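(* Let $(X,\Delta)$ be a log smooth surface which is a quotient of the form $(\mathbb{P}^2/G,\Delta_G)$ for a finite group $G\subseteq\mathrm{PGL}(3,\mathbb{C})$. Then $X=\mathbb{P}^2$, and there exists an integer $m\ge1$ such that $$\Delta=\Bigl(1-\frac1m\Bigr)(H_0+H_1+H_2),$$ where $H_0,H_1,H_2$ are hyperplanes (lines) in general position. In particular, $G=\mu_m\times\mu_m$, where the action on $\mathbb{P}^2$ is, up to conjugation by an automorphism of $\mathbb{P}^2$, the action $$(\zeta_1,\zeta_2)\cdot[x_0:x_1:x_2]=[x_0:\zeta_1x_1:\zeta_2x_2].$$
   Context: Everything is over $\mathbb{C}$; $\mu_m$ is the group of $m$-th roots of unity in $\mathbb{C}$. For a finite subgroup $G\subseteq\mathrm{PGL}(3,\mathbb{C})$ with quotient map $\pi_G\colon\mathbb{P}^2\to\mathbb{P}^2/G$, the divisor $\Delta_G=\sum_i(1-\frac1{m_i})\Delta_i$ is the branching divisor: the $\Delta_i$ are the irreducible curves over which $\pi_G$ ramifies and $m_i\ge2$ is the ramification order over $\Delta_i$. The pair $(X,\Delta)$ being log smooth means that $X$ is smooth and the support of $\Delta$ is a simple normal crossing divisor. $(X,\Delta)$ being a quotient of this form means that there is an isomorphism $X\simeq\mathbb{P}^2/G$ carrying $\Delta$ to $\Delta_G$. *)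

(* Defs.v *)
From HB Require Import structures.
From mathcomp Require Import all_boot all_order all_algebra.
From mathcomp Require Import all_classical reals topology_structure.
From mathcomp Require Import quotient_topology.
From mathcomp Require Import mpoly complex.

Set Implicit Arguments.
Unset Strict Implicit.
Unset Printing Implicit Defensive.

Import GRing.Theory.

Local Open Scope classical_set_scope.
Local Open Scope quotient_scope.
Local Open Scope ring_scope.

(* A variety over K is represented, in the language of classical algebraic
   geometry, as a space with functions: a topological space with a sheaf of
   K-valued functions.  [regular U f] says that the restriction of the total
   function f to the open set U is a regular function on U; the values of f
   outside U are irrelevant. *)
HB.mixin Record isFunSpace (K : fieldType) X & Topological X := {
  regular : set X -> set (X -> K);
  regular_ext : forall U f g, (forall x, U x -> f x = g x) ->
    regular U f -> regular U g;
  regular_sub : forall U V f, open U -> open V -> V `<=` U ->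
    regular U f -> regular V f;
  regular_glue : forall U f, open U ->
    (forall x, U x -> exists V, [/\ open V, V x, V `<=` U & regular V f]) ->
    regular U f;
  regular_cst : forall U c, open U -> regular U (fun _ => c);
  regular_add : forall U f g, open U ->
    regular U f -> regular U g -> regular U (fun x => f x + g x);
  regular_mul : forall U f g, open U ->
    regular U f -> regular U g -> regular U (fun x => f x * g x);
  regular_inv : forall U f, open U -> regular U f ->
    open (U `&` [set x | f x != 0]) /\
    regular (U `&` [set x | f x != 0]) (fun x => (f x)^-1)
}.

#[short(type="funSpaceType")]
HB.structure Definition FunSpace (K : fieldType) :=
  {X of isFunSpace K X & Topological X}.

Definition morphism (K : fieldType) (X Y : funSpaceType K) (f : X -> Y) :=
  forall U : set Y, open U ->
    open (f @^-1` U) /\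
    forall h : Y -> K, regular U h -> regular (f @^-1` U) (h \o f).

Definition isomorphism (K : fieldType) (X Y : funSpaceType K) (f : X -> Y) :=
  exists g : Y -> X, [/\ cancel f g, cancel g f, morphism f & morphism g].

(* The quotient of a space with functions: a function on an open set U of the
   quotient is regular when its pullback to the preimage of U is. *)
Section QuotientFunSpace.
Variables (K : fieldType) (X : funSpaceType K) (Q0 : quotType X).
Local Notation Q := (quotient_topology Q0).

Definition quot_regular (U : set Q) : set (Q -> K) :=
  [set f : Q -> K | regular (\pi_Q @^-1` U) (f \o \pi_Q)].

Lemma open_quot (U : set Q) : open U = open (\pi_Q @^-1` U).
Proof. by []. Qed.

Fact quot_regular_ext U (f g : Q -> K) : (forall x, U x -> f x = g x) ->
  quot_regular U f -> quot_regular U g.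
Proof. by move=> fg; apply: regular_ext => x /= /fg. Qed.

Fact quot_regular_sub U V (f : Q -> K) : open U -> open V -> V `<=` U ->
  quot_regular U f -> quot_regular V f.
Proof. by rewrite !open_quot => oU oV VU; apply: regular_sub => // x /VU. Qed.

Fact quot_regular_glue U (f : Q -> K) : open U ->
  (forall x, U x ->
     exists V, [/\ open V, V x, V `<=` U & quot_regular V f]) ->
  quot_regular U f.
Proof.
move=> oU H; apply: regular_glue => // x /= /H[V [oV Vx VU rV]].
by exists (\pi_Q @^-1` V); split => // y /VU.
Qed.

Fact quot_regular_cst U (c : K) : open U -> quot_regular U (fun _ => c).
Proof. by move=> oU; apply: regular_cst. Qed.

Fact quot_regular_add U (f g : Q -> K) : open U ->
  quot_regular U f -> quot_regular U g -> quot_regular U (fun x => f x + g x).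
Proof. by move=> oU; apply: regular_add. Qed.

Fact quot_regular_mul U (f g : Q -> K) : open U ->
  quot_regular U f -> quot_regular U g -> quot_regular U (fun x => f x * g x).
Proof. by move=> oU; apply: regular_mul. Qed.

Fact quot_regular_inv U (f : Q -> K) : open U -> quot_regular U f ->
  open (U `&` [set x | f x != 0]) /\
  quot_regular (U `&` [set x | f x != 0]) (fun x => (f x)^-1).
Proof. by move=> oU /(regular_inv _ _ oU). Qed.

HB.instance Definition _ := isFunSpace.Build K Q
  quot_regular_ext quot_regular_sub quot_regular_glue quot_regular_cst
  quot_regular_add quot_regular_mul quot_regular_inv.

End QuotientFunSpace.

Section Dimension.
Variable X : topologicalType.

Definition irreducible_set (Z : set X) :=
  Z !=set0 /\
  forall A B, closed A -> closed B -> Z `<=` A `|` B -> Z `<=` A \/ Z `<=` B.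

Definition has_chain (n : nat) := exists c : 'I_n.+1 -> set X,
  (forall i, closed (c i) /\ irreducible_set (c i)) /\
  (forall i j : 'I_n.+1, (i < j)%N -> c i `<` c j).

Definition surface :=
  [/\ irreducible_set [set: X], has_chain 2 & ~ has_chain 3].

(* irreducible closed subsets of codimension one (X being irreducible) *)
Definition prime_divisor (Z : set X) :=
  [/\ closed Z, irreducible_set Z, Z != setT &
      forall W, closed W -> irreducible_set W -> Z `<=` W ->
        W = Z \/ W = setT].

Record Qdivisor := {
  coef :> set X -> rat;
  coef_prime : forall Z, coef Z != 0 -> prime_divisor Z;
  coef_finite : finite_set [set Z | coef Z != 0]
}.

End Dimension.

(* For Z irreducible closed, germs along Z are the elements of the local ring
   O_{X,Z}; they are represented by total functions that are regular on some
   open set meeting Z, and compared by [germ_eq Z].  The case Z = [set x]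
   is the local ring at the point x. *)
Section LocalRing.
Variables (K : fieldType) (X : funSpaceType K).
Implicit Types (Z D : set X) (f g : X -> K).

Definition germ Z : set (X -> K) :=
  [set f : X -> K | exists U, [/\ open U, U `&` Z !=set0 & regular U f]].

Definition germ_eq Z f g :=
  exists U, [/\ open U, U `&` Z !=set0 & forall y, U y -> f y = g y].

(* The ideal of D in O_{X,Z}; it is the maximal ideal when D = Z. *)
Definition vanishing Z D : set (X -> K) :=
  [set f : X -> K | exists U, [/\ open U, U `&` Z !=set0 &
                        forall y, U y -> D y -> f y = 0]].

Definition germ_unit Z f :=
  exists U, [/\ open U, U `&` Z !=set0, regular U f &
                forall y, U y -> f y != 0].

(* The ideal I of O_{X,Z} is generated by the germs s_0, ..., s_(n-1). *)
Definition generates Z (n : nat) (s : 'I_n -> X -> K) (I : set (X -> K)) :=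
  (forall i, germ Z (s i)) /\
  forall f, germ Z f ->
    (I f <-> exists a : 'I_n -> X -> K, (forall i, germ Z (a i)) /\
               germ_eq Z f (fun y => \sum_(i < n) a i y * s i y)).

Definition local_equation Z D (t : X -> K) :=
  generates Z (fun _ : 'I_1 => t) (vanishing Z D).

(* regular system of parameters at a point of a surface *)
Definition local_parameters (x : X) (u : 'I_2 -> X -> K) :=
  generates [set x] u (vanishing [set x] [set x]).

(* As X has dimension two, its local rings at points are regular exactly when
   their maximal ideals are generated by two elements. *)
Definition smooth_surface :=
  surface X /\ forall x : X, exists u, local_parameters x u.

(* simple normal crossings: near every point x, the components of the support
   passing through x are among the two coordinate curves of some regular
   system of parameters at x *)
Definition snc (Delta : Qdivisor X) := forall x : X, exists u,
  local_parameters x u /\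
  forall D, Delta D != 0 -> D x -> exists i, local_equation [set x] D (u i).

Definition log_smooth_surface (Delta : Qdivisor X) :=
  smooth_surface /\ snc Delta.

End LocalRing.

(* [ramification_index pi C e]: with D the image of the prime divisor C, a
   uniformizer of O_{X,D} pulls back to a unit times the e-th power of a
   uniformizer of O_{Y,C}. *)
Definition ramification_index (K : fieldType) (Y X : funSpaceType K)
    (pi : Y -> X) (C : set Y) (e : nat) :=
  exists t s w, [/\ local_equation (pi @` C) (pi @` C) t,
    local_equation C C s, germ_unit C w &
    germ_eq C (t \o pi) (fun y => w y * s y ^+ e)].

(* The coefficient 1 - 1/e of D in the branching divisor of a Galois covering
   pi, where e is the ramification index of pi along any prime divisor lying
   over D; it is 0 if pi is unramified over D or D is not a prime divisor. *)
Definition branch_coef (K : fieldType) (Y X : funSpaceType K) (pi : Y -> X)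
    (D : set X) : rat :=
  1 - (xget 1%N [set e | exists C, [/\ prime_divisor C, pi @` C = D &
                                       ramification_index pi C e]])%:R^-1.

Section ProjectivePlane.
Variable K : fieldType.

Definition nzvec := {v : 'cV[K]_3 | v != 0}.

Definition collinear (v w : nzvec) : bool :=
  `[< exists c : K, c != 0 /\ val v = c *: val w >].

Fact collinear_refl : reflexive collinear.
Proof. by move=> v; apply/asboolP; exists 1; rewrite oner_neq0 scale1r. Qed.

Fact collinear_sym : ssrbool.symmetric collinear.
Proof.
move=> v w; apply/asboolP/asboolP => -[c [c0 E]]; exists c^-1;
by rewrite invr_eq0 E scalerA mulVf ?scale1r.
Qed.

Fact collinear_trans : transitive collinear.
Proof.
move=> v u w /asboolP[c [c0 E]] /asboolP[d [d0 F]].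
by apply/asboolP; exists (c * d); rewrite mulf_neq0 // E F scalerA.
Qed.

Canonical collinear_equiv :=
  EquivRel collinear collinear_refl collinear_sym collinear_trans.

Definition P2 := {eq_quot collinear}.
HB.instance Definition _ := EqQuotient.on P2.
HB.instance Definition _ := Choice.on P2.

Definition coords (p : P2) : 'cV[K]_3 := val (repr p).

Fact const_vec_neq0 : const_mx 1 != 0 :> 'cV[K]_3.
Proof. by apply/cV0Pn; exists ord0; rewrite mxE oner_neq0. Qed.

(* The point with homogeneous coordinates v (junk value if v = 0) *)
Definition proj_pt (v : 'cV[K]_3) : P2 :=
  \pi_P2 (insubd (exist _ (const_mx 1) const_vec_neq0 : nzvec) v).

Definition hpt (x0 x1 x2 : K) : P2 :=
  proj_pt (\col_(i < 3) [:: x0; x1; x2]`_i).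

(* For F homogeneous the vanishing of [peval F p], and for F, G homogeneous
   of the same degree the quotient of [peval F p] by [peval G p], do not
   depend on the chosen coordinates of p. *)
Definition peval (F : {mpoly K[3]}) (p : P2) : K :=
  F.@[fun i => coords p i ord0].

Definition zariski_open (U : set P2) := exists S : set {mpoly K[3]},
  (forall F, S F -> exists d, F \is d.-homog) /\
  U = [set p | exists2 F, S F & peval F p != 0].

Fact zariski_openT : zariski_open setT.
Proof.
exists [set 1]; split=> [F ->|]; first by exists 0%N; apply: dhomog1.
apply/seteqP; split=> // p _; exists 1 => //.
by rewrite /peval meval1 oner_neq0.
Qed.

Fact zariski_openI : setI_closed zariski_open.
Proof.
move=> _ _ [S [hS ->]] [T [hT ->]].
exists [set H | exists F G, [/\ S F, T G & H = F * G]]; split.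
  move=> _ [F [G [/hS[d hF] /hT[e hG] ->]]].
  by exists (d + e)%N; apply: dhomogM.
apply/seteqP; split=> [p [[F SF Fp] [G TG Gp]]|p [_ [F [G [SF TG ->]]]]].
  by exists (F * G); [exists F, G | rewrite /peval mevalM mulf_neq0].
rewrite /peval mevalM mulf_eq0 negb_or => /andP[Fp Gp].
by split; [exists F | exists G].
Qed.

Fact zariski_open_bigU (I : Type) (f : I -> set P2) :
  (forall i, zariski_open (f i)) -> zariski_open (\bigcup_i f i).
Proof.
move=> /choice[S hS]; exists (\bigcup_i S i); split.
  by move=> F [i _ SF]; apply: (hS i).1.
apply/seteqP; split=> [p [i _]|p [F [i _ SF] Fp]].
  by rewrite (hS i).2 => -[F SF Fp]; exists F => //; exists i.
by exists i => //; rewrite (hS i).2; exists F.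
Qed.

HB.instance Definition _ := isOpenTopological.Build P2
  zariski_openT zariski_openI zariski_open_bigU.

Definition P2_regular (U : set P2) : set (P2 -> K) := [set f : P2 -> K |
  forall p, U p -> exists V : set P2, [/\ open V, V p &
    exists d (F G : {mpoly K[3]}), [/\ F \is d.-homog, G \is d.-homog &
      forall q, V q -> U q -> peval G q != 0 /\ f q = peval F q / peval G q]]].

Fact P2_regular_ext U f g : (forall x, U x -> f x = g x) ->
  P2_regular U f -> P2_regular U g.
Proof.
move=> fg rf p Up; have [V [oV Vp [d [F [G [hF hG H]]]]]] := rf p Up.
exists V; split=> //; exists d, F, G; split=> // q Vq Uq.
by rewrite -fg //; apply: H.
Qed.

Fact P2_regular_sub U V f : open U -> open V -> V `<=` U ->
  P2_regular U f -> P2_regular V f.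
Proof.
move=> _ _ VU rf p Vp; have [W [oW Wp [d [F [G [hF hG H]]]]]] := rf p (VU _ Vp).
by exists W; split=> //; exists d, F, G; split=> // q Wq /VU; apply: H.
Qed.

Fact P2_regular_glue U f : open U ->
  (forall x, U x -> exists V, [/\ open V, V x, V `<=` U & P2_regular V f]) ->
  P2_regular U f.
Proof.
move=> oU H p /H[V [oV Vp VU rV]].
have [W [oW Wp [d [F [G [hF hG E]]]]]] := rV p Vp.
exists (W `&` V); split=> //; first exact: openI.
by exists d, F, G; split=> // q [Wq Vq] _; apply: E.
Qed.

Fact P2_regular_cst U c : open U -> P2_regular U (fun _ => c).
Proof.
move=> oU p Up; exists setT; split=> //; first exact: openT.
exists 0%N, c%:MP, 1; split; [|exact: dhomog1|].
  by rewrite -[c%:MP]mulr1 mul_mpolyC dhomogZ // dhomog1.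
by move=> q _ _; rewrite /peval mevalC meval1 divr1 oner_neq0.
Qed.

Fact P2_regular_add U f g : open U ->
  P2_regular U f -> P2_regular U g -> P2_regular U (fun x => f x + g x).
Proof.
move=> oU rf rg p Up.
have [V [oV Vp [d [F [G [hF hG E]]]]]] := rf p Up.
have [V' [oV' Vp' [d' [F' [G' [hF' hG' E']]]]]] := rg p Up.
exists (V `&` V'); split=> //; first exact: openI.
exists (d + d')%N, (F * G' + F' * G), (G * G').
split; [|exact: dhomogM|].
  by apply: dhomogD; [|rewrite addnC]; apply: dhomogM.
move=> q [Vq Vq'] Uq; have [Gq ->] := E q Vq Uq; have [Gq' ->] := E' q Vq' Uq.
rewrite /peval mevalD !mevalM; split; first exact: mulf_neq0.
by rewrite addf_div.
Qed.

Fact P2_regular_mul U f g : open U ->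
  P2_regular U f -> P2_regular U g -> P2_regular U (fun x => f x * g x).
Proof.
move=> oU rf rg p Up.
have [V [oV Vp [d [F [G [hF hG E]]]]]] := rf p Up.
have [V' [oV' Vp' [d' [F' [G' [hF' hG' E']]]]]] := rg p Up.
exists (V `&` V'); split=> //; first exact: openI.
exists (d + d')%N, (F * F'), (G * G'); split; [exact: dhomogM..|].
move=> q [Vq Vq'] Uq; have [Gq ->] := E q Vq Uq; have [Gq' ->] := E' q Vq' Uq.
rewrite /peval !mevalM; split; first exact: mulf_neq0.
by rewrite mulf_div.
Qed.

Fact open_peval_neq0 d (F : {mpoly K[3]}) : F \is d.-homog ->
  open [set p | peval F p != 0].
Proof.
move=> hF; exists [set F]; split=> [_ ->|]; first by exists d.
by apply/seteqP; split=> [p Fp|p [_ -> //]]; exists F.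
Qed.

Fact P2_regular_inv U f : open U -> P2_regular U f ->
  open (U `&` [set x | f x != 0]) /\
  P2_regular (U `&` [set x | f x != 0]) (fun x => (f x)^-1).
Proof.
move=> oU rf; split.
  rewrite openE => p [Up fp].
  have [V [oV Vp [d [F [G [hF hG E]]]]]] := rf p Up.
  rewrite /interior nbhsE; exists (U `&` V `&` [set q | peval F q != 0]).
    split; first by apply: openI (open_peval_neq0 hF); apply: openI.
    split=> //=; apply: contraNneq fp => Fp.
    by rewrite (E p Vp Up).2 Fp mul0r.
  move=> q [[Uq Vq] /= Fq]; split=> //=.
  have [Gq ->] := E q Vq Uq; by rewrite mulf_neq0 // invr_eq0.
move=> p [Up fp]; have [V [oV Vp [d [F [G [hF hG E]]]]]] := rf p Up.
exists V; split=> //; exists d, G, F; split=> // q Vq [Uq /= fq].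
have [Gq Eq] := E q Vq Uq; rewrite Eq invf_div; split=> //.
by apply: contraNneq fq => Fq; rewrite Eq Fq mul0r.
Qed.

HB.instance Definition _ := isFunSpace.Build K P2
  P2_regular_ext P2_regular_sub P2_regular_glue P2_regular_cst
  P2_regular_add P2_regular_mul P2_regular_inv.

Definition line (H : set P2) := exists a : 'rV[K]_3,
  a != 0 /\ H = [set p | a *m coords p = 0].

Definition general_position (H : 'I_3 -> set P2) :=
  injective H /\ \bigcap_i H i = set0.

Definition GL3 := {A : 'M[K]_3 | A \in unitmx}.

Definition GL3_1 : GL3 := exist _ 1%:M (unitmx1 K 3).

Fact GL3_mul_subproof (A B : GL3) : val A *m val B \in unitmx.
Proof. by rewrite unitmx_mul (valP A) (valP B). Qed.
Definition GL3_mul (A B : GL3) : GL3 :=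
  exist (fun M : 'M[K]_3 => M \in unitmx) _ (GL3_mul_subproof A B).

Fact GL3_inv_subproof (A : GL3) : invmx (val A) \in unitmx.
Proof. by rewrite unitmx_inv (valP A). Qed.
Definition GL3_inv (A : GL3) : GL3 :=
  exist (fun M : 'M[K]_3 => M \in unitmx) _ (GL3_inv_subproof A).

Definition homothetic (A B : GL3) : bool :=
  `[< exists c : K, c != 0 /\ val A = c *: val B >].

Fact homothetic_refl : reflexive homothetic.
Proof. by move=> A; apply/asboolP; exists 1; rewrite oner_neq0 scale1r. Qed.

Fact homothetic_sym : ssrbool.symmetric homothetic.
Proof.
move=> A B; apply/asboolP/asboolP => -[c [c0 E]]; exists c^-1;
by rewrite invr_eq0 E scalerA mulVf ?scale1r.
Qed.

Fact homothetic_trans : transitive homothetic.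
Proof.
move=> B A D /asboolP[c [c0 E]] /asboolP[d [d0 F]].
by apply/asboolP; exists (c * d); rewrite mulf_neq0 // E F scalerA.
Qed.

Canonical homothetic_equiv :=
  EquivRel homothetic homothetic_refl homothetic_sym homothetic_trans.

Definition PGL3 := {eq_quot homothetic}.
HB.instance Definition _ := EqQuotient.on PGL3.
HB.instance Definition _ := Choice.on PGL3.

Lemma eq_PGL3 (A B : GL3) (c : K) : c != 0 -> val A = c *: val B ->
  \pi_PGL3 A = \pi_PGL3 B.
Proof. by move=> c0 E; apply/eqmodP/asboolP; exists c. Qed.

Lemma pi_PGL3 (A B : GL3) : val A = val B -> \pi_PGL3 A = \pi_PGL3 B.
Proof. by move=> /val_inj ->. Qed.

Lemma repr_PGL3 (A : GL3) :
  exists c : K, c != 0 /\ val (repr (\pi_PGL3 A)) = c *: val A.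
Proof. by apply/asboolP; rewrite -[asbool _]/(homothetic _ _) -eqmodE reprK. Qed.

Definition PGL3_mul (g h : PGL3) : PGL3 := \pi_PGL3 (GL3_mul (repr g) (repr h)).
Definition PGL3_inv (g : PGL3) : PGL3 := \pi_PGL3 (GL3_inv (repr g)).
Definition PGL3_1 : PGL3 := \pi_PGL3 GL3_1.

Lemma PGL3_mulE (A B : GL3) :
  PGL3_mul (\pi_PGL3 A) (\pi_PGL3 B) = \pi_PGL3 (GL3_mul A B).
Proof.
have [c [c0 E]] := repr_PGL3 A; have [d [d0 F]] := repr_PGL3 B.
apply: (@eq_PGL3 _ _ (c * d)); first exact: mulf_neq0.
by rewrite /= E F -scalemxAl -scalemxAr scalerA.
Qed.

Fact PGL3_mulA : associative PGL3_mul.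
Proof.
move=> x y z; elim/quotW: x => x; elim/quotW: y => y; elim/quotW: z => z.
rewrite (PGL3_mulE y z) (PGL3_mulE x y) PGL3_mulE PGL3_mulE.
by apply: pi_PGL3; rewrite /= mulmxA.
Qed.

Fact PGL3_mul1 : left_id PGL3_1 PGL3_mul.
Proof.
move=> x; elim/quotW: x => x.
by rewrite PGL3_mulE; apply: pi_PGL3; rewrite /= mul1mx.
Qed.

Fact PGL3_mulr1 : right_id PGL3_1 PGL3_mul.
Proof.
move=> x; elim/quotW: x => x.
by rewrite PGL3_mulE; apply: pi_PGL3; rewrite /= mulmx1.
Qed.

Fact PGL3_mulV : left_inverse PGL3_1 PGL3_inv PGL3_mul.
Proof.
move=> x; rewrite -[x in PGL3_mul _ x]reprK PGL3_mulE.
by apply: pi_PGL3; rewrite /= mulVmx // (valP (repr x)).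
Qed.

Fact PGL3_mulrV : right_inverse PGL3_1 PGL3_inv PGL3_mul.
Proof.
move=> x; rewrite -[x in PGL3_mul x]reprK PGL3_mulE.
by apply: pi_PGL3; rewrite /= mulmxV // (valP (repr x)).
Qed.

HB.instance Definition _ := isGroup.Build PGL3
  PGL3_mulA PGL3_mul1 PGL3_mulr1 PGL3_mulV PGL3_mulrV.

Definition PGL3_act (g : PGL3) (p : P2) : P2 :=
  proj_pt (val (repr g) *m coords p).

End ProjectivePlane.

Record finSubgroup (gT : groupType) := {
  fsubg :> set gT;
  fsubg_finite : finite_set fsubg;
  fsubg1 : fsubg 1%g;
  fsubgM : forall x y, fsubg x -> fsubg y -> fsubg (x * y)%g;
  fsubgV : forall x, fsubg x -> fsubg (x^-1)%g
}.

Section QuotientByGroup.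
Variable K : fieldType.

Lemma proj_ptZ (c : K) (v : 'cV[K]_3) : c != 0 -> v != 0 ->
  proj_pt (c *: v) = proj_pt v.
Proof.
move=> c0 v0; apply/eqmodP/asboolP; exists c; split=> //.
by rewrite !val_insubd scaler_eq0 (negPf c0) (negPf v0).
Qed.

Lemma coordsK (p : P2 K) : proj_pt (coords p) = p.
Proof. by rewrite /proj_pt /coords valKd reprK. Qed.

Lemma coords_neq0 (p : P2 K) : coords p != 0.
Proof. exact: (valP (repr p)). Qed.

Lemma coords_proj_pt (v : 'cV[K]_3) : v != 0 ->
  exists c : K, c != 0 /\ coords (proj_pt v) = c *: v.
Proof.
move=> v0; have : collinear (repr (proj_pt v))
    (insubd (exist _ (const_mx 1) (const_vec_neq0 K) : nzvec K) v).
  by rewrite -eqmodE reprK.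
by move=> /asboolP; rewrite val_insubd v0.
Qed.

Lemma GL3_mulv_neq0 (A : GL3 K) (v : 'cV[K]_3) : v != 0 -> val A *m v != 0.
Proof.
apply: contraNneq => Av0.
by rewrite -[v]mul1mx -(mulVmx (valP A)) -mulmxA Av0 mulmx0.
Qed.

Lemma PGL3_actE (A : GL3 K) (v : 'cV[K]_3) : v != 0 ->
  PGL3_act (\pi_(PGL3 K) A) (proj_pt v) = proj_pt (val A *m v).
Proof.
move=> v0; rewrite /PGL3_act.
have [c [c0 ->]] := repr_PGL3 A; have [d [d0 ->]] := coords_proj_pt v0.
rewrite -scalemxAl -scalemxAr scalerA proj_ptZ //; first exact: mulf_neq0.
exact: GL3_mulv_neq0.
Qed.

Lemma PGL3_act1 (p : P2 K) : PGL3_act 1%g p = p.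
Proof.
by rewrite -[p]coordsK PGL3_actE ?coords_neq0 //= mul1mx.
Qed.

Lemma PGL3_actM (g h : PGL3 K) (p : P2 K) :
  PGL3_act (g * h)%g p = PGL3_act g (PGL3_act h p).
Proof.
rewrite -[g]reprK -[h]reprK -[p]coordsK.
rewrite [X in PGL3_act X _](PGL3_mulE (repr g) (repr h)).
have p0 := coords_neq0 p; have hp0 := GL3_mulv_neq0 (repr h) p0.
rewrite (PGL3_actE (GL3_mul _ _) p0) (PGL3_actE _ p0).
by rewrite (PGL3_actE _ hp0) mulmxA.
Qed.

Variable G : finSubgroup (PGL3 K).

Definition same_orbit (p q : P2 K) : bool :=
  `[< exists2 g, fsubg G g & q = PGL3_act g p >].

Fact same_orbit_refl : reflexive same_orbit.
Proof.
by move=> p; apply/asboolP; exists 1%g; [exact: fsubg1|rewrite PGL3_act1].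
Qed.

Fact same_orbit_sym : ssrbool.symmetric same_orbit.
Proof.
by move=> p q; apply/asboolP/asboolP => -[g Gg ->]; exists g^-1%g;
  rewrite -?PGL3_actM ?mulVg ?PGL3_act1 //; exact: fsubgV.
Qed.

Fact same_orbit_trans : transitive same_orbit.
Proof.
move=> q p r /asboolP[g Gg ->] /asboolP[h Gh ->]; apply/asboolP.
by exists (h * g)%g; [exact: fsubgM|rewrite PGL3_actM].
Qed.

Canonical same_orbit_equiv :=
  EquivRel same_orbit same_orbit_refl same_orbit_sym same_orbit_trans.

Definition P2quot : Type := quotient_topology {eq_quot same_orbit}.
HB.instance Definition _ := FunSpace.on P2quot.
HB.instance Definition _ := Quotient.on P2quot.

Definition piG : P2 K -> P2quot := \pi_P2quot.

(* (X, Delta) is isomorphic to the quotient pair (P2 / G, Delta_G) *)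
Definition quotient_pair (X : funSpaceType K) (Delta : Qdivisor X) :=
  exists phi : X -> P2quot, isomorphism phi /\
    forall Z, prime_divisor Z -> Delta Z = branch_coef piG (phi @` Z).

End QuotientByGroup.

Definition mu {K : fieldType} (m : nat) : set K := [set z : K | m.-unity_root z].

(* rho is an isomorphism of mu_m x mu_m onto G; the action of G on P2 that it
   gives is conjugate, by an automorphism of P2, to the diagonal action. *)
Definition diagonal_action (K : fieldType) (m : nat)
    (G : finSubgroup (PGL3 K)) :=
  exists rho : K * K -> PGL3 K,
    [/\ set_bij (mu m `*` mu m) G rho,
        forall z w, (mu m `*` mu m) z -> (mu m `*` mu m) w ->
          rho (z.1 * w.1, z.2 * w.2) = (rho z * rho w)%g &
        exists g : P2 K -> P2 K, isomorphism g /\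
          forall z, (mu m `*` mu m) z ->
          forall x0 x1 x2 : K, [|| x0 != 0, x1 != 0 | x2 != 0] ->
            PGL3_act (rho z) (g (hpt x0 x1 x2)) =
            g (hpt x0 (z.1 * x1) (z.2 * x2))].

(* Main.v *)
From mathcomp Require Import all_boot all_order all_algebra.
From mathcomp Require Import all_classical reals topology_structure.
From mathcomp Require Import quotient_topology mpoly complex ring zify spectral perm.
From mathcomp Require Import separable cyclotomic cyclic.
Require Import Defs.

(** Let p be a point of the plane. By Maschke's theorem its stabilizer in G
    acts linearly, as a group H, on an affine chart centered at p
    ([linearization]). If the quotient is smooth at the image of p, then the
    invariants of H are generated, locally at the origin, by two elements
    ([smooth_generators]). If h in G fixes a line pointwise, then the quotient
    branches along the image of this line ([mirror_ramified]): otherwise the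
    pullback of a uniformizer would be an invariant function with a simple
    zero along the line, and h would be a transvection, of infinite order. So
    normal crossings say that every reflection axis of H is contained in the
    zero locus of one of the two generators.

    This determines H ([snc_quotient_diagonal]). The generators may be replaced
    by homogeneous ones, f1 and f2. Their Jacobian vanishes exactly to order
    e - 1 on an axis whose stabilizer has order e, whereas f1 or f2 vanishes
    there to order e. As the Jacobian has degree deg f1 + deg f2 - 2, there are
    at most two axes; and in suitable coordinates f1 and f2 have leading terms
    x^e1 and y^e2, so that H is the diagonal group mu_e1 x mu_e2. All point
    stabilizers of G are thus products of two groups of homologies of a
    triangle ([snc_standard_stabilizer]).

    It follows that G is diagonal ([diagonal_subgroup]). Two mirrors meet in a
    point, whose stabilizer is commutative; so any two homologies in G commute,
    and all the stabilizers with two nontrivial factors coincide. Every element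
    of G has a fixed point and belongs to such a stabilizer. Hence G fixes a
    triangle, and comparing the stabilizers of its vertices shows that the two
    factors have the same order m.

    Finally, the quotient of the plane by mu_m x mu_m is the plane, by the map
    that raises the homogeneous coordinates to the m-th power
    ([quotient_is_plane]): a fraction of forms that is invariant under roots of
    unity on each coordinate can be written with forms in the m-th powers. Its
    ramification index is m along the sides of the triangle ([side_index]).
    Along any other curve C it is one ([other_index]), since otherwise an
    equation of least degree of the image of C would have derivatives that
    vanish on this image. This computes the branch divisor
    ([branch_coef_plane]). *)

Set Implicit Arguments.
Unset Strict Implicit.
Unset Printing Implicit Defensive.

Import Order.TTheory GRing.Theory Num.Theory.

Local Open Scope classical_set_scope.
Local Open Scope quotient_scope.
Local Open Scope ring_scope.

(** * Polynomial functions and their restriction to lines *)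

Section PolynomialFunctions.
Variable K : numClosedFieldType.

Definition ev n (F : {mpoly K[n]}) (v : 'cV[K]_n) : K := F.@[fun i => v i 0].

Lemma mpoly_closed n (P : {mpoly K[n]} -> Prop) :
  (forall c, P c%:MP) -> (forall i, P 'X_i) ->
  (forall F G, P F -> P G -> P (F + G)) ->
  (forall F G, P F -> P G -> P (F * G)) -> forall F, P F.
Proof.
move=> PC PX PD PM F; rewrite [F]mpolyE.
apply: (big_ind P) => [||m _]; [by rewrite -mpolyC0|exact: PD|].
rewrite -mul_mpolyC; apply: (PM _ _) => //; rewrite mpolyXE_id.
apply: (big_ind P) => [||i _]; [by rewrite -mpolyC1|exact PM|].
elim: (m i) => [|k IHk]; first by rewrite expr0 -mpolyC1.
by rewrite exprS; apply: PM.
Qed.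

Section Evaluation.
Variable n : nat.
Implicit Types (F G : {mpoly K[n]}) (v w : 'cV[K]_n).

Lemma ev0 v : ev 0 v = 0. Proof. exact: meval0. Qed.
Lemma ev1 v : ev 1 v = 1. Proof. exact: meval1. Qed.
Lemma evC c v : ev c%:MP v = c. Proof. exact: mevalC. Qed.
Lemma evX i v : ev 'X_i v = v i 0. Proof. exact: mevalXU. Qed.
Lemma evD F G v : ev (F + G) v = ev F v + ev G v. Proof. exact: mevalD. Qed.
Lemma evN F v : ev (- F) v = - ev F v. Proof. exact: mevalN. Qed.
Lemma evB F G v : ev (F - G) v = ev F v - ev G v. Proof. exact: mevalB. Qed.
Lemma evZ c F v : ev (c *: F) v = c * ev F v. Proof. exact: mevalZ. Qed.
Lemma evM F G v : ev (F * G) v = ev F v * ev G v. Proof. exact: mevalM. Qed.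
Lemma evXn F k v : ev (F ^+ k) v = ev F v ^+ k. Proof. exact: rmorphXn. Qed.
Lemma ev_sum (I : Type) (r : seq I) (P : pred I) (E : I -> {mpoly K[n]}) v :
  ev (\sum_(i <- r | P i) E i) v = \sum_(i <- r | P i) ev (E i) v.
Proof. exact: raddf_sum. Qed.
Lemma ev_prod (I : Type) (r : seq I) (P : pred I) (E : I -> {mpoly K[n]}) v :
  ev (\prod_(i <- r | P i) E i) v = \prod_(i <- r | P i) ev (E i) v.
Proof. exact: rmorph_prod. Qed.
Lemma ev_at0 F : ev F 0 = F@_0%MM.
Proof.
elim/mpoly_closed: F => [c|i|F G HF HG|F G HF HG].
- by rewrite evC mcoeffC eqxx mulr1.
- rewrite evX mxE mcoeffX; case: eqP => // /(congr1 (fun m => mdeg m)).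
  by rewrite mdeg1 mdeg0.
- by rewrite evD HF HG mcoeffD.
- by rewrite evM HF HG [RHS]rmorphM.
Qed.

Definition evE := (ev0, ev1, evC, evX, evD, evN, evB, evZ, evM, evXn).

(** [along v w F] is the polynomial s |-> F (v + s w). *)
Definition along v w F : {poly K} :=
  mmap (@polyC K) (fun i => (v i 0)%:P + w i 0 *: 'X) F.

Lemma alongC v w c : along v w c%:MP = c%:P. Proof. exact: mmapC. Qed.
Lemma along1 v w : along v w 1 = 1. Proof. by rewrite -mpolyC1 alongC. Qed.
Lemma alongX v w i : along v w 'X_i = (v i 0)%:P + w i 0 *: 'X.
Proof. by rewrite /along mmapX mmap1U. Qed.
Lemma alongD v w F G : along v w (F + G) = along v w F + along v w G.
Proof. exact: mmapD. Qed.
Lemma alongM v w F G : along v w (F * G) = along v w F * along v w G.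
Proof. by apply: (mmap_is_multiplicative _ _).1. Qed.
Lemma alongZ v w c F : along v w (c *: F) = c *: along v w F.
Proof. by rewrite /along mmapZ mul_polyC. Qed.

Lemma horner_along v w F s : (along v w F).[s] = ev F (v + s *: w).
Proof.
elim/mpoly_closed: F => [c|i|F G HF HG|F G HF HG].
- by rewrite alongC hornerC evC.
- by rewrite alongX evX !hornerE !mxE [_ * s]mulrC.
- by rewrite alongD evD hornerD HF HG.
- by rewrite alongM evM hornerM HF HG.
Qed.

Lemma coef0_along v w F : (along v w F)`_0 = ev F v.
Proof. by rewrite -horner_coef0 horner_along scale0r addr0. Qed.

Lemma deriv_along v w F :
  (along v w F)^`() = \sum_i w i 0 *: along v w F^`M(i).
Proof.
elim/mpoly_closed: F => [c|i|F G HF HG|F G HF HG].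
- rewrite alongC derivC big1 // => i _.
  by rewrite mderivC -mpolyC0 alongC scaler0.
- rewrite alongX !derivE (bigD1 i) //= big1 ?addr0 => [|j ji].
    rewrite mderivX mnm1E eqxx scale1r -{1}(add0m (U_(i))%MM) addmK mpolyX0 along1.
    by rewrite add0r alg_polyC.
  rewrite mderivX mnm1E eq_sym (negPf ji) scale0r.
  by rewrite -mpolyC0 alongC scaler0.
- rewrite alongD derivD HF HG -big_split; apply: eq_bigr => i _ /=.
  by rewrite mderivD alongD scalerDr.
- rewrite alongM derivM HF HG mulr_suml mulr_sumr -big_split.
  apply: eq_bigr => i _ /=.
  by rewrite mderivM alongD !alongM scalerDr scalerAl scalerAr.
Qed.

Lemma poly_nonroot (p : {poly K}) : p != 0 -> exists x, p.[x] != 0.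
Proof.
move=> p0; apply: contrapT => H.
have R (x : K) : root p x.
  by rewrite /root; apply/negPn/negP => px; apply: H; exists x.
pose s := [seq k%:R : K | k <- iota 0 (size p)].
have := @max_poly_roots _ p s p0; rewrite size_map size_iota ltnn.
move=> H1; suff: false by []; apply: H1; first by apply/allP => x _.
rewrite map_inj_uniq ?iota_uniq // => i j /eqP.
by rewrite eqr_nat => /eqP.
Qed.

Lemma poly_fun0 (p : {poly K}) : (forall x, p.[x] = 0) -> p = 0.
Proof.
by move=> H; apply/eqP; apply/negPn/negP => /poly_nonroot[x]; rewrite H eqxx.
Qed.

(** A polynomial is determined by its values: the coefficients are read off
    from the iterated partial derivatives at the origin. *)
Lemma ev_eq0 F : (forall v, ev F v = 0) -> F = 0.
Proof.
move=> F0; apply/mpolyP => m; rewrite mcoeff0.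
move: {2}(mdeg m) (erefl (mdeg m)) => d.
elim: d m F F0 => [|d IHd] m F F0 dm.
  by have/eqP := dm; rewrite mdeg_eq0 => /eqP ->; rewrite -ev_at0 F0.
have [i mi]: exists i, m i != 0%N.
  apply: contrapT => H; have: mdeg m == 0%N.
    rewrite mdeg_eq0; apply/eqP/mnmP => i; rewrite mnm0E.
    by apply/eqP/negPn/negP => mi; apply: H; exists i.
  by rewrite dm.
have Em : m = ((m - U_(i)) + U_(i))%MM.
  by rewrite submK //; apply/mnm_lepP => j; rewrite mnm1E; case: eqP => [<-|];
     rewrite ?lt0n.
have D0 v : ev F^`M(i) v = 0.
  have := deriv_along v (delta_mx i 0) F.
  rewrite (@poly_fun0 (along _ _ F)) => [|x]; last by rewrite horner_along.
  rewrite deriv0 (bigD1 i) //= big1 ?addr0 => [|j ji].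
    rewrite mxE !eqxx scale1r => /(congr1 (fun p : {poly K} => p`_0)).
    by rewrite coef0_along coef0 => <-.
  by rewrite mxE (negPf ji) scale0r.
have := mcoeff_mderiv i F (m - U_(i))%MM; rewrite -Em IHd //; last first.
  by have := dm; rewrite {1}Em mdegD mdeg1 addn1 => -[].
by move/esym/eqP; rewrite mulrn_eq0 /= => /eqP.
Qed.

Lemma ev_inj F G : (forall v, ev F v = ev G v) -> F = G.
Proof.
move=> H; apply/eqP; rewrite -subr_eq0; apply/eqP/ev_eq0 => v.
by rewrite evB H subrr.
Qed.

Lemma ev_nonzero F : F != 0 -> exists v, ev F v != 0.
Proof.
move=> F0; apply: contrapT => H; move/eqP: F0; apply; apply: ev_eq0 => v.
by apply/eqP; apply/negPn/negP => Fv; apply: H; exists v.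
Qed.

Lemma ev_neq0 F v : ev F v != 0 -> F != 0.
Proof. by apply: contraNneq => ->; rewrite ev0. Qed.

Lemma ev_eq_off F G Q : Q != 0 ->
  (forall v, ev Q v != 0 -> ev F v = ev G v) -> F = G.
Proof.
move=> Q0 H; apply/eqP; rewrite -subr_eq0.
have: (F - G) * Q == 0.
  apply/eqP/ev_eq0 => v; rewrite evM evB.
  by have [->|/H ->] := eqVneq (ev Q v) 0; rewrite ?mulr0 ?subrr ?mul0r.
by rewrite mulf_eq0 (negPf Q0) orbF.
Qed.

Lemma ev_homog F d c v : F \is d.-homog -> ev F (c *: v) = c ^+ d * ev F v.
Proof.
move=> hF; rewrite /ev !mevalE mulr_sumr big_seq [RHS]big_seq.
apply: eq_bigr => m /(dhomog_mf hF) /= dm.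
rewrite mulrCA; congr (_ * _); rewrite -dm mdegE -prodrXr -big_split /=.
by apply: eq_bigr => i _; rewrite mxE exprMn.
Qed.

Definition hc d F := pihomog mdeg d F.

Lemma hc_homog d F : hc d F \is d.-homog. Proof. exact: pihomogP. Qed.
Lemma hcD d F G : hc d (F + G) = hc d F + hc d G. Proof. exact: pihomogD. Qed.
Lemma hcB d F G : hc d (F - G) = hc d F - hc d G. Proof. exact: pihomogB. Qed.
Lemma hc0 d : hc d 0 = 0. Proof. exact: pihomog0. Qed.
Lemma hcZ d c F : hc d (c *: F) = c *: hc d F. Proof. exact: linearZ. Qed.
Lemma hc_sum d (I : Type) (r : seq I) (P : pred I) (E : I -> {mpoly K[n]}) :
  hc d (\sum_(i <- r | P i) E i) = \sum_(i <- r | P i) hc d (E i).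
Proof. exact: raddf_sum. Qed.
Lemma hc_id d F : F \is d.-homog -> hc d F = F. Proof. exact: pihomog_dE. Qed.
Lemma hc_ne d e F : d != e -> F \is d.-homog -> hc e F = 0.
Proof. exact: pihomog_ne0. Qed.
Lemma hc_hc d e F : hc e (hc d F) = if d == e then hc d F else 0.
Proof.
case: eqP => [<-|/eqP de]; first by rewrite hc_id ?hc_homog.
by rewrite (hc_ne de) ?hc_homog.
Qed.
Lemma hc_partition F k : (msize F <= k)%N -> F = \sum_(d < k) hc d F.
Proof. exact: pihomog_partitionE. Qed.

Lemma hcM d F G :
  hc d (F * G) = \sum_(i < d.+1) hc i F * hc (d - i)%N G.
Proof.
pose k := maxn (maxn (msize F) (msize G)) d.+1.
have EF : F = \sum_(i < k) hc i F by apply: hc_partition; rewrite /k; lia.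
have EG : G = \sum_(i < k) hc i G by apply: hc_partition; rewrite /k; lia.
rewrite {1}EF {1}EG mulr_suml hc_sum.
have -> : \sum_(i < d.+1) hc i F * hc (d - i)%N G =
   \sum_(i < k | (i < d.+1)%N) hc i F * hc (d - i)%N G.
  by rewrite (big_ord_widen k (fun i => hc i F * hc (d - i)%N G)) // /k; lia.
rewrite [RHS]big_mkcond /=; apply: eq_bigr => i _.
rewrite mulr_sumr hc_sum.
have H (j : 'I_k) : hc d (hc i F * hc j G) =
    if (i + j == d)%N then hc i F * hc j G else 0.
  have hij := dhomogM (hc_homog i F) (hc_homog j G).
  by case: eqP => [<-|/eqP ne]; [rewrite hc_id|rewrite (hc_ne ne)].
rewrite (eq_bigr _ (fun j _ => H j)) -big_mkcond /=.
case: ifP => di; last by rewrite big_pred0 // => j; lia.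
have ltk : (d - i < k)%N by rewrite /k; lia.
rewrite (big_pred1 (Ordinal ltk)) // => j.
by rewrite /= -(inj_eq val_inj) /=; apply/eqP/eqP; lia.
Qed.

Lemma hc_degree0 F : hc 0 F = (ev F 0)%:MP.
Proof.
apply: ev_inj => v; rewrite evC.
have := ev_homog 0 v (hc_homog 0 F); rewrite expr0 mul1r scale0r => <-.
rewrite [in RHS](@hc_partition F (msize F).+1) // big_ord_recl /= evD.
rewrite [X in _ = _ + X]ev_sum [X in _ = _ + X]big1 ?addr0 // => i _; rewrite -(scale0r (0 : 'cV_n)).
by rewrite (ev_homog _ _ (hc_homog _ _)) expr0n /= mul0r.
Qed.

End Evaluation.

Definition psub n k (q : 'I_n -> {mpoly K[k]}) (F : {mpoly K[n]}) :=
  F \mPo [tuple q i | i < n].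

Lemma ev_psub n k (q : 'I_n -> {mpoly K[k]}) F v :
  ev (psub q F) v = ev F (\col_i ev (q i) v).
Proof.
rewrite /ev comp_mpoly_meval; apply: meval_eq => i.
by rewrite tnth_map tnth_ord_tuple mxE.
Qed.

Definition lform n (a : 'rV[K]_n) : {mpoly K[n]} := \sum_i a 0 i *: 'X_i.

Lemma ev_lform n (a : 'rV[K]_n) v : ev (lform a) v = (a *m v) 0 0.
Proof.
by rewrite ev_sum mxE; apply: eq_bigr => i _; rewrite evZ evX.
Qed.

Lemma lform_homog n (a : 'rV[K]_n) : lform a \is 1.-homog.
Proof.
apply: rpred_sum => i _; apply: rpredZ.
by rewrite dhomogX /= mdeg1.
Qed.

Definition lsub n k (A : 'M[K]_(n, k)) (F : {mpoly K[n]}) : {mpoly K[k]} :=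
  psub (fun i => lform (row i A)) F.

Lemma ev_lsub n k (A : 'M[K]_(n, k)) F v : ev (lsub A F) v = ev F (A *m v).
Proof.
rewrite ev_psub; congr (ev F _); apply/colP => i; rewrite mxE ev_lform.
by rewrite -row_mul mxE.
Qed.

Lemma psub_homog n k (q : 'I_n -> {mpoly K[k]}) e F d :
  (forall i, q i \is e.-homog) -> F \is d.-homog ->
  psub q F \is (e * d).-homog.
Proof.
move=> hq hF; rewrite /psub comp_mpolyEX big_seq; apply: rpred_sum => m.
move=> /(dhomog_mf hF) /= dm; apply: rpredZ; rewrite comp_mpolyX.
have -> : (e * d = \sum_(i < n) e * m i)%N by rewrite -big_distrr /= -mdegE dm.
elim/big_ind2: _ => [|x1 d1 x2 d2 h1 h2|i _]; first exact: dhomog1.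
  exact: dhomogM.
by rewrite tnth_map tnth_ord_tuple; apply: dhomogMn.
Qed.

Lemma lsub_homog n k (A : 'M[K]_(n, k)) F d :
  F \is d.-homog -> lsub A F \is d.-homog.
Proof.
move=> hF; rewrite -[d]mul1n; apply: psub_homog => // i.
exact: lform_homog.
Qed.

End PolynomialFunctions.

(** * Invariants of a finite linear group and their generators *)

Lemma perm_map_self (T : eqType) (s : seq T) (f : T -> T) :
  uniq s -> injective f -> {in s, forall x, f x \in s} -> perm_eq (map f s) s.
Proof.
move=> us inj fs; have u : uniq (map f s) by rewrite map_inj_uniq.
have sub : {subset map f s <= s} by move=> y /mapP[x xs ->]; apply: fs.
apply: uniq_perm => // y; have [|_ ->] := uniq_min_size u sub => //.
by rewrite size_map.
Qed.

Section FiniteMatrixGroup.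
Variables (K : numClosedFieldType) (n : nat) (H : seq 'M[K]_n).

Definition matrix_group := [/\ uniq H, 1%:M \in H,
  {in H &, forall M N, M *m N \in H} & {in H, forall M, M \in unitmx}].

Hypothesis gH : matrix_group.

Lemma matrix_group_translate M : M \in H ->
  perm_eq [seq N *m M | N <- H] H.
Proof.
case: gH => Hu _ HM HU HMin; apply: perm_map_self => // [A B|A HA].
  by move=> /(congr1 (mulmx^~ (invmx M))); rewrite !mulmxK ?HU.
exact: HM.
Qed.

Lemma matrix_groupV M : M \in H -> invmx M \in H.
Proof.
move=> HMin; case: gH => Hu H1 HM HU.
have: 1%:M \in [seq N *m M | N <- H].
  by rewrite (perm_mem (matrix_group_translate HMin)).
case/mapP => N NH E; suff -> : invmx M = N by [].
by rewrite -[N](mulmxK (HU _ HMin)) -E mul1mx.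
Qed.

Definition inv (f : {mpoly K[n]}) :=
  {in H, forall M v, ev f (M *m v) = ev f v}.

Lemma invC c : inv c%:MP. Proof. by move=> M _ v; rewrite !evC. Qed.
Lemma invM f g : inv f -> inv g -> inv (f * g).
Proof. by move=> hf hg M HM v; rewrite !evM hf ?hg. Qed.
Lemma invZ c f : inv f -> inv (c *: f).
Proof. by move=> hf M HM v; rewrite !evZ hf. Qed.
Lemma invB f g : inv f -> inv g -> inv (f - g).
Proof. by move=> hf hg M HM v; rewrite !evB hf ?hg. Qed.

Lemma inv_hc d f : inv f -> inv (hc d f).
Proof.
move=> hf M HM v.
pose p w := \poly_(e < (maxn (msize f) d.+1)) ev (hc e f) w.
have pE w t : (p w).[t] = ev f (t *: w).
  rewrite horner_poly [in RHS](@hc_partition _ _ f (maxn (msize f) d.+1)); last by lia.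
  rewrite ev_sum; apply: eq_bigr => i _.
  by rewrite (ev_homog _ _ (hc_homog _ _)) mulrC.
have: p (M *m v) - p v = 0.
  by apply: poly_fun0 => t; rewrite hornerD hornerN !pE scalemxAr hf // subrr.
move/eqP; rewrite subr_eq0 => /eqP/(congr1 (fun q : {poly K} => q`_d)).
by rewrite !coef_poly leq_maxr.
Qed.

Lemma inv_norm (L : 'M[K]_n -> {mpoly K[n]}) :
  {in H, forall M N v, ev (L N) (M *m v) = ev (L (N *m M)) v} ->
  inv (\prod_(M <- H) L M).
Proof.
move=> HL M HM v; rewrite !ev_prod.
rewrite -[RHS](perm_big _ (matrix_group_translate HM)) /= big_map.
by rewrite big_seq [RHS]big_seq; apply: eq_bigr => N HN; rewrite HL.
Qed.

(** [idl] is the augmentation ideal of the ring of invariants; [dec N] is its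
    square, up to terms of degree at least N. The truncation makes room for
    generators that are only local at the origin. *)
Definition idl f := inv f /\ ev f 0 = 0.

Definition dec N g := exists s : seq ({mpoly K[n]} * {mpoly K[n]}),
  (forall p, p \in s -> idl p.1 /\ idl p.2) /\
  forall d, (d < N)%N -> hc d (g - \sum_(p <- s) p.1 * p.2) = 0.

Lemma idl_hc d f : idl f -> idl (hc d f).
Proof.
move=> [hf f0]; split; first exact: inv_hc.
case: d => [|d]; first by rewrite hc_degree0 f0 evC.
by rewrite -(scale0r (0 : 'cV_n)) (ev_homog _ _ (hc_homog _ _)) expr0n mul0r.
Qed.

Variable N : nat.

Lemma dec_small g : (forall d, (d < N)%N -> hc d g = 0) -> dec N g.
Proof. by move=> Hg; exists [::]; split=> // d dN; rewrite big_nil subr0 Hg. Qed.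

Lemma decD f g : dec N f -> dec N g -> dec N (f + g).
Proof.
move=> [s [hs Es]] [t [ht Et]]; exists (s ++ t); split.
  by move=> p; rewrite mem_cat => /orP[/hs|/ht].
move=> d dN; rewrite big_cat /= opprD addrACA hcD Es // Et //; exact: addr0.
Qed.

Lemma decZ c f : dec N f -> dec N (c *: f).
Proof.
move=> [s [hs Es]]; exists [seq (c *: p.1, p.2) | p <- s]; split.
  move=> _ /mapP[p /hs[[i1 z1] h2] ->]; split=> //; split; first exact: invZ.
  by rewrite evZ z1 mulr0.
move=> d dN; rewrite big_map /=.
under eq_bigr do rewrite -scalerAl.
by rewrite -scaler_sumr -scalerBr hcZ Es // scaler0.
Qed.

Lemma dec_mul a b : idl a -> idl b -> dec N (a * b).
Proof.
move=> ha hb; exists [:: (a, b)]; split; first by move=> p; rewrite inE => /eqP ->.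
by move=> d _; rewrite big_seq1 subrr hc0.
Qed.

Definition spans y z := forall g, idl g ->
  exists c1 c2, dec N (g - c1 *: y - c2 *: z).

Lemma spans_sym y z : spans y z -> spans z y.
Proof.
by move=> yz g /yz[c1 [c2 h]]; exists c2, c1; rewrite addrAC.
Qed.

(** Either some component of y involves y modulo the square of the ideal, and
    may replace it, or all its components are multiples of z, and then so is
    y. *)
Lemma spans_exchange y z : idl y -> spans y z -> exists d, spans (hc d y) z.
Proof.
move=> hy yz.
have [[d [a [b [a0 hab]]]]|none] :=
  pselect (exists d a b, a != 0 /\ dec N (hc d y - a *: y - b *: z)).
  exists d => g /yz[c1 [c2 h]]; exists (c1 / a), (c2 - c1 / a * b).
  have -> : g - (c1 / a) *: hc d y - (c2 - c1 / a * b) *: z =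
    (g - c1 *: y - c2 *: z) + (- (c1 / a)) *: (hc d y - a *: y - b *: z).
    have : c1 = c1 / a * a by rewrite divfK.
    move: (c1 / a) => t ->.
    by rewrite -!mul_mpolyC mpolyCB mpolyCN !mpolyCM; ring.
  exact: decD h (decZ _ hab).
have /choice[b hb] : forall d, exists b, dec N (hc d y - b *: z).
  move=> d; have [a [b h]] := yz _ (idl_hc d hy); exists b.
  have a0 : a = 0 by apply/eqP/negPn/negP => a0; apply: none; exists d, a, b.
  by move: h; rewrite a0 scale0r subr0.
have hyz : dec N (y - (\sum_(d < N) b d) *: z).
  have -> : y - (\sum_(d < N) b d) *: z =
     (y - \sum_(d < N) hc d y) + \sum_(d < N) (hc d y - b d *: z).
    by rewrite sumrB scaler_suml addrA subrK.
  apply: decD.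
    apply: dec_small => d dN; rewrite hcB hc_sum.
    rewrite (bigD1 (Ordinal dN)) //= hc_hc eqxx big1 ?addr0 ?subrr // => i ne.
    by rewrite hc_hc; case: eqP => // ed; rewrite -(inj_eq val_inj) /= ed eqxx in ne.
  elim/big_ind: _ => //; last by move=> ? ?; apply: decD.
  by apply: dec_small => d _; rewrite hc0.
exists 0%N => g /yz[c1 [c2 h]]; exists 0, (c2 + c1 * \sum_(d < N) b d).
have -> : g - 0 *: hc 0 y - (c2 + c1 * \sum_(d < N) b d) *: z =
  (g - c1 *: y - c2 *: z) + c1 *: (y - (\sum_(d < N) b d) *: z).
  by rewrite scale0r scalerBr scalerDl scalerA; ring.
exact: decD h (decZ _ hyz).
Qed.

Lemma spans_components y z : idl y -> idl z -> spans y z ->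
  exists d e, spans (hc d y) (hc e z).
Proof.
move=> hy hz yz; have [d h] := spans_exchange hy yz.
have [e h'] := spans_exchange hz (spans_sym h).
by exists d, e; apply: spans_sym.
Qed.

(** The maximal ideal of the invariants needs two generators only locally,
    i.e. up to an invariant E that does not vanish at the origin; this
    suffices to generate modulo the square of the ideal. *)
Lemma spans_local U1 U2 : idl U1 -> idl U2 ->
  (forall g, idl g -> exists E A1 A2, [/\ inv E, ev E 0 != 0, inv A1, inv A2 &
     forall d, (d < N)%N -> hc d (E * g - (A1 * U1 + A2 * U2)) = 0]) ->
  spans U1 U2.
Proof.
move=> h1 h2 HS g hg; have [E [A1 [A2 [hE E0 hA1 hA2 HN]]]] := HS g hg.
exists (ev A1 0 / ev E 0), (ev A2 0 / ev E 0).
have idlB f : inv f -> idl (f - (ev f 0)%:MP).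
  by move=> hf; split; [apply: invB => //; apply: invC | rewrite evB evC subrr].
have -> : g - (ev A1 0 / ev E 0) *: U1 - (ev A2 0 / ev E 0) *: U2 =
  (ev E 0)^-1 *: ((E * g - (A1 * U1 + A2 * U2)) +
     ((-1) *: ((E - (ev E 0)%:MP) * g) + ((A1 - (ev A1 0)%:MP) * U1 +
      (A2 - (ev A2 0)%:MP) * U2))).
  rewrite ![_ / _]mulrC -[g in LHS]scale1r -(mulVf E0) -!scalerA -!scalerBr.
  congr (_ *: _).
  by rewrite mulVf // scaleN1r -!mul_mpolyC; ring.
apply/decZ/decD; first exact: dec_small.
apply: decD; first by apply/decZ/dec_mul => //; apply: idlB.
by apply: decD; apply: dec_mul => //; apply: idlB.
Qed.

(** By induction on the degree: an invariant of degree d is a combination of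
    f1, f2 and products of invariants of smaller positive degree, so that
    Leibniz's rule propagates the vanishing of the derivation from f1 and f2
    to all invariants. *)
Lemma derivation_spans d1 d2 f1 f2 v (delta : {mpoly K[n]} -> K) :
  spans f1 f2 -> f1 \is d1.-homog -> f2 \is d2.-homog ->
  {morph delta : f g / f + g} -> (forall c f, delta (c *: f) = c * delta f) ->
  (forall f g, inv f -> inv g ->
     delta (f * g) = ev f v * delta g + delta f * ev g v) ->
  delta f1 = 0 -> delta f2 = 0 ->
  forall f, inv f -> (forall d, (N <= d)%N -> hc d f = 0) -> delta f = 0.
Proof.
move=> sp h1 h2 dD dZ dM d10 d20.
have d00 : delta 0 = 0 by rewrite -(scale0r 0) dZ mul0r.
have dsum (I : Type) (r : seq I) (E : I -> {mpoly K[n]}) :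
    delta (\sum_(i <- r) E i) = \sum_(i <- r) delta (E i).
  by apply: (big_morph delta dD d00).
have dC c : delta c%:MP = 0.
  have i1 : inv 1 by rewrite -mpolyC1; apply: invC.
  have /eqP := dM _ _ i1 i1; rewrite mulr1 !ev1 mulr1 mul1r -subr_eq0.
  rewrite opprD addrA subrr sub0r oppr_eq0 => /eqP delta1.
  by rewrite -[c%:MP]mulr1 mul_mpolyC dZ delta1 mulr0.
have dhc d e f : f \is e.-homog -> delta f = 0 -> delta (hc d f) = 0.
  move=> hf df; have [<-|ne] := eqVneq e d; first by rewrite hc_id.
  by rewrite (hc_ne ne).
have step d f : (d < N)%N -> inv f -> f \is d.-homog -> delta f = 0.
  elim/ltn_ind: d f => d IH f dN hf df.
  case: d IH dN df => [|d] IH dN df.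
    by rewrite -(hc_id df) hc_degree0 dC.
  have f0 : ev f 0 = 0.
    by rewrite -(scale0r (0 : 'cV_n)) (ev_homog _ _ df) expr0n mul0r.
  have [c1 [c2 [s [hs Es]]]] := sp f (conj hf f0).
  have := Es _ dN; rewrite !hcB !hcZ (hc_id df) => /eqP; rewrite subr_eq0 => /eqP E.
  have -> : f = \sum_(p <- s) hc d.+1 (p.1 * p.2) +
      (c1 *: hc d.+1 f1 + c2 *: hc d.+1 f2).
    by rewrite -hc_sum -E; ring.
  rewrite dD dsum big_seq big1 ?add0r; last first.
    move=> p /hs[hp1 hp2]; rewrite hcM dsum big1 // => i _.
    have [i0|i0] := posnP i.
      by rewrite i0 hc_degree0 hp1.2 mpolyC0 mul0r.
    have [id|id] := eqVneq (val i) d.+1.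
      by rewrite id subnn hc_degree0 hp2.2 mpolyC0 mulr0.
    have lti : (i < d.+1)%N by rewrite ltn_neqAle id -ltnS ltn_ord.
    have i1 : inv (hc i p.1) by apply: inv_hc; case: hp1.
    have i2 : inv (hc (d.+1 - i) p.2) by apply: inv_hc; case: hp2.
    have small j : (j < d.+1)%N -> (j < N)%N.
      by move=> jd; apply: ltn_trans jd dN.
    have ltdi : (d.+1 - i < d.+1)%N by rewrite ltn_subrL i0.
    have e1 := IH _ lti _ (small _ lti) i1 (hc_homog _ _).
    have e2 := IH _ ltdi _ (small _ ltdi) i2 (hc_homog _ _).
    by rewrite dM // e1 e2 mulr0 mul0r addr0.
  by rewrite dD !dZ (dhc _ _ _ h1 d10) (dhc _ _ _ h2 d20) !mulr0 addr0.
move=> f hf fN; rewrite (hc_partition (leqnn (msize f))) dsum big1 // => i _.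
have [iN|/fN ->] := ltnP i N; last exact: d00.
by apply: step iN _ (hc_homog _ _); apply: inv_hc.
Qed.

End FiniteMatrixGroup.

(** * Binary forms, Jacobians and orders of vanishing along lines *)

Section Lines.
Variables (K : numClosedFieldType) (n : nat).
Implicit Types (F : {mpoly K[n]}) (v w : 'cV[K]_n).

Lemma along_affine v w (a : 'rV[K]_n) c :
  along v w (lform a - c%:MP) = ((a *m v) 0 0 - c)%:P + (a *m w) 0 0 *: 'X.
Proof.
apply/eqP; rewrite -subr_eq0; apply/eqP; apply: poly_fun0 => s.
rewrite hornerD hornerN horner_along evB evC ev_lform mulmxDr -scalemxAr.
by rewrite !hornerE [in X in X - _]mxE [X in _ + X - c - _]mxE; ring.
Qed.

Lemma along_prod v w (I : Type) (r : seq I) (P : pred I) (E : I -> {mpoly K[n]}) :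
  along v w (\prod_(i <- r | P i) E i) = \prod_(i <- r | P i) along v w (E i).
Proof. exact: (big_morph _ (alongM v w) (along1 v w)). Qed.

Lemma size_along F d v w : F \is d.-homog -> (size (along v w F) <= d.+1)%N.
Proof.
move=> hF; rewrite /along /mmap; apply: (leq_trans (size_sum _ _ _)).
apply/bigmax_leqP_seq => m /(dhomog_mf hF) /= dm _.
apply: leq_trans (size_polyMleq _ _) _.
have: (size (mmap1 (fun i => (v i 0)%:P + w i 0 *: 'X)%R m) <= (mdeg m).+1)%N.
  rewrite mdegE /mmap1; elim/big_ind2: _ => [|p1 k1 p2 k2 h1 h2|i _].
  - by rewrite size_poly1.
  - by apply: leq_trans (size_polyMleq _ _) _; move: h1 h2; lia.
  apply: leq_trans (size_poly_exp_leq _ _) _; rewrite ltnS.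
  have: (size ((v i 0)%:P + w i 0 *: 'X)%R <= 2)%N.
    rewrite (leq_trans (size_polyD _ _)) // geq_max.
    by rewrite (leq_trans (size_polyC_leq1 _)) // (leq_trans (size_scale_leq _ _)) // size_polyX.
  by case: size => [|[|[|]]] //=; rewrite ?mul0n ?mul1n.
rewrite dm => h; rewrite -subn1 leq_subLR; apply: (@leq_trans (1 + d.+1)%N) => //; apply: leq_add => //.
exact: size_polyC_leq1.
Qed.

(** Both sides are polynomials in a; for a nonzero a, homogeneity reduces the
    identity to the restriction of F to the line v + K w. *)
Lemma ev_plane F d v w a b : F \is d.-homog ->
  ev F (a *: v + b *: w) =
  \sum_(i < d.+1) (along v w F)`_i * a ^+ (d - i) * b ^+ i.
Proof.
move=> hF.
pose p := along (b *: w) v F.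
pose q := \sum_(i < d.+1) ((along v w F)`_i * b ^+ i) *: 'X^(d - i).
suff -> : ev F (a *: v + b *: w) = q.[a].
  rewrite /q horner_sum; apply: eq_bigr => i _.
  by rewrite hornerZ hornerXn mulrAC.
rewrite addrC -horner_along -/p; suff -> : p = q by [].
apply/eqP; rewrite -subr_eq0.
have: (p - q) * 'X == 0.
  apply/eqP/poly_fun0 => t; rewrite hornerM hornerX.
  have [->|t0] := eqVneq t 0; first by rewrite mulr0.
  rewrite hornerD hornerN horner_along.
  have -> : b *: w + t *: v = t *: (v + (b / t) *: w).
    by rewrite scalerDr scalerA mulrCA divff // mulr1 addrC.
  rewrite (ev_homog _ _ hF) -horner_along (horner_coef_wide _ (size_along v w hF)).
  rewrite /q horner_sum mulr_sumr (eq_bigr (fun i : 'I_d.+1 =>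
    ((along v w F)`_i * b ^+ i *: 'X^(d - i)).[t])) ?subrr ?mul0r // => i _.
  rewrite hornerZ hornerXn exprMn exprVn.
  have -> : t ^+ d = t ^+ (d - i) * t ^+ i by rewrite -exprD subnK // -ltnS.
  move: (expf_neq0 i t0); move: (t ^+ i) (t ^+ (d - i)) (b ^+ i) => x y z x0.
  rewrite mulrCA -!mulrA; congr (_ * _).
  by rewrite [z * x^-1]mulrC mulVKf // mulrC.
by rewrite mulf_eq0 polyX_eq0 orbF.
Qed.

Lemma along_top F d v w : F \is d.-homog -> (along v w F)`_d = ev F w.
Proof.
move=> hF; have := ev_plane v w 0 1 hF; rewrite scale0r add0r scale1r => ->.
rewrite big_ord_recr /= subnn expr0 expr1n !mulr1 big1 ?add0r // => i _.
by rewrite expr0n subn_eq0 leqNgt ltn_ord mulr0 mul0r.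
Qed.

(** The order of vanishing of a form at v is the same along every line through
    v, as long as one starts from a transversal one: [ev_plane] writes the
    restriction to v + K (a v + b w0) as a combination of powers t^i with i at
    least m, up to factors 1 + a t. *)
Lemma along_order F d m v w0 a b : F \is d.-homog ->
  (forall k, (k < m)%N -> (along v w0 F)`_k = 0) ->
  forall k, (k < m)%N -> (along v (a *: v + b *: w0) F)`_k = 0.
Proof.
move=> hF H0 k km.
have -> : along v (a *: v + b *: w0) F = 'X^m *
   \sum_(i < d.+1 | (m <= i)%N)
      ((along v w0 F)`_i * b ^+ i) *: ((1 + a *: 'X) ^+ (d - i) * 'X^(i - m)).
  apply/eqP; rewrite -subr_eq0; apply/eqP/poly_fun0 => t.
  rewrite hornerD hornerN horner_along.
  have -> : v + t *: (a *: v + b *: w0) = (1 + t * a) *: v + (t * b) *: w0.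
    by rewrite scalerDl scalerDr !scalerA scale1r addrA.
  rewrite (ev_plane _ _ _ _ hF) hornerM hornerXn horner_sum mulr_sumr.
  rewrite (bigID (fun i : 'I_d.+1 => (m <= i)%N)) /= addrC big1 ?add0r; last first.
    by move=> i; rewrite -ltnNge => /H0 ->; rewrite !mul0r.
  rewrite -sumrB big1 // => i mi.
  rewrite hornerZ hornerM horner_exp hornerD hornerC hornerZ hornerX hornerXn.
  rewrite exprMn [t * a]mulrC.
  have -> : t ^+ i = t ^+ m * t ^+ (i - m) by rewrite -exprD subnKC.
  ring.
by rewrite coefXnM km.
Qed.

Lemma mderiv_homog F d i : F \is d.-homog -> F^`M(i) \is d.-1.-homog.
Proof.
move=> hF; rewrite /mderiv big_seq; apply: rpred_sum => m mF.
have dm := dhomog_mf hF mF.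
have [mi|mi] := eqVneq (m i) 0%N; first by rewrite mi mul0r scale0r rpred0.
have Em : m = ((m - U_(i)) + U_(i))%MM.
  by rewrite submK //; apply/mnm_lepP => j; rewrite mnm1E; case: eqP => [<-|];
     rewrite ?lt0n.
have := congr1 (fun x : 'X_{1..n} => mdeg x) Em.
by rewrite mdegD mdeg1 addn1 dm => ->; apply: rpredZ; rewrite dhomogX.
Qed.

Lemma along_self F d v : F \is d.-homog ->
  along v v F = ev F v *: (1 + 'X) ^+ d.
Proof.
move=> hF; apply/eqP; rewrite -subr_eq0; apply/eqP/poly_fun0 => t.
rewrite hornerD hornerN horner_along -{1}[v]scale1r -scalerDl.
by rewrite (ev_homog _ _ hF) hornerZ horner_exp !hornerE mulrC subrr.
Qed.

Lemma euler F d v : F \is d.-homog ->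
  \sum_i v i 0 * ev F^`M(i) v = d%:R * ev F v.
Proof.
move=> hF; have := deriv_along v v F.
move/(congr1 (fun p : {poly K} => p.[0])).
rewrite (along_self _ hF) horner_sum.
under eq_bigr do rewrite hornerZ horner_along scale0r addr0.
move=> <-.
rewrite derivZ deriv_exp derivD derivC derivX add0r hornerZ hornerMn.
by rewrite mul1r horner_exp !hornerE expr1n mulrC.
Qed.

End Lines.

Lemma big_ord2 (V : nmodType) (F : 'I_2 -> V) : \sum_i F i = F 0 + F 1.
Proof. by rewrite !big_ord_recl big_ord0 addr0; congr (F _ + F _); apply/val_inj. Qed.

Section Jacobian.
Variable K : numClosedFieldType.
Implicit Types (f g : {mpoly K[2]}) (v w : 'cV[K]_2).

Definition dt v w := v 0 0 * w 1 0 - v 1 0 * w 0 0.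

Definition jac f g := f^`M(0) * g^`M(1) - f^`M(1) * g^`M(0).

Lemma jac_homog f g d e : (0 < d)%N -> (0 < e)%N ->
  f \is d.-homog -> g \is e.-homog -> jac f g \is (d + e - 2).-homog.
Proof.
move=> d0 e0 hf hg; have -> : (d + e - 2 = d.-1 + e.-1)%N by lia.
by apply: rpredB; apply: dhomogM; apply: mderiv_homog.
Qed.

(** Euler's relation turns the Jacobian, restricted to a line, into a
    Wronskian of one-variable polynomials. *)
Lemma along_jac f g d e v w : f \is d.-homog -> g \is e.-homog ->
  dt v w *: along v w (jac f g) =
  d%:R *: (along v w f * (along v w g)^`()) - e%:R *: (along v w g * (along v w f)^`()).
Proof.
move=> hf hg; apply/eqP; rewrite -subr_eq0; apply/eqP/poly_fun0 => t.
rewrite !deriv_along !big_ord2.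
rewrite !(hornerD, hornerN, hornerZ, hornerM, horner_along) !evE.
have Ef := euler (v + t *: w) hf; have Eg := euler (v + t *: w) hg.
move: Ef Eg; rewrite !big_ord2 !mxE /dt; set x := v + _.
by rewrite !mulrA => <- <-; ring.
Qed.

Lemma ord2P (i : 'I_2) : i = 0 \/ i = 1.
Proof. by case: i => [[|[|//]] ?]; [left|right]; apply/val_inj. Qed.

Lemma dt_basis v w x : dt v w != 0 ->
  x = (dt x w / dt v w) *: v + (dt v x / dt v w) *: w.
Proof.
move=> d0; apply/colP => i; rewrite !mxE.
by have [->|->] := ord2P i; rewrite /dt; field; exact: d0.
Qed.

End Jacobian.

Section Stabilizers.
Variable K : numClosedFieldType.
Implicit Types (v w x : 'cV[K]_2) (M : 'M[K]_2).

Lemma det2E M : \det M = M 0 0 * M 1 1 - M 0 1 * M 1 0.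
Proof.
rewrite (expand_det_row _ 0) big_ord2 /cofactor !det_mx11 !mxE /=.
rewrite expr0 mul1r expr1 mulN1r mulrN.
by congr (_ * M _ _ - _ * M _ _); apply/val_inj.
Qed.

Lemma mulmx2E M v i : (M *m v) i 0 = M i 0 * v 0 0 + M i 1 * v 1 0.
Proof. by rewrite mxE big_ord2. Qed.

Lemma dtM M v w : dt (M *m v) (M *m w) = \det M * dt v w.
Proof. by rewrite /dt !mulmx2E det2E; ring. Qed.

Lemma dtDr v x y : dt v (x + y) = dt v x + dt v y.
Proof. by rewrite /dt !mxE; ring. Qed.
Lemma dtZr v c x : dt v (c *: x) = c * dt v x.
Proof. by rewrite /dt !mxE; ring. Qed.
Lemma dtvv v : dt v v = 0.
Proof. by rewrite /dt; ring. Qed.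
Lemma dtC v w : dt v w = - dt w v.
Proof. by rewrite /dt; ring. Qed.
Lemma dt0r v : dt v 0 = 0.
Proof. by rewrite /dt !mxE; ring. Qed.

Lemma dt_transversal v : v != 0 -> exists w, dt v w != 0.
Proof.
case/cV0Pn => i vi; have [i0|i1] := ord2P i.
  exists (delta_mx 1 0); rewrite /dt !mxE !eqxx mulr1 mulr0 subr0.
  by rewrite -i0.
exists (delta_mx 0 0); rewrite /dt !mxE !eqxx mulr1 mulr0 sub0r oppr_eq0.
by rewrite -i1.
Qed.

Lemma dt_eq0 v w : v != 0 -> dt v w = 0 -> exists c, w = c *: v.
Proof.
move=> /dt_transversal[x vx] vw; exists (dt w x / dt v x).
by rewrite {1}(dt_basis w vx) vw mul0r scale0r addr0.
Qed.

Lemma dt_neq0l v w : dt v w != 0 -> v != 0.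
Proof. by apply: contraNneq => ->; rewrite dtC dt0r oppr0. Qed.
Lemma dt_neq0r v w : dt v w != 0 -> w != 0.
Proof. by apply: contraNneq => ->; rewrite dt0r. Qed.

Lemma mx_eq_basis M N v w : dt v w != 0 ->
  M *m v = N *m v -> M *m w = N *m w -> M = N.
Proof.
move=> d0 Ev Ew; apply/matrixP => i j.
have E x : M *m x = N *m x.
  by rewrite (dt_basis x d0) !mulmxDr -!scalemxAr Ev Ew.
have := congr1 (fun y : 'cV_2 => y i 0) (E (delta_mx j 0)).
by rewrite -!colE !mxE.
Qed.

(** The product of the linear forms dual to the given vectors is a nonzero
    polynomial, so it has a nonzero value. *)
Lemma avoid n (s : seq 'cV[K]_n) : (forall x : 'cV[K]_n, x \in s -> x != 0) ->
  exists a : 'rV[K]_n, forall x : 'cV[K]_n, x \in s -> (a *m x) 0 0 != 0.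
Proof.
move=> s0; have: \prod_(x <- s) lform x^T != 0.
  rewrite prodf_seq_neq0; apply/allP => x /s0 x0 /=; apply: contraNneq x0 => E.
  apply/eqP/colP => i; rewrite mxE.
  have := ev_lform x^T (delta_mx i 0); rewrite E ev0 => /esym.
  by rewrite -colE !mxE.
case/ev_nonzero => b; rewrite ev_prod => /[dup] Hb _; exists b^T => x xs.
move: Hb; rewrite (big_rem x) //= mulf_eq0 negb_or => /andP[+ _].
by rewrite ev_lform -[in X in X -> _](trmxK b) -trmx_mul mxE.
Qed.

Section Group.
Variable H : seq 'M[K]_2.
Hypothesis gH : matrix_group H.

Definition stab v := [seq M <- H | M *m v == v].

Lemma stab_group v : matrix_group (stab v).
Proof.
case: gH => Hu H1 HM HU; split.
- exact: filter_uniq.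
- by rewrite mem_filter mul1mx eqxx.
- move=> M N; rewrite !mem_filter => /andP[/eqP Mv HMin] /andP[/eqP Nv HN].
  by rewrite -mulmxA Nv Mv eqxx HM.
- by move=> M; rewrite mem_filter => /andP[_ /HU].
Qed.

Lemma stabP v M : reflect (M *m v = v /\ M \in H) (M \in stab v).
Proof. by rewrite mem_filter; apply: (iffP andP) => -[/eqP]. Qed.

Lemma stab_gt0 v : (0 < size (stab v))%N.
Proof. by case: (stab_group v) => _; case: (stab v). Qed.

(** Averaging over the stabilizer with weight 1/det yields a common
    eigenvector outside the fixed line. *)
Lemma stab_center v : v != 0 ->
  exists w, dt v w != 0 /\ {in stab v, forall M, M *m w = \det M *: w}.
Proof.
move=> v0; have [w0 vw0] := dt_transversal v0.
have gS := stab_group v; have [Su S1 SM SU] := gS.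
have detU M : M \in stab v -> \det M != 0.
  by move=> /SU; rewrite unitmxE unitfE.
pose w := \sum_(M <- stab v) (\det M)^-1 *: (M *m w0); exists w; split.
  have -> : dt v w = \sum_(M <- stab v) dt v w0.
    rewrite /w big_seq [RHS]big_seq.
    apply: (big_ind2 (fun x y => dt v x = y)) => [|x1 x2 y1 y2 <- <-|M MS].
    - exact: dt0r.
    - exact: dtDr.
    - rewrite dtZr; have [Mv _] := stabP _ _ MS.
      by rewrite -{1}Mv dtM mulKf ?detU.
  rewrite big_const_seq count_predT iter_addr_0 -mulr_natr mulf_neq0 //.
  by rewrite pnatr_eq0 -lt0n stab_gt0.
move=> M MS.
have perm : perm_eq [seq M *m N | N <- stab v] (stab v).
  apply: perm_map_self => // [A B|A AS]; last exact: SM.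
  by move=> /(congr1 (mulmx (invmx M))); rewrite !mulKmx ?SU.
rewrite [in RHS]/w -(perm_big _ perm) big_map /= /w mulmx_sumr scaler_sumr.
rewrite big_seq [RHS]big_seq; apply: eq_bigr => N NS.
rewrite -scalemxAr mulmxA scalerA det_mulmx invfM mulVKf ?detU //.
Qed.

(** The common eigenvector makes the determinant injective on the stabilizer;
    it takes values in the roots of unity of exponent the order e of the
    stabilizer, of which a field has no more than e. *)
Lemma stab_det v : v != 0 ->
  {in stab v &, injective (fun M => \det M)} /\
  forall z : K, z ^+ size (stab v) = 1 <-> exists2 M, M \in stab v & \det M = z.
Proof.
move=> v0; have [w [vw Hw]] := stab_center v0.
have [Su S1 SM SU] := stab_group v.
have inj : {in stab v &, injective (fun M => \det M)}.
  move=> M N MS NS E; apply: (mx_eq_basis vw); last by rewrite !Hw // E.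
  by rewrite (stabP _ _ MS).1 (stabP _ _ NS).1.
split=> //; pose ds := [seq \det M | M <- stab v].
have du : uniq ds by rewrite map_inj_in_uniq.
have root z : z \in ds -> z ^+ size (stab v) = 1.
  case/mapP => M MS ->.
  have P0 : \prod_(N <- stab v) \det N != 0.
    rewrite prodf_seq_neq0; apply/allP => N NS /=.
    by have := SU _ NS; rewrite unitmxE unitfE.
  apply: (mulIf P0); rewrite mul1r.
  have perm := matrix_group_translate (stab_group v) MS.
  rewrite -[RHS](perm_big _ perm) /= big_map.
  under [RHS]eq_bigr do rewrite det_mulmx mulrC.
  by rewrite big_split /= big_const_seq count_predT iter_mulr mulr1.
move=> z; split=> [z1|[M MS <-]]; last by apply/root/map_f.
suff /mapP[M MS ->] : z \in ds by exists M.
apply: contraTT (leqnn (size ds)) => zn; rewrite -ltnNge.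
have -> : (size ds < size ds)%N = (size (z :: ds) <= size (stab v))%N.
  by rewrite /= !size_map.
apply: max_unity_roots (stab_gt0 v) _ _; last by rewrite /= zn.
apply/allP => y; rewrite inE => /orP[/eqP ->|/root yz]; exact/unity_rootP.
Qed.

Lemma stab_unity_dvd v k : v != 0 ->
  (forall z : K, z ^+ size (stab v) = 1 -> z ^+ k = 1) -> (size (stab v) %| k)%N.
Proof.
move=> v0; set e := size _ => Hk; have [inj dS] := stab_det v0.
rewrite /dvdn; apply/negPn/negP => r0; rewrite -lt0n in r0.
have e0 : (0 < e)%N := stab_gt0 v.
have Hr (z : K) : z ^+ e = 1 -> z ^+ (k %% e) = 1.
  move=> ze; have := Hk z ze; rewrite {1}(divn_eq k e) exprD mulnC exprM ze.
  by rewrite expr1n mul1r.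
pose ds := [seq \det M | M <- stab v].
have := @max_unity_roots _ _ ds r0; rewrite size_map -/e map_inj_in_uniq //.
have [Su _ _ _] := stab_group v.
move=> /(_ _ Su); rewrite leqNgt ltn_pmod // => H1; suff: false by []; apply: H1.
apply/allP => _ /mapP[M MS ->]; apply/unity_rootP/Hr/dS; by exists M.
Qed.

(** Replacing s by det M s in the restriction of an invariant to v + K w
    amounts to applying M, which changes nothing; so only powers of s
    divisible by the order of the stabilizer of v occur. *)
Lemma along_inv f v w k : v != 0 -> inv H f ->
  {in stab v, forall M, M *m w = \det M *: w} ->
  ~~ (size (stab v) %| k)%N -> (along v w f)`_k = 0.
Proof.
move=> v0 hf Hw; apply: contraNeq => fk; apply: stab_unity_dvd => // z.
case/(stab_det v0).2 => M MS Mz.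
have: along v (z *: w) f = along v w f.
  apply/eqP; rewrite -subr_eq0; apply/eqP/poly_fun0 => t.
  rewrite hornerD hornerN !horner_along.
  have [Mv MH] := stabP _ _ MS.
  have -> : v + t *: (z *: w) = M *m (v + t *: w).
    by rewrite mulmxDr Mv -scalemxAr Hw // Mz scalerA mulrC.
  by rewrite hf // subrr.
set p := along v w f => E.
have /(congr1 (fun q : {poly K} => q`_k)) : along v (z *: w) f =
    \poly_(i < size p) (p`_i * z ^+ i).
  apply/eqP; rewrite -subr_eq0; apply/eqP/poly_fun0 => t.
  rewrite hornerD hornerN horner_along horner_poly scalerA -horner_along -/p.
  rewrite horner_coef (eq_bigr (fun i : 'I_(size p) => p`_i * z ^+ i * t ^+ i)).
    by rewrite subrr.
  by move=> i _; rewrite exprMn; ring.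
rewrite E coef_poly; case: ltnP => [_|/(nth_default 0) pk]; last first.
  by rewrite /p pk eqxx in fk.
by move/eqP; rewrite -{1}[p`_k]mulr1 -subr_eq0 -mulrBr mulf_eq0 (negPf fk)
  subr_eq0 => /eqP.
Qed.

End Group.
End Stabilizers.

(** * The Jacobian of two generators *)

Section Degree.
Variables (K : numClosedFieldType) (n : nat).
Implicit Types f g : {mpoly K[n]}.

Definition degle k f := forall d, (k < d)%N -> hc d f = 0.

Lemma degleM k l f g : degle k f -> degle l g -> degle (k + l) (f * g).
Proof.
move=> hf hg d kld; rewrite hcM big1 // => i _.
have [ki|ik] := ltnP k i; first by rewrite hf ?mul0r.
by rewrite (hg (d - i)%N) ?mulr0 //; lia.
Qed.

Lemma degle_norm (I : Type) (r : seq I) (L : I -> {mpoly K[n]}) :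
  (forall i, degle 1 (L i)) -> degle (size r) (\prod_(i <- r) L i).
Proof.
move=> hL; elim: r => [|i r IHr].
  by rewrite big_nil => d d0; apply: (@hc_ne _ _ 0); [case: d d0|exact: dhomog1].
by rewrite big_cons -[size _]add1n; apply: degleM.
Qed.

Lemma degle_affine (a : 'rV[K]_n) c : degle 1 (lform a - c%:MP).
Proof.
move=> d d1; rewrite hcB (hc_ne _ (lform_homog a)); last by case: d d1 => [|[]].
rewrite (@hc_ne _ _ 0) ?subr0 //; first by case: d d1.
by rewrite -[c%:MP]mulr1 mul_mpolyC dhomogZ // dhomog1.
Qed.

End Degree.

Lemma prodZX (K : fieldType) (I : Type) (r : seq I) (c : I -> K) :
  \prod_(i <- r) (c i *: 'X) = (\prod_(i <- r) c i) *: 'X^(size r).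
Proof.
elim: r => [|i r IHr]; first by rewrite !big_nil expr0 scale1r.
by rewrite !big_cons IHr exprS -scalerAl -scalerAr scalerA.
Qed.

Section JacobianOrder.
Variables (K : numClosedFieldType) (H : seq 'M[K]_2) (N d1 d2 : nat).
Variables f1 f2 : {mpoly K[2]}.
Hypotheses (gH : matrix_group H) (sizeH : (size H < N)%N).
Hypotheses (h1 : f1 \is d1.-homog) (h2 : f2 \is d2.-homog).
Hypotheses (i1 : inv H f1) (i2 : inv H f2) (sp : spans H N f1 f2).
Implicit Types (v w : 'cV[K]_2).

Local Notation e v := (size (stab H v)).

Definition center v w :=
  dt v w != 0 /\ {in stab H v, forall M, M *m w = \det M *: w}.

Lemma center_coef v w f k : v != 0 -> center v w -> inv H f ->
  (0 < k < e v)%N -> (along v w f)`_k = 0.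
Proof.
move=> v0 [vw Hw] hf /andP[k0 ke]; apply: (along_inv gH v0 hf Hw).
by rewrite gtnNdvd.
Qed.

Lemma coef1M (p q : {poly K}) : (p * q)`_1 = p`_0 * q`_1 + p`_1 * q`_0.
Proof. by rewrite coefM !big_ord_recl big_ord0 addr0. Qed.

Lemma center_coefM v w f g : v != 0 -> center v w -> inv H f -> inv H g ->
  (along v w (f * g))`_(e v) =
  ev f v * (along v w g)`_(e v) + (along v w f)`_(e v) * ev g v.
Proof.
move=> v0 vw hf hg; rewrite alongM coefM -!(coef0_along v w).
have := stab_gt0 gH v; have := center_coef v0 vw hf.
case: (e v) => // k fk _; rewrite big_ord_recl big_ord_recr /= subn0 subnn.
rewrite big1 ?add0r // => i _; rewrite fk ?mul0r //.
by rewrite /bump /=; have := ltn_ord i; lia.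
Qed.

(** Generators cannot be killed by a nonzero combination of the derivative
    along v and of the leading coefficient transversally to the axis: such a
    combination is a derivation, hence kills all invariants, but it does not
    kill suitable norms of affine forms. *)
Lemma generators_separate v w al be : v != 0 -> center v w ->
  al * (along v v f1)`_1 + be * (along v w f1)`_(e v) = 0 ->
  al * (along v v f2)`_1 + be * (along v w f2)`_(e v) = 0 ->
  al = 0 /\ be = 0.
Proof.
move=> v0 vw E1 E2.
pose delta f := al * (along v v f)`_1 + be * (along v w f)`_(e v).
have kill f : inv H f -> degle (size H) f -> delta f = 0.
  move=> hf df; apply: (@derivation_spans _ _ _ _ _ _ _ _ v delta sp h1 h2 _ _ _ E1 E2) => //.
  - by move=> f' g; rewrite /delta !alongD !coefD; ring.
  - by move=> c g; rewrite /delta !alongZ !coefZ; ring.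
  - move=> f' g hf' hg; rewrite /delta alongM coef1M center_coefM //.
    by rewrite !coef0_along; ring.
  by move=> d Nd; apply: df; apply: leq_trans Nd.
have [HU H1 HM Hunit] := gH.
have nz M x : M \in H -> x != 0 -> M *m x != 0.
  move=> /Hunit MU; apply: contraNneq => Mx.
  by rewrite -[x](mulKmx MU) Mx mulmx0.
apply: contrapT => nab; have [dvw Hw] := vw.
have comb0 : al *: v + be *: w != 0.
  apply/eqP => E; apply: nab; split; apply: (mulIf dvw).
    have : dt w (al *: v + be *: w) = 0 by rewrite E dt0r.
    by rewrite dtDr !dtZr dtvv mulr0 addr0 dtC mulrN => /eqP; rewrite oppr_eq0 mul0r => /eqP.
  have : dt v (al *: v + be *: w) = 0 by rewrite E dt0r.
  by rewrite dtDr !dtZr dtvv mulr0 add0r mul0r.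
have [a Ha] : exists a : 'rV[K]_2, [/\ (a *m w) 0 0 != 0,
    (a *m (al *: v + be *: w)) 0 0 != 0,
    {in H, forall M, (a *m (M *m v)) 0 0 != 0} &
    {in H, forall M, M *m v != v -> (a *m (M *m v - v)) 0 0 != 0}].
  pose s := w :: (al *: v + be *: w) :: [seq M *m v | M <- H] ++
            [seq M *m v - v | M <- [seq M <- H | M *m v != v]].
  have [x|a Ha] := avoid (s := s).
    rewrite !inE mem_cat => /or3P[/eqP ->|/eqP ->//|/orP[]].
    - exact: dt_neq0r dvw.
    - by case/mapP => M MH ->; apply: nz.
    - by case/mapP => M; rewrite mem_filter => /andP[Mv _] ->; rewrite subr_eq0.
  exists a; split=> [||M MH|M MH Mv]; apply: Ha; rewrite !inE ?eqxx ?orbT //.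
    rewrite mem_cat; apply/or3P/Or33/orP; left.
    by apply/mapP; exists M.
  rewrite mem_cat; apply/or3P/Or33/orP; right; apply/mapP; exists M => //.
  by rewrite mem_filter Mv.
case: Ha => aw ac aM aMv.
have [be0|be0] := eqVneq be 0.
  have al0 : al != 0 by apply/eqP => al0; apply: nab.
  (* A norm of a linear form is homogeneous, so its derivative along v is a
     nonzero multiple of its value at v. *)
  pose F := \prod_(M <- H) (lform (a *m M) - 0%:MP).
  have hF : inv H F.
    apply: (inv_norm gH) => M MH M' x.
    by rewrite !evB !evC !ev_lform !mulmxA.
  have := kill F hF (degle_norm (fun M => degle_affine (a *m M) 0)).
  rewrite /delta be0 mul0r addr0 => /eqP; rewrite mulf_eq0 (negPf al0) /=.
  have -> : along v v F = (\prod_(M <- H) (a *m (M *m v)) 0 0) *: (1 + 'X) ^+ size H.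
    rewrite along_prod; elim: (H) => [|A s IHs]; first by rewrite !big_nil expr0 scale1r.
    rewrite !big_cons IHs along_affine subr0 -mulmxA -!mul_polyC polyCM.
    by rewrite -[size (A :: s)]/(size s).+1 exprS; ring.
  have c0 : \prod_(M <- H) (a *m (M *m v)) 0 0 != 0.
    by rewrite prodf_seq_neq0; apply/allP => M MH; apply: aM.
  rewrite coefZ mulf_eq0 (negPf c0) /=.
  have -> : ((1 + 'X) ^+ size H : {poly K})`_1 = (size H)%:R.
    rewrite -[_`_1]mulr1n -coef_deriv -horner_coef0 deriv_exp derivD derivC derivX.
    by rewrite add0r mul1r hornerMn horner_exp !hornerE expr1n.
  rewrite pnatr_eq0; apply/negP; rewrite -lt0n.
  by case: (H) H1.
(* The factors of this norm that vanish at v are those of the stabilizer of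
   v, so that it vanishes at v to order e v exactly. *)
pose F := \prod_(M <- H) (lform (a *m M) - ((a *m v) 0 0)%:MP).
have hF : inv H F.
  apply: (inv_norm gH) => M MH M' x.
  by rewrite !evB !evC !ev_lform !mulmxA.
have := kill F hF (degle_norm (fun M => degle_affine (a *m M) _)).
pose Q (u : 'cV[K]_2) := \prod_(M <- H | M *m v != v)
   ((((a *m M) *m v) 0 0 - (a *m v) 0 0)%:P + ((a *m M) *m u) 0 0 *: 'X).
have lineF u : along v u F = (\prod_(M <- stab H v) (a *m (M *m u)) 0 0) *:
     ('X^(e v) * Q u).
  rewrite along_prod (bigID (fun M : 'M[K]_2 => M *m v == v)) /= scalerAl.
  congr (_ * _); last by apply: eq_bigr => M _; rewrite along_affine.
  rewrite -big_filter -/(stab H v) -prodZX big_seq [RHS]big_seq.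
  apply: eq_bigr => M /stabP[Mv _].
  by rewrite along_affine -!mulmxA Mv subrr add0r.
pose q0 := \prod_(M <- H | M *m v != v) (a *m (M *m v - v)) 0 0.
have Q0 u : (Q u)`_0 = q0.
  rewrite -horner_coef0 horner_prod; apply: eq_bigr => M _.
  by rewrite !hornerE mulmxBr mulmxA [in RHS]mxE [X in _ = _ + X]mxE.
have q00 : q0 != 0.
  rewrite /q0 big_seq_cond prodf_seq_neq0; apply/allP => M MH; apply/implyP.
  by case/andP => _; apply: aMv.
rewrite /delta !lineF !coefZ !coefXnM ltnn subnn Q0.
have c0 : \prod_(M <- stab H v) (a *m (M *m w)) 0 0 != 0.
  rewrite prodf_seq_neq0; apply/allP => M MS /=.
  have [_ MH] := stabP _ _ _ MS.
  rewrite Hw // -scalemxAr mxE mulf_neq0 //.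
  by have := Hunit _ MH; rewrite unitmxE unitfE.
case: ltnP => [_|e1].
  by rewrite mulr0 mulr0 add0r => /eqP; rewrite !mulf_eq0 (negPf be0) (negPf c0) (negPf q00).
have Es : stab H v = [:: 1%:M].
  have : 1%:M \in stab H v by rewrite mem_filter mul1mx eqxx.
  by move: e1; case: (stab H v) => [|M []] //= _; rewrite inE => /eqP <-.
rewrite Es !big_seq1 !mul1mx subnn Q0 => /eqP; rewrite !mulrA -mulrDl.
rewrite mulf_eq0 (negPf q00) orbF; apply/negP; move: ac.
by rewrite mulmxDr -!scalemxAr !mxE.
Qed.

(** The Wronskian formula [along_jac] computes the coefficients of the
    Jacobian along v + K w; if the one of degree e - 1 vanished, the first
    order data of f1 and f2 at v would be proportional, against
    [generators_separate]. *)
Lemma jac_order v : v != 0 ->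
  exists w, center v w /\
    (forall k, (k < (e v).-1)%N -> (along v w (jac f1 f2))`_k = 0) /\
    (along v w (jac f1 f2))`_(e v).-1 != 0.
Proof.
move=> v0; have [w vw] := stab_center gH v0; exists w; split=> //.
have [dvw Hw] := vw.
have E := along_jac v w h1 h2.
have coefW f g k : inv H f -> (k < e v)%N ->
    (along v w f * (along v w g)^`())`_k = ev f v * (along v w g)`_k.+1 *+ k.+1.
  move=> hf ke; rewrite coefM big_ord_recl big1 ?addr0 => [|i _].
    by rewrite coef0_along subn0 coef_deriv mulrnAr.
  rewrite (center_coef v0 vw hf) ?mul0r // lift0 /=.
  exact: leq_ltn_trans (ltn_ord i) ke.
have e0 := stab_gt0 gH v.
split=> [k ke|].
  apply: (mulfI dvw); rewrite mulr0 -coefZ E coefB !coefZ !coefW //; try lia.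
  rewrite (center_coef v0 vw i1); last by lia.
  by rewrite (center_coef v0 vw i2) ?mulr0 ?mul0rn ?mulr0 ?subrr //; lia.
apply/eqP => J0; have: dt v w * (along v w (jac f1 f2))`_(e v).-1 = 0 by rewrite J0 mulr0.
rewrite -coefZ E coefB !coefZ !coefW ?prednK // -!mulrnAr => /eqP.
rewrite subr_eq0 => /eqP Edet.
have L1 f d : f \is d.-homog -> (along v v f)`_1 = d%:R * ev f v.
  move=> hf; rewrite (along_self _ hf) coefZ mulrC; congr (_ * _).
  rewrite -[_`_1]mulr1n -coef_deriv -horner_coef0 deriv_exp derivD derivC derivX.
  by rewrite add0r mul1r hornerMn horner_exp !hornerE expr1n.
set c1 := (along v w f1)`_(e v) in Edet *; set c2 := (along v w f2)`_(e v) in Edet *.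
have Edet' : d1%:R * ev f1 v * c2 = d2%:R * ev f2 v * c1.
  have en0 : (e v)%:R != 0 :> K by rewrite pnatr_eq0 -lt0n.
  by apply: (mulIf en0); rewrite -!mulrA !mulr_natr.
have sep := generators_separate v0 vw.
have [] := sep c1 (- (d1%:R * ev f1 v)).
  by rewrite (L1 _ _ h1) mulNr mulrC subrr.
  by rewrite (L1 _ _ h2) -/c2 mulNr Edet' mulrC subrr.
move=> c10 /eqP; rewrite oppr_eq0 => /eqP a10.
have [] := sep c2 (- (d2%:R * ev f2 v)).
  by rewrite (L1 _ _ h1) -/c1 mulNr a10 c10 !mulr0 subrr.
  by rewrite (L1 _ _ h2) -/c2 mulNr mulrC subrr.
move=> c20 /eqP; rewrite oppr_eq0 => /eqP a20.
have [] := sep 1 1; last by move=> /eqP; rewrite oner_eq0.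
  by rewrite (L1 _ _ h1) a10 -/c1 c10 !mulr0 addr0.
by rewrite (L1 _ _ h2) a20 -/c2 c20 !mulr0 addr0.
Qed.

End JacobianOrder.

(** * Linear groups in dimension two with smooth quotient and crossing axes *)

Section RootOrders.
Variable K : numClosedFieldType.

Lemma sum_count_mem (s rs : seq K) : uniq s ->
  (\sum_(r <- s) count_mem r rs = count (mem s) rs)%N.
Proof.
move=> us; elim: rs => [|z rs IHrs] /=; first by rewrite big1.
rewrite big_split /= IHrs; congr (_ + _)%N.
rewrite -(count_uniq_mem z us) -sum1_count [RHS]big_mkcond /=.
by apply: eq_bigr => r _; rewrite eq_sym; case: eqP.
Qed.

Lemma shifted_roots (rs : seq K) c r :
  let m := count_mem r rs in c != 0 ->
  let q := c *: \prod_(z <- rs) ('X + (r - z)%:P) in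
  (forall k, (k < m)%N -> q`_k = 0) /\ q`_m != 0.
Proof.
move=> m c0 q.
have -> : q = 'X^m * (c *: \prod_(z <- rs | z != r) ('X + (r - z)%:P)).
  rewrite /q (bigID (fun z => z == r)) /= -scalerAr; congr (_ *: (_ * _)).
  rewrite (eq_bigr (fun=> 'X)) => [|z /eqP ->]; last by rewrite subrr addr0.
  by rewrite big_const_seq iter_mulr mulr1.
split=> [k km|]; first by rewrite coefXnM km.
rewrite coefXnM ltnn subnn coefZ mulf_neq0 // -horner_coef0 horner_prod.
rewrite big_seq_cond prodf_seq_neq0; apply/allP => z _; apply/implyP => /andP[_ zr].
by rewrite !hornerE subr_eq0 eq_sym.
Qed.

(** The sequence rs lists the zeros of the restriction with multiplicity;
    translating the parameter to a zero turns its multiplicity into an order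
    of vanishing at the corresponding vector. *)
Lemma form_roots d (F : {mpoly K[2]}) v0 w0 : dt v0 w0 != 0 ->
  F \is d.-homog -> F != 0 ->
  exists rs : seq K, [/\ (size rs <= d)%N,
    ev F w0 != 0 -> size rs = d,
    forall r, (r \in rs) = (ev F (v0 + r *: w0) == 0) &
    forall r,
      (forall k, (k < count_mem r rs)%N -> (along (v0 + r *: w0) w0 F)`_k = 0) /\
      (along (v0 + r *: w0) w0 F)`_(count_mem r rs) != 0].
Proof.
move=> dvw hF F0; pose p := along v0 w0 F.
have p0 : p != 0.
  apply: contraNneq F0 => p0; apply/eqP/ev_eq0 => x.
  rewrite (dt_basis x dvw) (ev_plane _ _ _ _ hF) big1 // => i _.
  by rewrite -/p p0 coef0 !mul0r.
have [rs Ep] := closed_field_poly_normal p; exists rs.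
have lc0 : lead_coef p != 0 by rewrite lead_coef_eq0.
have size_rs : size p = (size rs).+1.
  by rewrite Ep size_scale // size_prod_XsubC.
split.
- by have := size_along v0 w0 hF; rewrite -/p size_rs.
- move=> Fw0; have pd : p`_d != 0 by rewrite along_top.
  have := size_along v0 w0 hF; rewrite -/p size_rs ltnS => le.
  apply/eqP; rewrite eqn_leq le -ltnS -size_rs ltnNge.
  by apply: contra pd => /(nth_default 0) ->.
- by move=> r; rewrite -horner_along -/p Ep -rootE rootZ // root_prod_XsubC.
move=> r; have -> : along (v0 + r *: w0) w0 F =
    lead_coef p *: \prod_(z <- rs) ('X + (r - z)%:P).
  apply/eqP; rewrite -subr_eq0; apply/eqP/poly_fun0 => t.
  rewrite hornerD hornerN horner_along -addrA -scalerDl -horner_along -/p Ep.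
  rewrite !hornerZ !horner_prod [X in _ - _ * X](eq_bigr (fun z => ('X - z%:P).[r + t])).
    by rewrite -Ep subrr.
  by move=> z _; rewrite hornerXsubC hornerD hornerX hornerC addrCA addrA.
exact: shifted_roots.
Qed.

End RootOrders.

Section Axes.
Variables (K : numClosedFieldType) (H : seq 'M[K]_2).
Hypothesis gH : matrix_group H.
Implicit Types (v w : 'cV[K]_2).

Local Notation e v := (size (stab H v)).

Lemma stab_trivial v M : e v = 1%N -> M \in stab H v -> M = 1%:M.
Proof.
have : 1%:M \in stab H v by case: (stab_group gH v).
by case: (stab H v) => [|N []] //=; rewrite !inE => /eqP <- _ /eqP.
Qed.

Lemma stab_image v M : M \in H -> (e v <= e (M *m v))%N.
Proof.
move=> MH; have [Hu H1 HM HU] := gH; have MU := HU _ MH.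
have MVH := matrix_groupV gH MH.
rewrite -(size_map (fun N => M *m N *m invmx M)); apply: uniq_leq_size.
  have [Su _ _ _] := stab_group gH v.
  rewrite map_inj_uniq // => A B /(congr1 (fun X => invmx M *m (X *m M))).
  by rewrite -!mulmxA !mulVmx // !mulmx1 !mulmxA mulVmx // !mul1mx.
move=> _ /mapP[N /stabP[Nv NH] ->]; apply/stabP; split; last by rewrite !HM.
by rewrite -!mulmxA [invmx M *m _]mulmxA mulVmx // mul1mx Nv.
Qed.

(** An invariant that vanishes at v vanishes there to the order of the
    stabilizer of v, by [along_inv]; and a form of degree d has at most d
    zeros on a line, with multiplicities. *)
Lemma vanishing_degree d f v0 w0 (s : seq K) : dt v0 w0 != 0 ->
  f \is d.-homog -> inv H f -> f != 0 -> uniq s ->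
  (forall r, r \in s -> ev f (v0 + r *: w0) = 0) ->
  (\sum_(r <- s) e (v0 + r *: w0) <= d)%N.
Proof.
move=> dvw hf invf f0 us fs.
have [rs [rsd _ _ ord]] := form_roots dvw hf f0.
apply: leq_trans rsd; apply: leq_trans (count_size (mem s) rs).
rewrite -sum_count_mem // big_seq [X in (_ <= X)%N]big_seq; apply: leq_sum => r rin.
set v := v0 + r *: w0.
have dv : dt v w0 != 0.
  by rewrite dtC /v dtDr dtZr dtvv mulr0 addr0 -dtC.
have v0' := dt_neq0l dv; have [w [vw Hw]] := stab_center gH v0'.
have lw k : (k < e v)%N -> (along v w f)`_k = 0.
  case: k => [_|k ke]; first by rewrite coef0_along fs.
  by apply: (along_inv gH v0' invf Hw); rewrite gtnNdvd.
have lw0 k : (k < e v)%N -> (along v w0 f)`_k = 0.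
  by rewrite (dt_basis w0 vw); apply: along_order hf lw k.
by rewrite leqNgt; apply/negP => /lw0; apply/eqP; exact: (ord r).2.
Qed.

End Axes.

Section AtMostTwoAxes.
Variables (K : numClosedFieldType) (H : seq 'M[K]_2) (N d1 d2 : nat).
Variables f1 f2 : {mpoly K[2]}.
Hypotheses (gH : matrix_group H) (sizeH : (size H < N)%N).
Hypotheses (h1 : f1 \is d1.-homog) (h2 : f2 \is d2.-homog).
Hypotheses (i1 : idl H f1) (i2 : idl H f2) (sp : spans H N f1 f2).
Hypothesis axes : forall v : 'cV[K]_2, v != 0 ->
  (1 < size (stab H v))%N -> ev f1 v = 0 \/ ev f2 v = 0.
Implicit Types (v w : 'cV[K]_2).

Local Notation e v := (size (stab H v)).
Local Notation J := (jac f1 f2).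

Let order v (v0 : v != 0) := jac_order gH sizeH h1 h2 i1.1 i2.1 sp v0.

Lemma jac_neq0 : J != 0.
Proof.
have e0 : delta_mx 0 0 != 0 :> 'cV[K]_2.
  by apply/cV0Pn; exists 0; rewrite mxE !eqxx oner_neq0.
have [w [_ [_ Jw]]] := order e0; apply: contraNneq Jw => ->.
by rewrite -mpolyC0 alongC coefC; case: ifP.
Qed.

Lemma degree_gt0 f d : f \is d.-homog -> idl H f -> f != 0 -> (0 < d)%N.
Proof.
move=> hf [_ f0]; apply: contraNT; rewrite -eqn0Ngt => /eqP d0.
by rewrite -(hc_id hf) d0 hc_degree0 f0 mpolyC0.
Qed.

Lemma generators_neq0 : f1 != 0 /\ f2 != 0.
Proof.
split; apply: contraNneq jac_neq0 => ->; rewrite /jac.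
  by rewrite !mderiv0 !mul0r subrr.
by rewrite !mderiv0 !mulr0 subrr.
Qed.

(** The stabilizers are trivial off at most two axes: the Jacobian has degree
    d1 + d2 - 2 and vanishes to order e - 1 on an axis of order e, while one
    of f1, f2 vanishes to order e there; hence the sum of all e is at most
    d1 + d2 = 2 + sum (e - 1). *)
Lemma at_most_two_axes : exists v0 w0 : 'cV[K]_2, exists rs : seq K,
  [/\ dt v0 w0 != 0, uniq rs && (size rs <= 2)%N,
   forall r, r \in rs -> (1 < e (v0 + r *: w0))%N,
   forall v, v != 0 -> (1 < e v)%N ->
     exists2 r, r \in rs & dt v (v0 + r *: w0) = 0 &
   (d1 + d2 <= 2 + \sum_(r <- rs) (e (v0 + r *: w0)).-1)%N].
Proof.
have J0 := jac_neq0; have [f10 f20] := generators_neq0.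
have d10 := degree_gt0 h1 i1 f10; have d20 := degree_gt0 h2 i2 f20.
have hJ : J \is (d1 + d2 - 2).-homog by apply: jac_homog.
have [w0 []] : exists w0 : 'cV[K]_2, w0 != 0 /\ ev J w0 != 0.
  have [|x] := @ev_nonzero _ _ (J * 'X_0).
    rewrite mulf_neq0 //; apply/eqP => /(congr1 (fun p => ev p (delta_mx 0 0))).
    by rewrite evX ev0 mxE eqxx => /eqP; rewrite oner_eq0.
  rewrite evM evX mulf_eq0 negb_or => /andP[Jx x0]; exists x; split=> //.
  by apply: contraNneq x0 => ->; rewrite mxE.
case/dt_transversal => v0; rewrite dtC oppr_eq0 => dvw Jw0.
have [rs0 [_ /(_ Jw0) size0 mem0 ord0]] := form_roots dvw hJ J0.
have dv r : dt (v0 + r *: w0) w0 != 0.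
  by rewrite dtC dtDr dtZr dtvv mulr0 addr0 -dtC.
have mult r : (count_mem r rs0 <= (e (v0 + r *: w0)).-1)%N.
  have v0' := dt_neq0l (dv r); have [w [[vw Hw] [_ Jw]]] := order v0'.
  rewrite leqNgt; apply/negP => ltc; move/eqP: Jw; apply.
  rewrite (dt_basis w (dv r)); apply: along_order hJ _ _ ltc => k.
  exact: (ord0 r).1.
have e0 v : (0 < e v)%N := stab_gt0 gH v.
pose rs := undup rs0; have us : uniq rs := undup_uniq _.
have e1 r : r \in rs -> (1 < e (v0 + r *: w0))%N.
  rewrite mem_undup -has_pred1 has_count => c0; have := leq_trans c0 (mult r).
  by have := e0 (v0 + r *: w0); case: size => [|[]].
have bound : (d1 + d2 <= 2 + \sum_(r <- rs) (e (v0 + r *: w0)).-1)%N.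
  rewrite -leq_subLR -size0.
  have -> : size rs0 = (\sum_(r <- rs) count_mem r rs0)%N.
    rewrite sum_count_mem //; apply/esym/eqP; rewrite -all_count.
    by apply/allP => r; rewrite /= mem_undup.
  by apply: leq_sum.
exists v0, w0, rs; split=> // [|v v0' ev1].
  rewrite us /=.
  pose s1 := [seq r <- rs | ev f1 (v0 + r *: w0) == 0].
  pose s2 := [seq r <- rs | ev f1 (v0 + r *: w0) != 0].
  have b1 : (\sum_(r <- s1) e (v0 + r *: w0) <= d1)%N.
    apply: (vanishing_degree gH dvw h1 i1.1 f10); first exact: filter_uniq.
    by move=> r; rewrite mem_filter => /andP[/eqP].
  have b2 : (\sum_(r <- s2) e (v0 + r *: w0) <= d2)%N.
    apply: (vanishing_degree gH dvw h2 i2.1 f20); first exact: filter_uniq.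
    move=> r; rewrite mem_filter => /andP[f1r /e1 er].
    by have [E|//] := axes (dt_neq0l (dv r)) er; rewrite E eqxx in f1r.
  have tot : (\sum_(r <- rs) e (v0 + r *: w0) <= d1 + d2)%N.
    rewrite (bigID (fun r => ev f1 (v0 + r *: w0) == 0)) /= -!(big_filter rs).
    exact: leq_add.
  have := leq_trans tot bound.
  have -> : (\sum_(r <- rs) e (v0 + r *: w0) =
     size rs + \sum_(r <- rs) (e (v0 + r *: w0)).-1)%N.
    rewrite -sum1_size -big_split /=; apply: eq_bigr => r _.
    by rewrite add1n prednK.
  by rewrite leq_add2r.
have Jv : ev J v = 0.
  have [w [_ [Jw _]]] := order v0'; rewrite -(coef0_along v w) Jw //.
  by move: ev1; case: size => [|[]].
have := dt_basis v dvw; set a := _ / _; set b := _ / _ => Ev.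
have a0 : a != 0.
  apply: contraNneq v0' => a0; move: Jv; rewrite Ev a0 scale0r add0r.
  rewrite (ev_homog _ _ hJ) => /eqP; rewrite mulf_eq0 (negPf Jw0) orbF expf_eq0.
  by case/andP => _ /eqP ->; rewrite scale0r.
exists (b / a).
  rewrite mem_undup mem0; apply/eqP; apply: (mulfI (expf_neq0 (d1 + d2 - 2) a0)).
  rewrite mulr0 -(ev_homog _ _ hJ) scalerDr scalerA mulrCA divff // mulr1.
  by rewrite -Ev.
rewrite {1}Ev dtC !dtDr !dtZr !(dtC (_ + _)) !dtDr !dtZr !dtvv (dtC w0 v0).
by field.
Qed.

End AtMostTwoAxes.

Section DiagonalStabilizer.
Variables (K : numClosedFieldType) (H : seq 'M[K]_2).
Hypothesis gH : matrix_group H.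
Implicit Types (v w b : 'cV[K]_2).

Local Notation e v := (size (stab H v)).

Definition diagonal_group b1 b2 e1 e2 :=
  {in H, forall M, exists a b : K,
     [/\ a ^+ e1 = 1, b ^+ e2 = 1, M *m b1 = a *: b1 & M *m b2 = b *: b2]} /\
  forall a b : K, a ^+ e1 = 1 -> b ^+ e2 = 1 ->
    exists2 M, M \in H & M *m b1 = a *: b1 /\ M *m b2 = b *: b2.

Lemma diagonal_group_sym b1 b2 e1 e2 :
  diagonal_group b1 b2 e1 e2 -> diagonal_group b2 b1 e2 e1.
Proof.
move=> [D1 D2]; split=> [M /D1[a [b [? ? ? ?]]]|a b a1 b1'].
  by exists b, a; split.
by have [M MH []] := D2 b a b1' a1; exists M.
Qed.

(** As f is a pure power of the first coordinate, invariance of f at M b2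
    leaves no component along b1; invariance of g at M b1 then leaves none
    along b2. Conversely the stabilizers of b1 and b2 supply all the diagonal
    matrices. *)
Lemma diagonal_of_forms b1 b2 f g c g0 g' :
  dt b1 b2 != 0 -> inv H f -> inv H g ->
  {in stab H b2, forall M, M *m b1 = \det M *: b1} ->
  {in stab H b1, forall M, M *m b2 = \det M *: b2} ->
  (forall x y, ev f (x *: b1 + y *: b2) = c * x ^+ e b2) ->
  (forall x y, ev g (x *: b1 + y *: b2) = g0 * y ^+ e b1 + g' * x ^+ e b1) ->
  c != 0 -> g0 != 0 -> (g' != 0 -> (e b2 %| e b1)%N) ->
  diagonal_group b1 b2 (e b2) (e b1).
Proof.
move=> db hf hg s1 s2 Ef Eg c0 g00 dvd.
have e20 := stab_gt0 gH b2; have e10 := stab_gt0 gH b1.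
have b10 := dt_neq0l db; have b20 := dt_neq0r db.
split=> [M MH|a b a1 b1'].
  have coord x : exists p q, x = p *: b1 + q *: b2.
    by exists (dt x b2 / dt b1 b2), (dt b1 x / dt b1 b2); apply: dt_basis.
  have [al [be E2]] := coord (M *m b2); have [ga [de E1]] := coord (M *m b1).
  have B1 : b1 = 1 *: b1 + 0 *: b2 by rewrite scale0r addr0 scale1r.
  have B2 : b2 = 0 *: b1 + 1 *: b2 by rewrite scale0r add0r scale1r.
  have fb1 : ev f b1 = c by have := Ef 1 0; rewrite -B1 expr1n mulr1.
  have fb2 : ev f b2 = 0.
    by have := Ef 0 1; rewrite -B2 expr0n eqn0Ngt e20 mulr0.
  have gb1 : ev g b1 = g'.
    by have := Eg 1 0; rewrite -B1 expr0n eqn0Ngt e10 expr1n mulr0 add0r mulr1.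
  have gb2 : ev g b2 = g0.
    by have := Eg 0 1; rewrite -B2 expr0n eqn0Ngt e10 expr1n mulr0 addr0 mulr1.
  have al0 : al = 0.
    have := hf M MH b2; rewrite E2 Ef fb2 => /eqP.
    by rewrite mulf_eq0 (negPf c0) expf_eq0 e20 => /eqP.
  have ga1 : ga ^+ e b2 = 1.
    by have := hf M MH b1; rewrite E1 Ef fb1 -{2}[c]mulr1 => /(mulfI c0).
  have be1 : be ^+ e b1 = 1.
    have := hg M MH b2; rewrite E2 Eg al0 gb2 expr0n eqn0Ngt e10 mulr0 addr0.
    by rewrite -{2}[g0]mulr1 => /(mulfI g00).
  have de0 : de = 0.
    have := hg M MH b1; rewrite E1 Eg gb1.
    have -> : g' * ga ^+ e b1 = g'.
      have [->|/dvd/dvdnP[k ->]] := eqVneq g' 0; first by rewrite mul0r.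
      by rewrite mulnC exprM ga1 expr1n mulr1.
    move/eqP; rewrite -subr_eq0 addrK mulf_eq0 (negPf g00) expf_eq0 e10.
    by move/eqP.
  exists ga, be; split=> //; first by rewrite E1 de0 scale0r addr0.
  by rewrite E2 al0 scale0r add0r.
have [A AS Aa] := ((stab_det gH b20).2 a).1 a1.
have [B BS Bb] := ((stab_det gH b10).2 b).1 b1'.
have [Ab2 AH] := stabP _ _ _ AS; have [Bb1 BH] := stabP _ _ _ BS.
exists (A *m B); first by case: gH => _ _ HM _; apply: HM.
by rewrite -!mulmxA Bb1 s1 // Aa s2 // Bb -scalemxAr Ab2.
Qed.

Lemma along_reverse d F v w k : F \is d.-homog -> (k <= d)%N ->
  (along w v F)`_(d - k) = (along v w F)`_k.
Proof.
move=> hF kd; have -> : along w v F = \poly_(j < d.+1) (along v w F)`_(d - j).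
  apply/eqP; rewrite -subr_eq0; apply/eqP/poly_fun0 => t.
  rewrite hornerD hornerN horner_along horner_poly.
  have := ev_plane v w t 1 hF; rewrite scale1r addrC => ->.
  rewrite (reindex_inj rev_ord_inj) /= -sumrB big1 // => i _.
  rewrite subSS subKn; last by rewrite -ltnS.
  by rewrite expr1n mulr1 subrr.
by rewrite coef_poly subKn // ltnS leq_subr.
Qed.

(** The stabilizers of b1 and b2 only allow monomials with exponents divisible
    by their orders, and f has degree the order of the stabilizer of b2. *)
Lemma pure_form b1 b2 f : dt b1 b2 != 0 -> inv H f -> f \is (e b2).-homog ->
  {in stab H b2, forall M, M *m b1 = \det M *: b1} ->
  {in stab H b1, forall M, M *m b2 = \det M *: b2} ->
  (forall x y, ev f (x *: b1 + y *: b2) =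
     ev f b1 * x ^+ e b2 + ev f b2 * y ^+ e b2) /\
  (ev f b2 != 0 -> (e b1 %| e b2)%N).
Proof.
move=> db hi hf s1 s2; have b10 := dt_neq0l db; have b20 := dt_neq0r db.
split=> [x y|fb2]; last first.
  apply/negPn/negP => nd; move/eqP: fb2; apply; rewrite -(along_top b1 _ hf).
  exact: (along_inv gH b10 hi s2 nd).
have mid i : (0 < i < e b2)%N -> (along b1 b2 f)`_i = 0.
  move=> /andP[i0 ie]; rewrite -(along_reverse b1 b2 hf (ltnW ie)).
  by apply: (along_inv gH b20 hi s1); rewrite gtnNdvd ?subn_gt0 // ltn_subrL i0 (leq_trans i0 (ltnW ie)).
rewrite (ev_plane _ _ _ _ hf) -(along_top b1 b2 hf) -(coef0_along b1 b2).
have := stab_gt0 gH b2; move: mid; case: (e b2) => // k mid _.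
rewrite big_ord_recl big_ord_recr /= subn0 subnn expr0 !mulr1.
by rewrite big1 ?add0r // => i _; rewrite mid ?mul0r //= /bump add1n ltnS ltn_ord.
Qed.

(** If both f and g involve both pure powers, these have the same degree, and
    a combination of f and g, nonzero because the Jacobian is, is a pure
    power. *)
Lemma diagonal_of_generators b1 b2 f g : dt b1 b2 != 0 ->
  {in stab H b2, forall M, M *m b1 = \det M *: b1} ->
  {in stab H b1, forall M, M *m b2 = \det M *: b2} ->
  inv H f -> inv H g -> f \is (e b2).-homog -> g \is (e b1).-homog ->
  ev f b1 != 0 -> ev g b2 != 0 -> jac f g != 0 ->
  diagonal_group b1 b2 (e b2) (e b1).
Proof.
move=> db s1 s2 invf invg hf hg fb1 gb2 J0.
have db' : dt b2 b1 != 0 by rewrite dtC oppr_eq0.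
have [Ef fd] := pure_form db invf hf s1 s2.
have [Eg gd] := pure_form db' invg hg s2 s1.
have Eg' x y : ev g (x *: b1 + y *: b2) = ev g b2 * y ^+ e b1 + ev g b1 * x ^+ e b1.
  by rewrite addrC Eg.
have [f2|f2] := eqVneq (ev f b2) 0.
  apply: (diagonal_of_forms (f := f) (g := g) (c := ev f b1)) Eg' fb1 gb2 gd => //.
  by move=> x y; rewrite Ef f2 mul0r addr0.
have [g1|g1] := eqVneq (ev g b1) 0.
  apply: diagonal_group_sym.
  apply: (diagonal_of_forms (f := g) (g := f) (c := ev g b2) (g0 := ev f b1)
    (g' := ev f b2)) => // x y; last by rewrite addrC Ef.
  by rewrite Eg g1 mul0r addr0.
have ee : e b2 = e b1 by apply/eqP; rewrite eqn_dvd gd // fd.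
pose F := ev g b2 *: f - ev f b2 *: g.
have EF x y : ev F (x *: b1 + y *: b2) =
    (ev g b2 * ev f b1 - ev f b2 * ev g b1) * x ^+ e b2.
  rewrite evB !evZ Ef Eg' ee; move: (x ^+ _) (y ^+ _) => X Y.
  move: (ev f b1) (ev f b2) (ev g b1) (ev g b2) => f1 f2' g1' g2'; ring.
have invF : inv H F by apply: invB; apply: invZ.
apply: (diagonal_of_forms db invF invg s1 s2 EF Eg' _ gb2 gd).
apply: contraNneq J0 => c0.
have F0 : ev g b2 *: f = ev f b2 *: g.
  apply/eqP; rewrite -subr_eq0; apply/eqP/ev_eq0 => x.
  by rewrite (dt_basis x db) EF c0 mul0r.
have F1 i : ev g b2 *: f^`M(i) = ev f b2 *: g^`M(i) by rewrite -!mderivZ F0.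
have: ev g b2 *: jac f g = 0.
  rewrite /jac scalerBr !(scalerAl (ev g b2)) !F1 -!scalerAl -scalerBr.
  by rewrite [g^`M(1) * _]mulrC subrr scaler0.
by move/eqP; rewrite scaler_eq0 (negPf gb2).
Qed.

Variables (N d1 d2 : nat) (f1 f2 : {mpoly K[2]}).
Hypothesis sizeH : (size H < N)%N.
Hypotheses (h1 : f1 \is d1.-homog) (h2 : f2 \is d2.-homog).
Hypotheses (i1 : idl H f1) (i2 : idl H f2) (sp : spans H N f1 f2).
Hypothesis axes : forall v : 'cV[K]_2, v != 0 ->
  (1 < size (stab H v))%N -> ev f1 v = 0 \/ ev f2 v = 0.

(** With two axes, the stabilizer of one permutes the axes, hence preserves
    the other one. With one axis, a common eigenvector of its stabilizer
    completes the basis; with none, any basis will do. *)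
Lemma axes_basis : exists b1 b2, [/\ dt b1 b2 != 0,
  {in stab H b2, forall M, M *m b1 = \det M *: b1},
  {in stab H b1, forall M, M *m b2 = \det M *: b2} &
  (d1 + d2 <= e b2 + e b1)%N].
Proof.
have [v0 [w0 [rs [dvw /andP[us rs2] ers Hax bound]]]] :=
  at_most_two_axes gH sizeH h1 h2 i1 i2 sp axes.
have e0 v : (0 < e v)%N := stab_gt0 gH v.
have triv v w : e v = 1%N -> {in stab H v, forall M, M *m w = \det M *: w}.
  by move=> e1 M /(stab_trivial gH e1) ->; rewrite mul1mx det1 scale1r.
have dr r s : dt (v0 + r *: w0) (v0 + s *: w0) = (s - r) * dt v0 w0.
  by rewrite dtDr dtZr !(dtC (_ + _)) !dtDr !dtZr !dtvv (dtC w0 v0); ring.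
have vr0 r : v0 + r *: w0 != 0.
  apply: (@dt_neq0l _ _ w0).
  by rewrite dtC dtDr dtZr dtvv mulr0 addr0 -dtC.
case: rs us rs2 ers Hax bound => [|r [|r' [|//]]] us _ ers Hax bound.
- have e1 v : v != 0 -> e v = 1%N.
    move=> vn; apply/eqP; rewrite eqn_leq e0 andbT leqNgt; apply/negP => ev1.
    by have [] := Hax v vn ev1.
  exists v0, w0; rewrite (e1 v0) ?(e1 w0) ?(dt_neq0l dvw) ?(dt_neq0r dvw) //.
  split=> //; try by apply: triv; apply: e1; rewrite ?(dt_neq0l dvw) ?(dt_neq0r dvw).
  by rewrite big_nil in bound.
- set b2 := v0 + r *: w0; have [b1 [db Hb]] := stab_center gH (vr0 r).
  have b10 := dt_neq0r db.
  have eb1 : e b1 = 1%N.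
    apply/eqP; rewrite eqn_leq e0 andbT leqNgt; apply/negP => /(Hax b1 b10).
    case=> s; rewrite inE => /eqP -> E.
    by move: db; rewrite dtC E oppr0 eqxx.
  exists b1, b2; split=> //; [by rewrite dtC oppr_eq0|exact: triv|].
  rewrite big_seq1 in bound; apply: leq_trans bound _.
  by rewrite eb1 -/b2 addnC addn2 addn1 prednK.
have rr' : r' != r by move: us; rewrite /= inE andbT eq_sym.
set b2 := v0 + r *: w0; set b1 := v0 + r' *: w0.
have db : dt b1 b2 != 0 by rewrite dr mulf_neq0 // subr_eq0 eq_sym.
have b10 : b1 != 0 := vr0 r'; have b20 : b2 != 0 := vr0 r.
have eig b c : b \in [:: b1; b2] -> c \in [:: b1; b2] -> dt b c != 0 ->
    {in stab H b, forall M, M *m c = \det M *: c}.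
  move=> bin cin dbc M /stabP[Mb MH].
  have c0 := dt_neq0r dbc; have bn0 := dt_neq0l dbc.
  have MU : M \in unitmx by case: gH => _ _ _; apply.
  have Mc0 : M *m c != 0.
    by apply: contraNneq c0 => E; rewrite -[c](mulKmx MU) E mulmx0.
  have ec : (1 < e c)%N.
    by move: cin; rewrite !inE => /orP[] /eqP ->; apply: ers; rewrite !inE eqxx ?orbT.
  have [s sin ds] := Hax _ Mc0 (leq_trans ec (stab_image gH c MH)).
  have dMbc : dt b (M *m c) = \det M * dt b c by rewrite -[b in LHS]Mb dtM.
  have detM0 : \det M != 0 by move: MU; rewrite unitmxE unitfE.
  have dMcc : dt (M *m c) c = 0.
    have /orP[/eqP Es|/eqP Es] : (v0 + s *: w0 == b) || (v0 + s *: w0 == c).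
    - move: sin bin cin dbc; rewrite !inE -/b1 -/b2.
      case/orP => /eqP -> /orP[] /eqP -> /orP[] /eqP ->;
        rewrite -/b1 -/b2 ?eqxx ?orbT // => /negP []; rewrite dtvv //.
    - move: ds; rewrite Es dtC dMbc => /eqP; rewrite oppr_eq0 mulf_eq0.
      by rewrite (negPf detM0) (negPf dbc).
    by rewrite -[X in dt _ X]Es.
  have [k Ek] : exists k, M *m c = k *: c.
    by apply: dt_eq0 c0 _; rewrite dtC dMcc oppr0.
  by move: dMbc; rewrite Ek dtZr => /(mulIf dbc) ->.
exists b1, b2; split=> //.
- by apply: eig; rewrite ?inE ?eqxx ?orbT // dtC oppr_eq0.
- by apply: eig; rewrite ?inE ?eqxx ?orbT.
apply: leq_trans bound _; rewrite !big_cons big_nil addn0 -/b1 -/b2 addnA.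
by rewrite [X in (X + _)%N](_ : _ = (e b2).+1) ?addSnnS ?prednK // -addn1 addnC -addn1; move: (e0 b2); case: (e b2) => //= k _; rewrite !addn1 add2n.
Qed.

Lemma coef_Xderiv (p : {poly K}) k : ('X * p^`())`_k = k%:R * p`_k.
Proof.
by rewrite coefXM; case: k => [|k]; rewrite ?mul0r //= coef_deriv mulr_natl.
Qed.

(** As the Jacobian is not zero, f1 and f2 contain monomials with nonzero
    Jacobian. The exponents of x and y in each of them are multiples of e b2
    and e b1, so that the bound on the degrees only leaves the pure powers
    x^(e b2) and y^(e b1). *)
Lemma leading_monomials b1 b2 : dt b1 b2 != 0 ->
  {in stab H b2, forall M, M *m b1 = \det M *: b1} ->
  {in stab H b1, forall M, M *m b2 = \det M *: b2} ->
  (d1 + d2 <= e b2 + e b1)%N ->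
  [/\ d1 = e b2, d2 = e b1, ev f1 b1 != 0 & ev f2 b2 != 0] \/
  [/\ d1 = e b1, d2 = e b2, ev f1 b2 != 0 & ev f2 b1 != 0].
Proof.
move=> db s1 s2 bound.
have b10 := dt_neq0l db; have b20 := dt_neq0r db.
pose p1 := along b1 b2 f1; pose p2 := along b1 b2 f2.
have [k1 [k2 [c1 c2 dk]]] : exists k1 k2,
    [/\ p1`_k1 != 0, p2`_k2 != 0 & d1%:R * k2%:R - d2%:R * k1%:R != 0 :> K].
  apply: contrapT => none.
  have jp : d1%:R *: (p1 * p2^`()) - d2%:R *: (p2 * p1^`()) = 0.
    suff: 'X * (d1%:R *: (p1 * p2^`()) - d2%:R *: (p2 * p1^`())) == 0.
      by rewrite mulf_eq0 polyX_eq0 => /eqP.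
    apply/eqP/polyP => t; rewrite coef0.
    have -> : 'X * (d1%:R *: (p1 * p2^`()) - d2%:R *: (p2 * p1^`())) =
      d1%:R *: (p1 * ('X * p2^`())) - d2%:R *: (('X * p1^`()) * p2).
      by rewrite -!mul_polyC; ring.
    rewrite coefB !coefZ !coefM !mulr_sumr -sumrB big1 // => i _.
    rewrite !coef_Xderiv; apply/eqP/negPn/negP => nz; apply: none.
    exists i, (t - i)%N.
    have E : d1%:R * (p1`_i * ((t - i)%:R * p2`_(t - i))) -
      d2%:R * (i%:R * p1`_i * p2`_(t - i)) =
      p1`_i * p2`_(t - i) * (d1%:R * (t - i)%:R - d2%:R * i%:R) by ring.
    by move: nz; rewrite E !mulf_eq0 !negb_or => /andP[/andP[]].
  have J0 : along b1 b2 (jac f1 f2) = 0.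
    apply: (scalerI db); rewrite scaler0.
    by rewrite (along_jac b1 b2 h1 h2) -/p1 -/p2 jp.
  have [w []] := jac_order gH sizeH h1 h2 i1.1 i2.1 sp b10.
  move=> [dw _] [_]; rewrite (dt_basis w db).
  have hJ := jac_neq0 gH sizeH h1 h2 i1 i2 sp.
  move/eqP; apply.
  have [f10 f20] := generators_neq0 gH sizeH h1 h2 i1 i2 sp.
  have homJ := jac_homog (degree_gt0 h1 i1 f10) (degree_gt0 h2 i2 f20) h1 h2.
  apply: (along_order _ _ homJ (m := e b1)) => [k _|]; first by rewrite J0 coef0.
  by rewrite prednK // stab_gt0.
have supp f d k : f \is d.-homog -> idl H f -> (along b1 b2 f)`_k != 0 ->
    [/\ (k <= d)%N, (e b1 %| k)%N & (e b2 %| d - k)%N].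
  move=> hf [hi _] fk.
  have kd : (k <= d)%N.
    rewrite -ltnS; apply: leq_trans (size_along b1 b2 hf); rewrite ltnNge.
    by apply: contra fk => /(nth_default 0) ->.
  split=> //.
    by apply/negPn/negP => nd; move/eqP: fk; apply; exact: (along_inv gH b10 hi s2 nd).
  apply/negPn/negP => nd; move/eqP: fk; apply; rewrite -(along_reverse b1 b2 hf kd).
  exact: (along_inv gH b20 hi s1 nd).
have [kd1 /dvdnP[y1 ey1] /dvdnP[x1 ex1]] := supp _ _ _ h1 i1 c1.
have [kd2 /dvdnP[y2 ey2] /dvdnP[x2 ex2]] := supp _ _ _ h2 i2 c2.
have ed1 : d1 = (x1 * e b2 + y1 * e b1)%N by rewrite -ex1 -ey1 subnK.
have ed2 : d2 = (x2 * e b2 + y2 * e b1)%N by rewrite -ex2 -ey2 subnK.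
have dn : (x1 * y2 != x2 * y1)%N.
  apply: contra_neq dk => E; rewrite ed1 ed2 ey1 ey2 -!natrM -[RHS](subrr (
    ((x1 * e b2 + y1 * e b1) * (y2 * e b1))%:R)).
  congr (_ - _%:R); rewrite !mulnDl; congr (_ + _)%N; last by ring.
  by rewrite mulnACA [in RHS]mulnACA E.
have e1p := stab_gt0 gH b1; have e2p := stab_gt0 gH b2.
have x12 : (0 < x1 + x2)%N.
  by case: (x1) (x2) dn => [|?] [|?] //=; rewrite !mul0n eqxx.
have y12 : (0 < y1 + y2)%N.
  by case: (y1) (y2) dn => [|?] [|?] //=; rewrite !muln0 eqxx.
have tot : ((x1 + x2) * e b2 + (y1 + y2) * e b1 <= e b2 + e b1)%N.
  by move: bound; rewrite {1}ed1 {1}ed2 addnACA -!mulnDl.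
have [x1' y1'] : (x1 + x2 = 1 /\ y1 + y2 = 1)%N.
  move: tot x12 y12; case: (x1 + x2)%N => [|[|x]] //; case: (y1 + y2)%N => [|[|y]] //; nia.
have l1 d f k : f \is d.-homog -> k = d -> (along b1 b2 f)`_k != 0 -> ev f b2 != 0.
  by move=> hf ->; rewrite along_top.
case: x1 x2 x1' dn ed1 ed2 ex1 ex2 {tot x12} => [|[|//]] [|[|//]] //= _ dn ed1 ed2 ex1 ex2.
  right; case: y1 y2 y1' dn ed1 ed2 ey1 ey2 {y12} => [|[|//]] [|[|//]] //= _ _.
  rewrite !mul0n !mul1n ?addn0 ?add0n => ed1 ed2 ey1 ey2; split=> //.
    by apply: l1 h1 _ c1; rewrite ey1 ed1.
  by move: c2; rewrite ey2 coef0_along.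
left; case: y1 y2 y1' dn ed1 ed2 ey1 ey2 {y12} => [|[|//]] [|[|//]] //= _ _.
rewrite !mul0n !mul1n ?addn0 ?add0n => ed1 ed2 ey1 ey2; split=> //.
  by move: c1; rewrite ey1 coef0_along.
by apply: l1 h2 _ c2; rewrite ey2 ed2.
Qed.

End DiagonalStabilizer.

Lemma hc_vanishing (K : numClosedFieldType) n (f : {mpoly K[n]}) v d :
  (forall t, ev f (t *: v) = 0) -> ev (hc d f) v = 0.
Proof.
move=> f0; set k := maxn (msize f) d.+1.
have p0 : \poly_(i < k) ev (hc i f) v = 0.
  apply: poly_fun0 => t; rewrite -(f0 t) horner_poly.
  rewrite [in RHS](@hc_partition _ _ f k) ?leq_maxl // ev_sum.
  by apply: eq_bigr => i _; rewrite (ev_homog _ _ (hc_homog _ _)) mulrC.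
have := congr1 (fun p : {poly K} => p`_d) p0.
by rewrite coef_poly coef0 /k leq_maxr.
Qed.

(** Two homogeneous components f1, f2 of U1, U2 generate the invariants. Their
    Jacobian vanishes to order e - 1 on an axis with stabilizer of order e,
    while normal crossings make f1 or f2 vanish there to order e; comparing
    degrees, there are at most two axes, and in coordinates adapted to them f1
    and f2 have leading terms x^e1 and y^e2. A group that preserves such
    forms, and contains the reflections about both axes, is diagonal. *)
Theorem snc_quotient_diagonal (K : numClosedFieldType) (H : seq 'M[K]_2) N
    (U1 U2 : {mpoly K[2]}) : matrix_group H -> (size H < N)%N ->
  idl H U1 -> idl H U2 ->
  (forall g, idl H g -> exists E A1 A2,
     [/\ inv H E, ev E 0 != 0, inv H A1, inv H A2 &
     forall d, (d < N)%N -> hc d (E * g - (A1 * U1 + A2 * U2)) = 0]) ->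
  (forall v : 'cV[K]_2, v != 0 -> (1 < size (stab H v))%N ->
     (forall t, ev U1 (t *: v) = 0) \/ (forall t, ev U2 (t *: v) = 0)) ->
  exists b1 b2 e1 e2, [/\ dt b1 b2 != 0, (0 < e1)%N, (0 < e2)%N &
    diagonal_group H b1 b2 e1 e2].
Proof.
move=> gH sizeH h1 h2 HS axesU.
have [d1 [d2 sp]] := spans_components h1 h2 (spans_local h1 h2 HS).
have i1 := idl_hc d1 h1; have i2 := idl_hc d2 h2.
have hom1 := hc_homog d1 U1; have hom2 := hc_homog d2 U2.
have axes v : v != 0 -> (1 < size (stab H v))%N ->
    ev (hc d1 U1) v = 0 \/ ev (hc d2 U2) v = 0.
  by move=> v0 /(axesU v v0)[|] /hc_vanishing E; [left|right].
have [b1 [b2 [db s1 s2 bound]]] := axes_basis gH sizeH hom1 hom2 i1 i2 sp axes.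
have J0 := jac_neq0 gH sizeH hom1 hom2 i1 i2 sp.
exists b1, b2, (size (stab H b2)), (size (stab H b1)).
split; rewrite ?stab_gt0 //.
have [[E1 E2 n1 n2]|[E1 E2 n1 n2]] :=
  leading_monomials gH sizeH hom1 hom2 i1 i2 sp db s1 s2 bound.
  apply: (diagonal_of_generators gH db s1 s2 i1.1 i2.1) => //.
    by rewrite -E1.
  by rewrite -E2.
apply: (diagonal_of_generators gH db s1 s2 i2.1 i1.1) => //.
- by rewrite -E2.
- by rewrite -E1.
have -> : jac (hc d2 U2) (hc d1 U1) = - jac (hc d1 U1) (hc d2 U2).
  by rewrite /jac; ring.
by rewrite oppr_eq0.
Qed.

(** * Regular functions on the projective plane *)

Section Plane.
Variable K : numClosedFieldType.
Local Notation P2 := (P2 K).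
Implicit Types (F G Q : {mpoly K[3]}) (v w : 'cV[K]_3) (U V : set P2).

Lemma peval_proj F d v : F \is d.-homog -> v != 0 ->
  exists c : K, c != 0 /\ peval F (proj_pt v) = c ^+ d * ev F v.
Proof.
move=> hF v0; have [c [c0 E]] := coords_proj_pt v0; exists c; split=> //.
by rewrite -(ev_homog _ _ hF) -E.
Qed.

Lemma peval_proj_neq0 F d v : F \is d.-homog -> v != 0 ->
  (peval F (proj_pt v) != 0) = (ev F v != 0).
Proof.
move=> hF v0; have [c [c0 ->]] := peval_proj hF v0.
by rewrite mulf_eq0 expf_eq0 (negPf c0) andbF.
Qed.

Lemma peval_proj_eq0 F d v : F \is d.-homog -> v != 0 ->
  (peval F (proj_pt v) == 0) = (ev F v == 0).
Proof. by move=> hF v0; apply: negb_inj; rewrite (peval_proj_neq0 hF). Qed.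

Lemma peval_proj_ratio F G d v : F \is d.-homog -> G \is d.-homog -> v != 0 ->
  peval F (proj_pt v) / peval G (proj_pt v) = ev F v / ev G v.
Proof.
move=> hF hG v0; have [c [c0 E]] := coords_proj_pt v0.
rewrite /peval -!/(ev _ (coords _)) E (ev_homog _ _ hF) (ev_homog _ _ hG).
by rewrite -mulf_div divff ?mul1r // expf_neq0.
Qed.

Lemma open_rep U v : open U -> v != 0 -> U (proj_pt v) ->
  exists d F, [/\ F \is d.-homog, ev F v != 0 &
    forall w, w != 0 -> ev F w != 0 -> U (proj_pt w)].
Proof.
move=> [S [hS ->]] v0 [F SF]; have [d hF] := hS F SF.
rewrite (peval_proj_neq0 hF v0) => Fv; exists d, F; split=> // w w0 Fw.
by exists F => //; rewrite (peval_proj_neq0 hF w0).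
Qed.

Lemma open_principal F d : F \is d.-homog ->
  open [set p : P2 | peval F p != 0].
Proof. exact: open_peval_neq0. Qed.

Lemma regular_rep U f v : open U -> regular U f -> v != 0 -> U (proj_pt v) ->
  exists d F G, [/\ F \is d.-homog, G \is d.-homog, ev G v != 0 &
    forall w, w != 0 -> ev G w != 0 ->
      U (proj_pt w) /\ f (proj_pt w) = ev F w / ev G w].
Proof.
move=> oU rf v0 Uv; have [V [oV Vv [d [F [G [hF hG E]]]]]] := rf _ Uv.
have [a [A [hA Av HA]]] := open_rep oV v0 Vv.
have [b [B [hB Bv HB]]] := open_rep oU v0 Uv.
exists (a + b + d)%N, (A * B * F), (A * B * G).
have hAB := dhomogM hA hB; split; [exact: dhomogM..| |].
  have [Gv _] := E _ Vv Uv.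
  by rewrite !evM !mulf_neq0 // -(peval_proj_neq0 hG v0).
move=> w w0; rewrite !evM !mulf_eq0 !negb_or => /andP[/andP[Aw Bw] Gw].
have Vw := HA w w0 Aw; have Uw := HB w w0 Bw; split=> //.
rewrite (E _ Vw Uw).2 (peval_proj_ratio hF hG w0) -mulf_div divff ?mul1r //.
by rewrite mulf_neq0.
Qed.

Lemma regular_local U f : (forall v, v != 0 -> U (proj_pt v) ->
  exists d F G, [/\ F \is d.-homog, G \is d.-homog, ev G v != 0 &
    forall w, w != 0 -> U (proj_pt w) -> ev G w != 0 ->
      f (proj_pt w) = ev F w / ev G w]) -> regular U f.
Proof.
move=> H p Up; have v0 := coords_neq0 p; rewrite -[p]coordsK in Up *.
have [d [F [G [hF hG Gv E]]]] := H _ v0 Up.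
exists [set q : P2 | peval G q != 0]; split.
- exact: open_principal hG.
- by rewrite /= (peval_proj_neq0 hG v0).
exists d, F, G; split=> // q /= Gq Uq; split=> //.
by rewrite -[q]coordsK E ?coords_neq0 // coordsK.
Qed.

Lemma regular_ratio U F G d : F \is d.-homog -> G \is d.-homog ->
  (forall p, U p -> peval G p != 0) -> regular U (fun p => peval F p / peval G p).
Proof.
move=> hF hG UG; apply: regular_local => v v0 Uv; exists d, F, G; split=> //.
  by rewrite -(peval_proj_neq0 hG v0); apply: UG.
by move=> w w0 _ _; rewrite (peval_proj_ratio hF hG w0).
Qed.

Lemma ev_eq_off0 F G Q : Q != 0 ->
  (forall v, v != 0 -> ev Q v != 0 -> ev F v = ev G v) -> F = G.
Proof.
move=> Q0 H; apply: (@ev_eq_off _ _ _ _ (Q * 'X_0)).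
  rewrite mulf_neq0 //; apply/eqP => /(congr1 (fun p => ev p (delta_mx 0 0))).
  by rewrite evX ev0 mxE eqxx => /eqP; rewrite oner_eq0.
move=> v; rewrite evM evX mulf_eq0 negb_or => /andP[Qv v0]; apply: H => //.
by apply: contraNneq v0 => ->; rewrite mxE.
Qed.

(** By irreducibility of the plane, an expression of a regular function as a
    quotient of forms that is valid on some nonempty open set is valid
    everywhere. *)
Lemma regular_global U f F G Q d : open U -> regular U f ->
  F \is d.-homog -> G \is d.-homog -> Q != 0 ->
  (forall v, v != 0 -> ev Q v != 0 -> U (proj_pt v) ->
     f (proj_pt v) * ev G v = ev F v) ->
  forall v, v != 0 -> U (proj_pt v) -> f (proj_pt v) * ev G v = ev F v.
Proof.
move=> oU rf hF hG Q0 HQ v v0 Uv.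
have [e [F' [G' [hF' hG' G'v E]]]] := regular_rep oU rf v0 Uv.
have EFG : F' * G = F * G'.
  apply: (@ev_eq_off0 _ _ (Q * G')); first by rewrite mulf_neq0 // (ev_neq0 G'v).
  move=> w w0; rewrite evM mulf_eq0 negb_or => /andP[Qw G'w].
  have [Uw Ew] := E w w0 G'w.
  by rewrite !evM -(HQ w w0 Qw Uw) Ew mulrAC divfK.
have [_ ->] := E v v0 G'v.
by rewrite mulrAC -evM EFG evM mulfK.
Qed.

Lemma open_lsub (A : 'M[K]_3) U : A \in unitmx -> open U ->
  open [set p : P2 | U (proj_pt (A *m coords p))].
Proof.
move=> Au [S [hS ->]]; have nz p : A *m coords p != 0.
  exact: (@GL3_mulv_neq0 _ (exist _ A Au)) (coords_neq0 p).
exists [set lsub A F | F in S]; split=> [_ [F SF <-]|].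
  by have [d hF] := hS F SF; exists d; apply: lsub_homog.
apply/seteqP; split=> p /=.
  move=> [F SF]; have [d hF] := hS F SF; rewrite (peval_proj_neq0 hF) // => Fp.
  by exists (lsub A F); [exists F | rewrite /peval -/(ev _ (coords p)) ev_lsub].
move=> [_ [F SF <-]]; have [d hF] := hS F SF.
rewrite /peval -/(ev _ (coords p)) ev_lsub => Fp.
by exists F => //; rewrite (peval_proj_neq0 hF).
Qed.

Lemma act_repr (g : PGL3 K) v : v != 0 ->
  PGL3_act g (proj_pt v) = proj_pt (val (repr g) *m v).
Proof. by move=> v0; rewrite -[g in LHS]reprK (PGL3_actE _ v0). Qed.

Lemma act_morphism (g : PGL3 K) : morphism (PGL3_act g).
Proof.
move=> U oU; have Au := valP (repr g).
have oU' : open (PGL3_act g @^-1` U).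
  exact: open_lsub Au oU.
split=> // h rh; apply: regular_local => v v0 Uv.
have Av0 := GL3_mulv_neq0 (repr g) v0.
move: Uv; rewrite /preimage /= act_repr // => Uv.
have [d [F [G [hF hG Gv E]]]] := regular_rep oU rh Av0 Uv.
exists d, (lsub (val (repr g)) F), (lsub (val (repr g)) G).
split; [exact: lsub_homog..|by rewrite ev_lsub|].
move=> w w0 _; rewrite !ev_lsub /= act_repr // => Gw.
by rewrite (E _ (GL3_mulv_neq0 _ w0) Gw).2.
Qed.

Lemma act_isomorphism (g : PGL3 K) : isomorphism (PGL3_act g).
Proof.
exists (PGL3_act g^-1%g); split; try exact: act_morphism.
- by move=> p; rewrite -PGL3_actM mulVg PGL3_act1.
- by move=> p; rewrite -PGL3_actM mulgV PGL3_act1.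
Qed.

Lemma act_open (g : PGL3 K) U : open U -> open (PGL3_act g @^-1` U).
Proof. by move=> /(act_morphism g)[]. Qed.

Lemma act_regular (g : PGL3 K) U f : open U -> regular U f ->
  regular (PGL3_act g @^-1` U) (f \o PGL3_act g).
Proof. by move=> /(act_morphism g)[_]; apply. Qed.

End Plane.

(** * Linearizing a point stabilizer *)

Section Linearization.
Variables (K : numClosedFieldType) (G : finSubgroup (PGL3 K)).
Implicit Types (g h : PGL3 K) (p : P2 K) (A B : 'M[K]_3) (v : 'cV[K]_3).

Definition lifts A g := exists c : K, c != 0 /\ val (repr g) = c *: A.

Lemma lifts_pi A (Au : A \in unitmx) g :
  lifts A g <-> g = \pi_(PGL3 K) (exist (fun M : 'M[K]_3 => M \in unitmx) A Au).
Proof.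
split=> [[c [c0 E]]|->]; last exact: repr_PGL3.
by rewrite -[LHS]reprK; apply: (@eq_PGL3 _ _ _ c).
Qed.

Lemma lifts_unit A g : lifts A g -> A \in unitmx.
Proof.
move=> [c [c0 E]]; have := valP (repr g).
by rewrite /= -[sval _]/(val (repr g)) E unitmxZ ?unitfE.
Qed.

Lemma lifts_act A g v : lifts A g -> v != 0 ->
  PGL3_act g (proj_pt v) = proj_pt (A *m v).
Proof.
by move=> /[dup] /lifts_unit Au /(lifts_pi Au) -> v0; rewrite PGL3_actE.
Qed.

Lemma lifts_repr g : lifts (val (repr g)) g.
Proof. by exists 1; rewrite oner_neq0 scale1r. Qed.

Lemma lifts_mul A B g h : lifts A g -> lifts B h -> lifts (A *m B) (g * h)%g.
Proof.
move=> /[dup] /lifts_unit Au /(lifts_pi Au) ->.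
move=> /[dup] /lifts_unit Bu /(lifts_pi Bu) ->.
have ABu : A *m B \in unitmx by rewrite unitmx_mul Au.
by apply/(lifts_pi ABu); rewrite [LHS]PGL3_mulE; apply: pi_PGL3.
Qed.

Lemma lifts1 : lifts 1%:M 1%g.
Proof. by apply/(lifts_pi (unitmx1 K 3)); apply: pi_PGL3. Qed.

Lemma lifts_inj A g h : lifts A g -> lifts A h -> g = h.
Proof.
by move=> /[dup] /lifts_unit Au /(lifts_pi Au) -> /(lifts_pi Au) ->.
Qed.

Lemma lifts_scale A c g : c != 0 -> lifts A g -> lifts (c *: A) g.
Proof.
move=> c0 [d [d0 E]]; exists (d / c); split; first by rewrite mulf_neq0 ?invr_eq0.
by rewrite scalerA divfK.
Qed.

Lemma lifts_exists A : A \in unitmx -> exists g, lifts A g.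
Proof.
by move=> Au; exists (\pi_(PGL3 K) (exist (fun M : 'M[K]_3 => M \in unitmx) A Au));
  apply/(lifts_pi Au).
Qed.

Lemma lifts_eq A B g : lifts A g -> lifts B g -> exists c, c != 0 /\ A = c *: B.
Proof.
move=> [c [c0 E]] [d [d0 F]]; exists (d / c); split.
  by rewrite mulf_neq0 ?invr_eq0.
by rewrite mulrC -scalerA -F E scalerA mulVf // scale1r.
Qed.

Lemma group_seq : exists s : seq (PGL3 K), uniq s /\ forall g, fsubg G g <-> g \in s.
Proof.
have /finite_seqP[s Es] := fsubg_finite G; exists (undup s).
split=> [|g]; first exact: undup_uniq.
by rewrite mem_undup; have := congr1 (fun A : set (PGL3 K) => A g) Es => /= ->.
Qed.

Lemma proj_pt_eq v w : v != 0 -> w != 0 ->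
  proj_pt v = proj_pt w -> exists c, c != 0 /\ v = c *: w.
Proof.
move=> v0 w0 E; have [c [c0 Ec]] := coords_proj_pt v0.
have [d [d0 Ed]] := coords_proj_pt w0; exists (d / c); split.
  by rewrite mulf_neq0 ?invr_eq0.
by rewrite mulrC -scalerA -Ed -E Ec scalerA mulVf // scale1r.
Qed.

(** Normalizing the lifts to fix a vector over p embeds the stabilizer of p
    into GL3. *)
Lemma stabilizer_lift v : v != 0 -> exists Hs : seq 'M[K]_3,
  matrix_group Hs /\
  forall A, A \in Hs <-> (A *m v = v /\ exists g, fsubg G g /\ lifts A g).
Proof.
move=> v0; have [s [us sG]] := group_seq; have [i vi] := cV0Pn _ v0.
pose lift g := ((val (repr g) *m v) i 0 / v i 0)^-1 *: val (repr g).
pose Hs := undup [seq lift g | g <- s & PGL3_act g (proj_pt v) == proj_pt v].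
have liftP g : PGL3_act g (proj_pt v) = proj_pt v ->
    lifts (lift g) g /\ lift g *m v = v.
  rewrite act_repr // => E.
  have [c [c0 Ec]] := proj_pt_eq (GL3_mulv_neq0 _ v0) v0 E.
  have Ek : (val (repr g) *m v) i 0 / v i 0 = c by rewrite Ec mxE mulfK.
  rewrite /lift Ek; split; last by rewrite -scalemxAl Ec scalerA mulVf // scale1r.
  by apply: lifts_scale; [rewrite invr_eq0|exact: lifts_repr].
have mem A : A \in Hs <-> (A *m v = v /\ exists g, fsubg G g /\ lifts A g).
  rewrite mem_undup; split=> [/mapP[g]|[Av [g [Gg Ag]]]].
    rewrite mem_filter => /andP[/eqP gp /sG Gg] ->.
    by have [l f] := liftP g gp; split=> //; exists g.
  have gp : PGL3_act g (proj_pt v) = proj_pt v by rewrite (lifts_act Ag v0) Av.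
  apply/mapP; exists g; first by rewrite mem_filter gp eqxx; apply/sG.
  have [l f] := liftP g gp; have [c [c0 E]] := lifts_eq Ag l.
  have: c *: v = v by rewrite -[RHS]Av E -scalemxAl f.
  move/eqP; rewrite -{2}[v]scale1r -subr_eq0 -scalerBl scaler_eq0 (negPf v0) orbF.
  by rewrite subr_eq0 => /eqP c1; rewrite E c1 scale1r.
exists Hs; split=> //; split.
- exact: undup_uniq.
- apply/mem; split; first exact: mul1mx.
  by exists 1%g; split; [exact: fsubg1|exact: lifts1].
- move=> A B /mem[Av [g [Gg Ag]]] /mem[Bv [h [Gh Bh]]]; apply/mem.
  split; first by rewrite -mulmxA Bv Av.
  by exists (g * h)%g; split; [exact: fsubgM|exact: lifts_mul].
by move=> A /mem[_ [g [_ /lifts_unit]]].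
Qed.

Definition cc (x : 'cV[K]_2) : 'cV[K]_(1 + 2) := col_mx (1%:M : 'cV[K]_1) x.

Lemma cc_neq0 x : cc x != 0.
Proof.
apply/eqP => /(congr1 (fun y : 'cV[K]_(1 + 2) => usubmx y 0 0)).
by rewrite /cc col_mxKu !mxE => /eqP; rewrite oner_eq0.
Qed.

Definition blk (M : 'M[K]_2) : 'M[K]_(1 + 2) := block_mx (1%:M : 'M[K]_1) 0 0 M.

Lemma blk_cc M x : blk M *m cc x = cc (M *m x).
Proof. by rewrite /blk /cc mul_block_col !mul0mx mul1mx addr0 add0r. Qed.

Lemma blkM M N : blk M *m blk N = blk (M *m N).
Proof. by rewrite /blk mulmx_block !mul0mx !mulmx0 mul1mx !addr0 add0r. Qed.

Lemma blk_unit M : (blk M \in unitmx) = (M \in unitmx).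
Proof. by rewrite !unitmxE /blk det_ublock det1 mul1r. Qed.

Lemma basis_completion v (lam : 'rV[K]_3) : v != 0 -> lam *m v = 1%:M ->
  exists B, [/\ B \in unitmx, B *m cc 0 = v & lam *m B = row_mx (1%:M : 'M[K]_1) 0].
Proof.
move=> v0 lv.
have [B0 B0u B0v] : exists2 B0 : 'M[K]_3, B0 \in unitmx & B0 *m cc 0 = v.
  have rv : \rank v = 1%N.
    by apply/eqP; rewrite eqn_leq rank_leq_col lt0n mxrank_eq0 v0.
  have := mulmx_ebase v; rewrite rv => E.
  have [r Er] : exists r, row_ebase v = r%:M.
    by exists (row_ebase v 0 0); rewrite [LHS]mx11_scalar.
  have r0 : r != 0.
    have := row_ebase_unit v; rewrite Er unitmxE det_scalar expr1 unitfE //.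
  exists (r *: col_ebase v); first by rewrite unitmxZ ?unitfE ?col_ebase_unit.
  rewrite -[RHS]E Er mul_mx_scalar -scalemxAl; congr (_ *: (_ *m _)).
  exact/esym/(pid_mx_col K 2 1).
have [r Er] : exists r : 'rV[K]_2, lam *m B0 = row_mx (1%:M : 'M[K]_1) r.
  pose Y : 'rV[K]_(1 + 2) := lam *m B0; exists (rsubmx Y).
  have YE : Y = row_mx (lsubmx Y) (rsubmx Y) by rewrite hsubmxK.
  suff E : lsubmx Y = 1%:M by rewrite -E -YE.
  have: Y *m cc 0 = 1%:M by rewrite /Y -mulmxA B0v.
  by rewrite YE /cc mul_row_col mulmx1 mulmx0 addr0 row_mxKl.
pose C : 'M[K]_(1 + 2) := block_mx (1%:M : 'M[K]_1) (- r) 0 1%:M.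
have Cu : C \in unitmx by rewrite unitmxE det_ublock !det1 mulr1 unitr1.
have C0 : C *m cc 0 = cc 0.
  by rewrite /C /cc mul_block_col !mulmx0 mul0mx mul1mx !addr0.
have rC : row_mx (1%:M : 'M[K]_1) r *m C = row_mx 1%:M 0.
  by rewrite mul_row_block mulmx1 mul1mx mulmx0 addr0 mulmx1 addNr.
exists (B0 *m C); split; first by rewrite unitmx_mul B0u.
- by rewrite -mulmxA -[X in _ *m X]/(C *m cc 0) C0 B0v.
by rewrite mulmxA Er -[LHS]/(row_mx (1%:M : 'M[K]_1) r *m C) rC.
Qed.

(** By Maschke's theorem, the stabilizer of a point acts linearly in suitable
    affine coordinates centered at this point. *)
Lemma linearization p : exists B (H : seq 'M[K]_2),
  [/\ B \in unitmx, proj_pt (B *m cc 0) = p, matrix_group H,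
     (forall M, M \in H -> exists2 g, fsubg G g & lifts (B *m blk M *m invmx B) g) &
     forall g, fsubg G g -> PGL3_act g p = p ->
       exists2 M, M \in H & lifts (B *m blk M *m invmx B) g].
Proof.
rewrite -[p]coordsK; set v := coords p; have v0 : v != 0 := coords_neq0 p.
have [Hs [gHs mem]] := stabilizer_lift v0; have [Hu H1 HM HU] := gHs.
have [i vi] := cV0Pn _ v0.
pose lam0 : 'rV[K]_3 := (v i 0)^-1 *: delta_mx 0 i.
have lam0v : lam0 *m v = 1%:M.
  rewrite -scalemxAl -rowE; apply/matrixP => a b; rewrite !ord1 !mxE eqxx.
  by rewrite mulVf.
have n0 : (size Hs)%:R != 0 :> K by rewrite pnatr_eq0; case: (Hs) H1.
pose lam : 'rV[K]_3 := (size Hs)%:R^-1 *: \sum_(A <- Hs) lam0 *m A.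
have lamv : lam *m v = 1%:M.
  rewrite -scalemxAl mulmx_suml big_seq (eq_bigr (fun=> 1%:M)); last first.
    by move=> A /mem[Av _]; rewrite -mulmxA Av.
  rewrite -big_seq big_const_seq count_predT iter_addr_0 -scaler_nat scalerA.
  by rewrite mulVf // scale1r.
have lamA A : A \in Hs -> lam *m A = lam.
  move=> AH; rewrite -scalemxAl mulmx_suml; congr (_ *: _).
  rewrite -[RHS](perm_big _ (matrix_group_translate gHs AH)) /= big_map.
  by apply: eq_bigr => N _; rewrite mulmxA.
have [B [Bu Bv lamB]] := basis_completion v0 lamv.
have conj A : A \in Hs -> exists M, invmx B *m A *m B = blk M.
  move=> AH; pose X : 'M[K]_(1 + 2) := invmx B *m A *m B.
  have Xe : X *m cc 0 = cc 0.
    have [Av _] := (mem A).1 AH.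
    by rewrite /X -!mulmxA Bv Av -[v]Bv mulKmx.
  have Xl : row_mx (1%:M : 'M[K]_1) 0 *m X = row_mx (1%:M : 'M[K]_1) (0 : 'M[K]_(1, 2)).
    by rewrite -lamB /X !mulmxA mulmxK // lamA.
  exists (drsubmx X); rewrite -[LHS]/X -[LHS](@submxK _ 1 2 1 2).
  move: Xe Xl; rewrite -{1 2}[X](@submxK _ 1 2 1 2) /cc mul_block_col mul_row_block.
  rewrite !mulmx0 !mulmx1 !addr0 !mul1mx !mul0mx !addr0.
  by move=> /eq_col_mx[-> ->] /eq_row_mx[_ ->].
pose H := [seq drsubmx (invmx B *m A *m B : 'M[K]_(1 + 2)) | A <- Hs].
have HP A : A \in Hs -> A = B *m blk (drsubmx (invmx B *m A *m B : 'M[K]_(1 + 2))) *m invmx B.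
  move=> /conj[M E]; rewrite E /blk block_mxKdr -/(blk M) -E.
  by rewrite !mulmxA mulmxV // mul1mx mulmxK.
have memH M : M \in H <-> B *m blk M *m invmx B \in Hs.
  split=> [/mapP[A AH ->]|MH]; first by rewrite -HP.
  apply/mapP; exists (B *m blk M *m invmx B) => //.
  by rewrite -!mulmxA mulVmx // mulmx1 mulKmx // /blk block_mxKdr.
exists B, H; split=> //; first by rewrite Bv.
- split.
  + rewrite map_inj_in_uniq // => A A' AH AH' E.
    by rewrite (HP _ AH) (HP _ AH') E.
  + apply/memH; suff -> : B *m blk 1%:M *m invmx B = 1%:M by [].
    by rewrite /blk -scalar_mx_block mulmx1 mulmxV.
  + move=> M N /memH MH /memH NH; apply/memH.
    suff -> : B *m blk (M *m N) *m invmx B =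
      (B *m blk M *m invmx B) *m (B *m blk N *m invmx B) by apply: HM.
    by rewrite -blkM !mulmxA mulmxKV.
  + by move=> M /memH /HU; rewrite !unitmx_mul blk_unit => /andP[/andP[]].
- by move=> M /memH/mem[_ [g [Gg l]]]; exists g.
move=> g Gg gp; have l0 := lifts_repr g.
have: lifts (val (repr g)) g by [].
have [c [c0 Ec]] : exists c, c != 0 /\ val (repr g) *m v = c *: v.
  by apply: (proj_pt_eq (GL3_mulv_neq0 (repr g) v0) v0); rewrite -act_repr.
move=> /(lifts_scale (c := c^-1)); rewrite invr_eq0 => /(_ c0) l.
have AH : c^-1 *: val (repr g) \in Hs.
  apply/mem; split; first by rewrite -scalemxAl Ec scalerA mulVf // scale1r.
  by exists g.
exists (drsubmx (invmx B *m (c^-1 *: val (repr g)) *m B : 'M[K]_(1 + 2))).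
  by apply/mapP; exists (c^-1 *: val (repr g)).
by rewrite -HP.
Qed.

End Linearization.

(** * Local study of the quotient map *)

Section Ideals.
Variables (K : numClosedFieldType) (n : nat).
Implicit Types f g : {mpoly K[n]}.

(** The N-th power of the maximal ideal of the origin. *)
Definition ord_ge N f := forall d, (d < N)%N -> hc d f = 0.

Lemma ord_ge0 N : ord_ge N 0. Proof. by move=> d _; rewrite hc0. Qed.
Lemma ord_geD N f g : ord_ge N f -> ord_ge N g -> ord_ge N (f + g).
Proof. by move=> hf hg d dN; rewrite hcD hf ?hg ?addr0. Qed.
Lemma ord_geM a b f g : ord_ge a f -> ord_ge b g -> ord_ge (a + b) (f * g).
Proof.
move=> hf hg d dab; rewrite hcM big1 // => i _.
have [ia|ai] := ltnP i a; first by rewrite hf ?mul0r.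
rewrite (hg (d - i)%N) ?mulr0 //; have := ltn_ord i; rewrite ltnS => id.
by rewrite ltn_subLR // (leq_trans dab) // leq_add2r.
Qed.
Lemma ord_geMl N f g : ord_ge N g -> ord_ge N (f * g).
Proof. by move=> hg; rewrite -[N]add0n; apply: ord_geM. Qed.
Lemma ord_geMr N f g : ord_ge N f -> ord_ge N (f * g).
Proof. by rewrite mulrC; apply: ord_geMl. Qed.
Lemma ord_ge1 f : ev f 0 = 0 -> ord_ge 1 f.
Proof. by move=> f0 [|//] _; rewrite hc_degree0 f0. Qed.
Lemma ord_ge_pow N f : ev f 0 = 0 -> ord_ge N (f ^+ N).
Proof.
move=> f0; elim: N => [|N IHN] //; rewrite exprS -add1n.
exact: ord_geM (ord_ge1 f0) IHN.
Qed.

Lemma hc_lsub (A : 'M[K]_n) d f : hc d (lsub A f) = lsub A (hc d f).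
Proof.
have lsum m (F : 'I_m -> {mpoly K[n]}) :
    lsub A (\sum_i F i) = \sum_i lsub A (F i) by exact: raddf_sum.
set k := maxn (msize f) d.+1.
rewrite {1}(@hc_partition _ _ f k) ?leq_maxl // lsum hc_sum.
have dk : (d < k)%N by rewrite leq_maxr.
rewrite (bigD1 (Ordinal dk)) //= hc_id ?lsub_homog ?hc_homog // big1 ?addr0 //.
move=> i ne; apply: (@hc_ne _ _ i); last by apply: lsub_homog; apply: hc_homog.
by apply: contraNneq ne => id; apply/eqP/val_inj.
Qed.

End Ideals.

Section Chart.
Variables (K : numClosedFieldType) (B : 'M[K]_3).
Hypothesis Bu : B \in unitmx.
Implicit Types (x y : 'cV[K]_2) (F : {mpoly K[3]}) (P Q : {mpoly K[2]}).

Definition chart x : P2 K := proj_pt (B *m cc x).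

Lemma chart_neq0 x : B *m cc x != 0.
Proof. exact: (@GL3_mulv_neq0 _ (exist _ B Bu)) (cc_neq0 x). Qed.

Definition aff F : {mpoly K[2]} :=
  psub (fun i => lform (row i (rsubmx (B : 'M[K]_(3, 1 + 2)))) +
                 (lsubmx (B : 'M[K]_(3, 1 + 2)) i 0)%:MP) F.

Lemma ev_aff F x : ev (aff F) x = ev F (B *m cc x).
Proof.
pose B' : 'M[K]_(3, 1 + 2) := B.
have E : B' *m cc x = lsubmx B' + rsubmx B' *m x.
  by rewrite -{1}[B']hsubmxK /cc mul_row_col mulmx1.
rewrite ev_psub; congr (ev F _); apply/colP => i.
rewrite mxE evD evC ev_lform -row_mul mxE addrC.
by transitivity ((B' *m cc x) i 0) => //; rewrite E [RHS]mxE.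
Qed.

Lemma act_chart (M : 'M[K]_2) g x : lifts (B *m blk M *m invmx B) g ->
  PGL3_act g (chart x) = chart (M *m x).
Proof.
move=> l; rewrite (lifts_act l (chart_neq0 x)) /chart.
by rewrite !mulmxA mulmxKV // -!mulmxA blk_cc.
Qed.

Lemma chart_rep (U : set (P2 K)) f : open U -> regular U f -> U (chart 0) ->
  exists P Q, ev Q 0 != 0 /\ forall x, ev Q x != 0 ->
    U (chart x) /\ f (chart x) = ev P x / ev Q x.
Proof.
move=> oU rf U0.
have [d [F [G [hF hG G0 E]]]] := regular_rep oU rf (chart_neq0 0) U0.
exists (aff F), (aff G); rewrite ev_aff; split=> // x; rewrite !ev_aff => Gx.
by have [] := E _ (chart_neq0 x) Gx.
Qed.

Definition locrep (f : P2 K -> K) P Q :=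
  ev Q 0 != 0 /\ forall x, ev Q x != 0 -> f (chart x) = ev P x / ev Q x.

Lemma locrepD f g P Q P' Q' : locrep f P Q -> locrep g P' Q' ->
  locrep (fun p => f p + g p) (P * Q' + P' * Q) (Q * Q').
Proof.
move=> [Q0 E] [Q0' E']; split=> [|x]; first by rewrite evM mulf_neq0.
rewrite !(evM, evD) mulf_eq0 negb_or => /andP[Qx Qx'].
by rewrite E // E' // addf_div.
Qed.

Lemma locrepM f g P Q P' Q' : locrep f P Q -> locrep g P' Q' ->
  locrep (fun p => f p * g p) (P * P') (Q * Q').
Proof.
move=> [Q0 E] [Q0' E']; split=> [|x]; first by rewrite evM mulf_neq0.
by rewrite !evM mulf_eq0 negb_or => /andP[Qx Qx']; rewrite E // E' // mulf_div.
Qed.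

(** The Taylor expansion of f at the origin of the chart is g up to order N;
    clearing the denominator avoids power series. *)
Definition approx N (f : P2 K -> K) (g : {mpoly K[2]}) :=
  exists P Q, locrep f P Q /\ ord_ge N (P - g * Q).

Lemma approx_cst N c : approx N (fun _ => c) c%:MP.
Proof.
exists c%:MP, 1; split; last by rewrite mulr1 subrr; apply: ord_ge0.
by split=> [|x _]; rewrite ?ev1 ?evC ?divr1 ?oner_neq0.
Qed.

Lemma approxD N f g f' g' : approx N f g -> approx N f' g' ->
  approx N (fun p => f p + f' p) (g + g').
Proof.
move=> [P [Q [l h]]] [P' [Q' [l' h']]].
exists (P * Q' + P' * Q), (Q * Q'); split; first exact: locrepD.
have -> : P * Q' + P' * Q - (g + g') * (Q * Q') =
  (P - g * Q) * Q' + (P' - g' * Q') * Q by ring.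
by apply: ord_geD; apply: ord_geMr.
Qed.

Lemma approxM N f g f' g' : approx N f g -> approx N f' g' ->
  approx N (fun p => f p * f' p) (g * g').
Proof.
move=> [P [Q [l h]]] [P' [Q' [l' h']]].
exists (P * P'), (Q * Q'); split; first exact: locrepM.
have -> : P * P' - g * g' * (Q * Q') =
  (P - g * Q) * P' + (P' - g' * Q') * (g * Q) by ring.
by apply: ord_geD; apply: ord_geMr.
Qed.

Lemma approx_ext N f f' g : f =1 f' -> approx N f g -> approx N f' g.
Proof. by move=> /funext ->. Qed.

Lemma approx0M N f f' P Q : approx N f 0 -> locrep f' P Q ->
  approx N (fun p => f p * f' p) 0.
Proof.
move=> [P' [Q' [l h]]] l'; exists (P' * P), (Q' * Q); split.
  exact: locrepM.
by move: h; rewrite !mul0r !subr0; apply: ord_geMr.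
Qed.

Lemma approxX N f g k : approx N f g -> approx N (fun p => f p ^+ k) (g ^+ k).
Proof.
move=> h; elim: k => [|k IHk].
  by rewrite expr0 -mpolyC1; apply: approx_ext (approx_cst N 1) => p; rewrite expr0.
by rewrite exprS; apply: approx_ext (approxM h IHk) => p; rewrite exprS.
Qed.

Lemma approx_pow N f P Q : locrep f P Q -> f (chart 0) = 0 ->
  approx N (fun p => f p ^+ N) 0.
Proof.
move=> [Q0 E] f0; have P0 : ev P 0 = 0.
  by move: f0; rewrite E // => /eqP; rewrite mulf_eq0 invr_eq0 (negPf Q0) orbF => /eqP.
exists (P ^+ N), (Q ^+ N); split.
  split=> [|x]; first by rewrite evXn expf_neq0.
  rewrite !evXn expf_eq0 negb_and => /orP[N0|Qx]; last by rewrite E // expr_div_n.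
  by move: N0; rewrite -eqn0Ngt => /eqP ->; rewrite !expr0 divr1.
by rewrite mul0r subr0; apply: ord_ge_pow.
Qed.

Lemma approx_subst N (xi : 'I_2 -> P2 K -> K) (g : {mpoly K[2]}) :
  (forall i, approx N (xi i) 'X_i) ->
  approx N (fun p => ev g (\col_i xi i p)) g.
Proof.
move=> hxi; elim/mpoly_closed: g => [c|i|g h IHg IHh|g h IHg IHh].
- by apply: approx_ext (approx_cst N c) => p; rewrite evC.
- by apply: approx_ext (hxi i) => p; rewrite evX mxE.
- by apply: approx_ext (approxD IHg IHh) => p; rewrite evD.
- by apply: approx_ext (approxM IHg IHh) => p; rewrite evM.
Qed.

Lemma approx_act N f g (M : 'M[K]_2) gam :
  lifts (B *m blk M *m invmx B) gam -> approx N f g ->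
  approx N (f \o PGL3_act gam) (lsub M g).
Proof.
move=> l [P [Q [[Q0 E] h]]]; exists (lsub M P), (lsub M Q); split.
  split=> [|x]; first by rewrite ev_lsub mulmx0.
  by rewrite !ev_lsub /= (act_chart _ l) => /E.
have -> : lsub M P - lsub M g * lsub M Q = lsub M (P - g * Q).
  by apply: ev_inj => x; rewrite !(evB, evM, ev_lsub).
by move=> d dN; rewrite hc_lsub h //; apply: ev_inj => x; rewrite ev_lsub !ev0.
Qed.

End Chart.

Section RegularClosure.
Variables (K : numClosedFieldType) (X : funSpaceType K) (U : set X).
Hypothesis oU : open U.

Lemma regular_eq f g : f =1 g -> regular U f -> regular U g.
Proof. by move=> /funext ->. Qed.

Lemma regularX f k : regular U f -> regular U (fun x => f x ^+ k).
Proof.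
move=> rf; elim: k => [|k IHk]; first exact: regular_cst.
by apply: (regular_eq (f := fun x => f x * f x ^+ k)) (regular_mul _ _ _ oU rf IHk) => x;
  rewrite exprS.
Qed.

Lemma regular_bigprod (I : Type) (r : seq I) (P : pred I) (f : I -> X -> K) :
  (forall i, regular U (f i)) -> regular U (fun x => \prod_(i <- r | P i) f i x).
Proof.
move=> rf; elim: r => [|i r IHr].
  apply: (regular_eq (f := fun=> 1)) => [x|]; first by rewrite big_nil.
  exact: regular_cst.
case Pi : (P i).
  apply: (regular_eq (f := fun x => f i x * \prod_(j <- r | P j) f j x)).
    by move=> x; rewrite big_cons Pi.
  exact: regular_mul.
by apply: regular_eq IHr => x; rewrite big_cons Pi.
Qed.

Lemma regular_bigsum (I : eqType) (r : seq I) (f : I -> X -> K) :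
  (forall i, i \in r -> regular U (f i)) -> regular U (fun x => \sum_(i <- r) f i x).
Proof.
elim: r => [|i r IHr] rf.
  apply: (regular_eq (f := fun=> 0)) => [x|]; first by rewrite big_nil.
  exact: regular_cst.
apply: (regular_eq (f := fun x => f i x + \sum_(j <- r) f j x)).
  by move=> x; rewrite big_cons.
apply: regular_add => //; first by apply: rf; rewrite inE eqxx.
by apply: IHr => j jr; apply: rf; rewrite inE jr orbT.
Qed.

Lemma regular_opp f : regular U f -> regular U (fun x => - f x).
Proof.
move=> rf; apply: (regular_eq (f := fun x => -1 * f x)) => [x|].
  by rewrite mulN1r.
by apply: regular_mul => //; apply: regular_cst.
Qed.

Lemma regular_eval n (g : {mpoly K[n]}) (xi : 'I_n -> X -> K) :
  (forall i, regular U (xi i)) -> regular U (fun x => ev g (\col_i xi i x)).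
Proof.
move=> rxi; elim/mpoly_closed: g => [c|i|g h rg rh|g h rg rh].
- apply: (regular_eq (f := fun=> c)) => [x|]; first by rewrite evC.
  exact: regular_cst.
- by apply: regular_eq (rxi i) => x; rewrite evX mxE.
- by apply: regular_eq (regular_add _ _ _ oU rg rh) => x; rewrite evD.
- by apply: regular_eq (regular_mul _ _ _ oU rg rh) => x; rewrite evM.
Qed.

End RegularClosure.

Lemma separating_form (K : fieldType) n (v w : 'cV[K]_n) :
  v != 0 -> (forall c, v <> c *: w) ->
  exists a : 'rV[K]_n, (a *m w) 0 0 = 0 /\ (a *m v) 0 0 = 1.
Proof.
move=> v0 vw; have: ~~ (v^T <= w^T)%MS.
  apply/negP => /sub_rVP[c E]; apply: (vw c).
  by apply: trmx_inj; rewrite E linearZ.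
rewrite submxE => /rV0Pn[j nz].
pose k := (v^T *m cokermx w^T) 0 j.
exists (k^-1 *: (cokermx w^T *m delta_mx j 0)^T).
rewrite -!scalemxAl; split; rewrite mxE.
  rewrite -{2}[w]trmxK -trmx_mul mulmxA mulmx_coker mul0mx trmx0.
  by rewrite mxE mulr0.
by rewrite -{1}[v]trmxK -trmx_mul mulmxA -colE mxE [X in _ * X]mxE mulVf.
Qed.

Section Approximation.
Variables (K : numClosedFieldType) (G : finSubgroup (PGL3 K)).
Variables (B : 'M[K]_3) (H : seq 'M[K]_2).
Hypothesis Bu : B \in unitmx.
Local Notation p := (chart B 0).
Hypothesis GH : forall g, fsubg G g -> PGL3_act g p = p ->
  exists2 M, M \in H & lifts (B *m blk M *m invmx B) g.

Local Opaque PGL3_act proj_pt.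

(** Average over G a regular function that has the expansion g at p and
    vanishes to high order at the other points of the orbit of p. The elements
    of G that fix p do not change the expansion, since g is invariant. *)
Lemma invariant_approximation N (g : {mpoly K[2]}) : inv H g ->
  exists V (f : P2 K -> K), [/\ open V, V p & regular V f] /\
    [/\ forall gam q, fsubg G gam -> V q -> V (PGL3_act gam q),
        forall gam q, fsubg G gam -> f (PGL3_act gam q) = f q & approx B N f g].
Proof.
move=> hg; have [s [us sG]] := group_seq G.
set v := B *m cc 0; have v0 : v != 0 := chart_neq0 Bu 0.
pose w (gam : PGL3 K) : 'cV[K]_3 := val (repr gam) *m v.
have w0 gam : w gam != 0 := GL3_mulv_neq0 (repr gam) v0.
have actp (gam : PGL3 K) : PGL3_act gam p = proj_pt (w gam) by rewrite /chart act_repr.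
have [l [l1 lw]] : exists l : 'rV[K]_3, (l *m v) 0 0 = 1 /\
    forall gam, gam \in s -> (l *m w gam) 0 0 != 0.
  have [x|l0 Hl] := avoid (s := v :: [seq w gam | gam <- s]).
    by rewrite inE => /orP[/eqP ->|/mapP[gam _ ->]].
  have lv : (l0 *m v) 0 0 != 0 by apply: Hl; rewrite inE eqxx.
  exists (((l0 *m v) 0 0)^-1 *: l0); split=> [|gam gs].
    by rewrite -scalemxAl mxE mulVf.
  rewrite -scalemxAl mxE mulf_neq0 ?invr_eq0 //; apply: Hl.
  by rewrite inE map_f ?orbT.
pose L := aff B (lform l).
have L0 : ev L 0 = 1 by rewrite ev_aff ev_lform.
pose rat a (q : P2 K) := peval (lform a) q / peval (lform l) q.
pose Vl := [set q : P2 K | peval (lform l) q != 0].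
have oVl : open Vl := open_principal (lform_homog l).
have rrat a : regular Vl (rat a) by apply: regular_ratio (lform_homog _) (lform_homog _) _.
have ratE a y : y != 0 -> rat a (proj_pt y) = (a *m y) 0 0 / (l *m y) 0 0.
  by move=> y0; rewrite /rat (peval_proj_ratio (lform_homog a) (lform_homog l) y0) !ev_lform.
have rowE (a b : _) x : ((row_mx (a : 'M[K]_1) (b : 'rV[K]_2) *m invmx B) *m (B *m cc x)) 0 0
    = a 0 0 + (b *m x) 0 0.
  rewrite mulmxA mulmxKV //.
  have -> : row_mx a b *m cc x = a + b *m x by rewrite /cc mul_row_col mulmx1.
  by rewrite mxE.
pose lam : 'rV[K]_3 := row_mx (1%:M : 'M[K]_1) 0 *m invmx B.
pose coord i : 'rV[K]_3 := row_mx (0 : 'M[K]_1) (delta_mx 0 i : 'rV[K]_2) *m invmx B.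
have lamE x : (lam *m (B *m cc x)) 0 0 = 1.
  by rewrite rowE mul0mx !mxE eqxx addr0.
have coordE i x : (coord i *m (B *m cc x)) 0 0 = x i 0.
  by rewrite rowE -matrix.rowE !mxE add0r.
(* The affine coordinate x_i is (coord i) / lam. To have the same denominator
   l at all points of the orbit, lam is inverted by a geometric series in 1 -
   lam / l, which vanishes at p. *)
pose xi i q := rat (coord i) q * \sum_(k < N) (1 + - rat lam q) ^+ k.
have rxi i : regular Vl (xi i).
  apply: regular_mul => //.
  apply: (regular_eq (f := fun q => \sum_(k <- index_enum 'I_N) (1 + - rat lam q) ^+ k)) => //.
  apply: regular_bigsum => // k _; apply: regularX => //; apply: regular_add => //.
    exact: regular_cst.
  exact: regular_opp.
have axi i : approx B N (xi i) 'X_i.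
  exists ('X_i * (L ^+ N - (L - 1) ^+ N) * L), (L ^+ N * L); split; last first.
    have -> : 'X_i * (L ^+ N - (L - 1) ^+ N) * L - 'X_i * (L ^+ N * L) =
      - ('X_i * L) * (L - 1) ^+ N by ring.
    by apply/ord_geMl/ord_ge_pow; rewrite evB L0 ev1 subrr.
  split=> [|x]; first by rewrite evM evXn L0 expr1n mulr1 oner_neq0.
  rewrite evM mulf_eq0 negb_or => /andP[_ Lx].
  rewrite /xi /chart !ratE ?chart_neq0 // lamE coordE.
  have EL : (l *m (B *m cc x)) 0 0 = ev L x by rewrite ev_aff ev_lform.
  rewrite EL !(evM, evB, evX, evXn, ev1); set z := ev L x in Lx *.
  have geo := subrX1 (1 - 1 / z) N.
  have {}geo : 1 / z * \sum_(k < N) (1 + - (1 / z)) ^+ k = 1 - (1 - 1 / z) ^+ N.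
    by rewrite -[RHS]opprB geo; ring.
  have -> : x i 0 / z * \sum_(k < N) (1 + - (1 / z)) ^+ k =
      x i 0 * (1 / z * \sum_(k < N) (1 + - (1 / z)) ^+ k) by rewrite mul1r mulrA.
  rewrite geo; have -> : 1 - 1 / z = (z - 1) / z by field.
  rewrite expr_div_n -mulf_div divff // mulr1 -mulrA mulrBl divff ?expf_neq0 //.
have sep gam : exists a : 'rV[K]_3, PGL3_act gam p != p ->
    (a *m w gam) 0 0 = 0 /\ (a *m v) 0 0 = 1.
  have [E|ne] := eqVneq (PGL3_act gam p) p; first by exists 0.
  have [|a Ha] := separating_form v0 (w := w gam); last by exists a.
  move=> c E; move/eqP: ne; apply; rewrite actp /chart -/v E proj_ptZ //.
  by apply: contraNneq v0 => c0; rewrite E c0 scale0r.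
have {sep}[a sep] := choice sep.
pose r q := \prod_(gam <- s | PGL3_act gam p != p) rat (a gam) q.
have rr : regular Vl r by apply: regular_bigprod.
have r1 : r p = 1.
  rewrite /r big1 // => gam /sep[_ av].
  by rewrite /chart ratE // av l1 divr1.
have rgam gam : gam \in s -> PGL3_act gam p != p -> r (PGL3_act gam p) = 0.
  move=> gs ne; have r0 : rat (a gam) (PGL3_act gam p) = 0.
    by rewrite actp (ratE _ _ (w0 gam)) (sep _ ne).1 mul0r.
  apply/eqP; rewrite /r prodf_seq_eq0; apply/hasP; exists gam; first exact: gs.
  by apply/andP; split; [exact: ne|apply/eqP; exact: r0].
(* As r is 1 at p and 0 at the other points of the orbit, eps is 1 at p and 0
   at the other points, to order N in both cases. *)
pose eps q := 1 + -1 * (1 + -1 * r q ^+ N) ^+ N.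
pose gx q := ev g (\col_i xi i q).
have rt : regular Vl (fun q => 1 + -1 * r q ^+ N).
  apply: regular_add => //; first exact: regular_cst.
  by apply: regular_mul => //; [exact: regular_cst|exact: regularX].
have reps : regular Vl eps.
  apply: regular_add => //; first exact: regular_cst.
  by apply: regular_mul => //; [exact: regular_cst|exact: regularX].
have rgx : regular Vl gx by apply: regular_eval.
pose rho q := eps q * gx q.
have rrho : regular Vl rho by apply: regular_mul.
have Vlp : Vl p.
  by rewrite /Vl /= (peval_proj_neq0 (lform_homog l)) // ev_lform l1 oner_neq0.
have arho : approx B N rho g.
  have aeps : approx B N eps 1.
    have [P [Q [Q0 E]]] := chart_rep Bu oVl rt Vlp.
    have lr : locrep B (fun q => 1 + -1 * r q ^+ N) P Q.
      by split=> // x /E[].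
    have := approx_pow N lr; rewrite r1 expr1n mulr1 subrr => /(_ erefl) apow.
    have := approxD (approx_cst B N 1) (approxM (approx_cst B N (-1)) apow).
    by rewrite mulr0 addr0 mpolyC1.
  by have := approxM aeps (approx_subst g axi); rewrite mul1r.
have agam gam : gam \in s ->
    approx B N (rho \o PGL3_act gam) (if PGL3_act gam p == p then g else 0).
  move=> gs; case: eqP => [E|/eqP ne].
    have [M MH lM] := GH ((sG gam).2 gs) E.
    have <- : lsub M g = g by apply: ev_inj => x; rewrite ev_lsub hg.
    exact: approx_act.
  have oV' := act_open gam oVl.
  have V'p : (PGL3_act gam @^-1` Vl) p.
    by rewrite /preimage /= actp /Vl /= (peval_proj_neq0 (lform_homog l)) // ev_lform lw.
  have rep h : regular Vl h -> exists P Q, locrep B (h \o PGL3_act gam) P Q.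
    move=> rh; have [P [Q [Q0 E]]] := chart_rep Bu oV' (act_regular (g := gam) oVl rh) V'p.
    by exists P, Q; split=> // x /E[].
  have [P [Q lr]] := rep _ rr; have := approx_pow N lr.
  rewrite /= rgam // => /(_ erefl) apow.
  have [P' [Q' lg]] := rep _ rgx.
  apply: approx0M lg.
  have := approxD (approx_cst B N 1) (approxM (approx_cst B N (-1))
    (approxX N (approxD (approx_cst B N 1) (approxM (approx_cst B N (-1)) apow)))).
  rewrite mulr0 addr0 mpolyC1 expr1n mulr1.
  suff -> : 1 + (-1)%:MP = 0 :> {mpoly K[2]} by [].
  by rewrite -mpolyC1 -mpolyCD subrr mpolyC0.
pose V := [set q | forall gam, gam \in s -> Vl (PGL3_act gam q)].
have oV : open V.
  have -> : V = \bigcap_(gam in [set` s]) (PGL3_act gam @^-1` Vl).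
    by apply/seteqP; split=> q Hq gam; apply: Hq.
  rewrite bigcap_seq; elim: (s) => [|gam t IHt]; first by rewrite big_nil; exact: openT.
  by rewrite big_cons; apply: openI => //; apply: act_open.
have Vp : V p.
  move=> gam gs; rewrite actp /Vl /= (peval_proj_neq0 (lform_homog l)) //.
  by rewrite ev_lform lw.
pose m := count (fun gam => PGL3_act gam p == p) s.
have m0 : m%:R != 0 :> K.
  rewrite pnatr_eq0 -lt0n -has_count; apply/hasP; exists 1%g.
    by apply/sG; apply: fsubg1.
  by rewrite PGL3_act1.
pose f q := m%:R^-1 * \sum_(gam <- s) rho (PGL3_act gam q).
exists V, f; split; split; [exact: oV|exact: Vp| | | |].
- apply: regular_mul; [exact: oV|exact: regular_cst|].
  apply: (regular_bigsum oV) => gam gs.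
  apply: (regular_sub (PGL3_act gam @^-1` Vl)) => //; first exact: act_open.
    by move=> q; apply.
  exact: act_regular.
- move=> gam q Gg Vq h hs; rewrite -PGL3_actM; apply: Vq; apply/sG.
  by apply: fsubgM => //; apply/sG.
- move=> gam q Gg.
  have perm : perm_eq [seq (h * gam)%g | h <- s] s.
    apply: perm_map_self => [|x y|x xs]; [exact: us|exact: mulIg|].
    by apply/sG; apply: fsubgM; [apply/sG|].
  have E : \sum_(h <- s) rho (PGL3_act h (PGL3_act gam q)) =
           \sum_(h <- s) rho (PGL3_act h q).
    rewrite -[RHS](perm_big _ perm) big_map; apply: eq_bigr => h _.
    by rewrite PGL3_actM.
  exact: (congr1 (fun z => m%:R^-1 * z) E).
have asum : approx B N (fun q => \sum_(gam <- s) rho (PGL3_act gam q)) (m%:R *: g).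
  have -> : m%:R *: g = \sum_(gam <- s) (if PGL3_act gam p == p then g else 0).
    by rewrite -big_mkcond /= big_const_seq iter_addr_0 scaler_nat.
  elim: (s) agam => [|gam t IHt] agam.
    rewrite big_nil -mpolyC0.
    by apply: approx_ext (approx_cst B N 0) => q; rewrite big_nil.
  rewrite big_cons; apply: approx_ext (approxD (agam gam _) (IHt _)).
  - by move=> q; rewrite big_cons.
  - by rewrite inE eqxx.
  - by move=> h ht; apply: agam; rewrite inE ht orbT.
have := approxM (approx_cst B N m%:R^-1) asum.
by rewrite mul_mpolyC scalerA mulVf // scale1r.
Qed.

End Approximation.

(** * Regular functions on the quotient *)

Section Quotient.
Variables (K : numClosedFieldType) (G : finSubgroup (PGL3 K)).
Local Notation X := (P2quot G).
Local Notation pi := (@piG K G).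

Lemma pi_eq p q : pi p = pi q <-> exists2 g, fsubg G g & q = PGL3_act g p.
Proof.
rewrite -[pi p]/(\pi_({eq_quot (same_orbit G)})%qT p).
rewrite -[pi q]/(\pi_({eq_quot (same_orbit G)})%qT q).
by split=> [/eqmodP/asboolP|H]; [|apply/eqmodP/asboolP].
Qed.

Lemma pi_act g p : fsubg G g -> pi (PGL3_act g p) = pi p.
Proof. by move=> Gg; apply/esym/pi_eq; exists g. Qed.

Lemma pi_surj x : exists p, pi p = x.
Proof. by exists (repr x); rewrite /piG reprK. Qed.

Lemma pi_open (U : set X) : open U = open (pi @^-1` U).
Proof. by []. Qed.

Lemma pi_regular (U : set X) f : regular U f = regular (pi @^-1` U) (f \o pi).
Proof. by []. Qed.

Lemma descend T (rho : P2 K -> T) :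
  (forall g q, fsubg G g -> rho (PGL3_act g q) = rho q) ->
  exists f : X -> T, forall q, f (pi q) = rho q.
Proof.
move=> inv; exists (fun x => rho (repr x)) => q.
have /pi_eq[g Gg ->] : pi q = pi (repr (pi q)) by rewrite /piG reprK.
exact: inv.
Qed.

Lemma descend_open (V : set (P2 K)) : open V ->
  (forall g q, fsubg G g -> V q -> V (PGL3_act g q)) ->
  exists U : set X, open U /\ forall q, U (pi q) <-> V q.
Proof.
move=> oV inv.
have P q : (pi @` V) (pi q) <-> V q.
  split=> [[q' Vq' /pi_eq[g Gg ->]]|Vq]; [exact: inv|by exists q].
exists (pi @` V); split=> //.
rewrite pi_open; suff -> : pi @^-1` (pi @` V) = V by [].
by apply/seteqP; split=> q /P.
Qed.

Lemma ord_ge_unit n N (f Q : {mpoly K[n]}) :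
  ord_ge N (f * Q) -> ev Q 0 != 0 -> ord_ge N f.
Proof.
move=> h Q0 d; elim/ltn_ind: d => d IH dN.
have := h d dN; rewrite hcM big_ord_recr /= big1 ?add0r => [|i _]; last first.
  by rewrite IH ?mul0r //; apply: ltn_trans dN.
rewrite subnn hc_degree0 => /eqP; rewrite mulf_eq0 => /orP[/eqP //|].
by rewrite mpolyC_eq0 (negPf Q0).
Qed.

Variables (B : 'M[K]_3) (H : seq 'M[K]_2).
Hypotheses (Bu : B \in unitmx) (gH : matrix_group H).
Hypothesis HG : forall M, M \in H ->
  exists2 g, fsubg G g & lifts (B *m blk M *m invmx B) g.
Hypothesis GH : forall g, fsubg G g -> PGL3_act g (chart B 0) = chart B 0 ->
  exists2 M, M \in H & lifts (B *m blk M *m invmx B) g.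
Local Notation p := (chart B 0).

Lemma pi_chart M x : M \in H -> pi (chart B (M *m x)) = pi (chart B x).
Proof. by move=> /HG[g Gg l]; rewrite -(act_chart Bu x l) pi_act. Qed.

(** Multiplying the numerator and the denominator of a fraction by the other
    translates of the denominator replaces the denominator by its norm, which
    is invariant. *)
Lemma invariant_rep (U : set X) f : open U -> regular U f -> U (pi p) ->
  exists P Q, [/\ inv H P, inv H Q, ev Q 0 != 0 & forall x, ev Q x != 0 ->
    U (pi (chart B x)) /\ f (pi (chart B x)) = ev P x / ev Q x].
Proof.
move=> oU rf Up; have [Hu H1 HM HU] := gH.
have [P0 [Q0 [Q00 E]]] := chart_rep Bu (f := f \o pi) oU rf Up.
pose Q := \prod_(M <- H) lsub M Q0.
pose P := P0 * \prod_(M <- H | M != 1%:M) lsub M Q0.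
have EQ x : ev Q x = ev Q0 x * ev (\prod_(M <- H | M != 1%:M) lsub M Q0) x.
  by rewrite /Q (bigD1_seq 1%:M) //= evM ev_lsub mul1mx.
have nzQ x M : M \in H -> ev Q x != 0 -> ev Q0 (M *m x) != 0.
  move=> MH; apply: contraNneq => Q0x.
  by rewrite /Q (big_rem M) //= evM ev_lsub Q0x mul0r.
have repE x : ev Q x != 0 ->
    U (pi (chart B x)) /\ f (pi (chart B x)) = ev P x / ev Q x.
  move=> Qx; have := nzQ x _ H1 Qx; rewrite mul1mx => Q0x.
  have [Ux /= ->] := E x Q0x; split=> //.
  rewrite EQ evM -mulf_div divff ?mulr1 //.
  by apply: contraNneq Qx => R0; rewrite EQ R0 mulr0.
have iQ : inv H Q.
  by apply: (inv_norm gH) => M MH N x; rewrite !ev_lsub mulmxA.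
have Qn0 : ev Q 0 != 0.
  rewrite /Q ev_prod prodf_seq_neq0; apply/allP => M _ /=.
  by rewrite ev_lsub mulmx0.
exists P, Q; split=> // M MH x.
suff EP : lsub M P = P by rewrite -ev_lsub EP.
apply: (@ev_eq_off _ _ _ _ Q); first exact: ev_neq0 Qn0.
move=> y Qy; rewrite ev_lsub.
have QMy : ev Q (M *m y) != 0 by rewrite iQ.
have [_ E1] := repE y Qy; have [_ E2] := repE _ QMy.
have := E2; rewrite pi_chart // E1 iQ // => /(mulIf _) ->//.
by rewrite invr_eq0.
Qed.

Lemma germ_pt (x : X) f : germ [set x] f <-> exists U, [/\ open U, U x & regular U f].
Proof.
split=> [[U [oU [y [Uy /= yx]] rU]]|[U [oU Ux rU]]]; exists U; split=> //.
  by rewrite -yx.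
by exists x.
Qed.

Lemma germ_cst (x : X) c : germ [set x] (fun _ => c).
Proof.
by apply/germ_pt; exists setT; split=> //; [exact: openT|apply: regular_cst; exact: openT].
Qed.

Lemma local_parameters_vanish (x : X) u i : local_parameters x u -> u i x = 0.
Proof.
move=> [gu gen]; have [_ vu] := gen _ (gu i).
have [|U [_ [y [Uy yx]]]] := vu.
  exists (fun j _ => (j == i)%:R); split=> [j|]; first exact: germ_cst.
  exists setT; split; [exact: openT|by exists x|move=> y _].
  rewrite (bigD1 i) //= eqxx mul1r big1 ?addr0 // => j /negPf ->.
  by rewrite mul0r.
by move: yx => /= <- /(_ _ Uy); apply.
Qed.

Lemma open_chart (W : set X) : open W -> W (pi p) ->
  exists T : {mpoly K[2]}, ev T 0 != 0 /\ forall x, ev T x != 0 -> W (pi (chart B x)).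
Proof.
move=> oW Wp.
have [P [T [T0 E]]] := chart_rep Bu (f := fun=> 0) oW (regular_cst _ _ oW) Wp.
by exists T; split=> // x /E[].
Qed.

(** Germs on the quotient are fractions of invariants by [invariant_rep].
    Conversely, [invariant_approximation] turns an invariant polynomial into a
    germ on the quotient, up to order N, and the parameters generate the germs
    that vanish at the point. *)
Lemma smooth_generators u : local_parameters (pi p) u ->
  exists U R : 'I_2 -> {mpoly K[2]},
  (forall j, [/\ idl H (U j), ev (R j) 0 != 0 & forall x, ev (R j) x != 0 ->
     u j (pi (chart B x)) = ev (U j) x / ev (R j) x]) /\
  forall N g, (0 < N)%N -> idl H g -> exists E A1 A2,
     [/\ inv H E, ev E 0 != 0, inv H A1, inv H A2 &
     forall d, (d < N)%N -> hc d (E * g - (A1 * U 0 + A2 * U 1)) = 0].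
Proof.
move=> lu; have [gu gen] := lu.
have repr_germ f : germ [set pi p] f -> exists PQ : {mpoly K[2]} * {mpoly K[2]},
    [/\ inv H PQ.1, inv H PQ.2, ev PQ.2 0 != 0 & forall x, ev PQ.2 x != 0 ->
      f (pi (chart B x)) = ev PQ.1 x / ev PQ.2 x].
  move=> /germ_pt[U [oU Up rU]]; have [P [Q [iP iQ Q0 E]]] := invariant_rep oU rU Up.
  by exists (P, Q); split=> // x /E[].
have /choice[UR hUR] : forall j : 'I_2, exists PQ : {mpoly K[2]} * {mpoly K[2]},
    [/\ inv H PQ.1, inv H PQ.2, ev PQ.2 0 != 0 & forall x, ev PQ.2 x != 0 ->
      u j (pi (chart B x)) = ev PQ.1 x / ev PQ.2 x].
  by move=> j; apply: repr_germ.
exists (fun j => (UR j).1), (fun j => (UR j).2); split=> [j|N g N0 [ig g0]].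
  have [iU iR R0 E] := hUR j; split=> //; split=> //.
  have := E 0 R0; rewrite local_parameters_vanish // => /esym/eqP.
  by rewrite mulf_eq0 invr_eq0 (negPf R0) orbF => /eqP.
have [V [f0 [[oV Vp rf0] [invV invf0 [P [Q [[Q0 E] hN]]]]]]] :=
  invariant_approximation Bu GH N ig.
have [W [oW WV]] := descend_open oV invV.
have [f fE] := descend invf0.
have oW' := oW; rewrite pi_open in oW'.
have EW : pi @^-1` W = V by apply/seteqP; split=> q /WV.
have rf : regular W f.
  rewrite pi_regular EW; apply: regular_eq rf0 => q.
  by rewrite /= fE.
have Wp : W (pi p) by apply/WV.
have gf : germ [set pi p] f by apply/germ_pt; exists W.
have [PQ [iP' iQ' Q0' E']] := repr_germ _ gf.
have hN' : ord_ge N (PQ.1 - g * PQ.2).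
  apply: (ord_ge_unit (Q := Q)); last exact: Q0.
  suff -> : (PQ.1 - g * PQ.2) * Q = (P - g * Q) * PQ.2 by apply: ord_geMr.
  have EPQ : PQ.1 * Q = P * PQ.2.
    apply: (@ev_eq_off _ _ _ _ (Q * PQ.2)).
      by apply: mulf_neq0; [exact: ev_neq0 Q0|exact: ev_neq0 Q0'].
    move=> x; rewrite !evM mulf_eq0 negb_or => /andP[Qx Qx'].
    have := E' x Qx'; rewrite fE E // => /(congr1 (fun z => z * (ev Q x * ev PQ.2 x))).
    by rewrite mulrA divfK // [ev Q x * _]mulrC mulrA divfK // => ->.
  by rewrite mulrBl EPQ; ring.
have fp : f (pi p) = 0.
  rewrite E' //; have := hN' 0%N N0.
  rewrite hc_degree0 evB evM g0 mul0r subr0 => /eqP; rewrite mpolyC_eq0 => /eqP ->.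
  by rewrite mul0r.
have vf : vanishing [set pi p] [set pi p] f.
  by exists W; split=> //; [exists (pi p) | move=> y _ /= ->].
have [a [ga [W' [oW'' [y [W'y /= yp]] Ea]]]] := (gen _ gf).1 vf.
rewrite yp in W'y.
have [T [T0 hT]] := open_chart oW'' W'y.
have [AS0 [iA0 iS0 S00 EA0]] := repr_germ _ (ga 0).
have [AS1 [iA1 iS1 S10 EA1]] := repr_germ _ (ga 1).
have [iU0 iR0 R00 EU0] := hUR 0; have [iU1 iR1 R10 EU1] := hUR 1.
set U0 := (UR 0).1 in iU0 EU0 *; set R0 := (UR 0).2 in iR0 R00 EU0 *.
set U1 := (UR 1).1 in iU1 EU1 *; set R1 := (UR 1).2 in iR1 R10 EU1 *.
set P' := PQ.1 in iP' E' hN' *; set Q' := PQ.2 in iQ' Q0' E' hN' *.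
set A0 := AS0.1 in iA0 EA0; set S0 := AS0.2 in iS0 S00 EA0.
set A1 := AS1.1 in iA1 EA1; set S1 := AS1.2 in iS1 S10 EA1.
exists (Q' * (S0 * R0) * (S1 * R1)), (Q' * A0 * (S1 * R1)), (Q' * A1 * (S0 * R0)).
split.
- by do !apply: invM.
- by rewrite !evM !mulf_neq0.
- by do !apply: invM.
- by do !apply: invM.
have Epoly : P' * ((S0 * R0) * (S1 * R1)) =
   Q' * (A0 * U0 * (S1 * R1) + A1 * U1 * (S0 * R0)).
  apply: (@ev_eq_off _ _ _ _ (T * Q' * (S0 * R0) * (S1 * R1))).
    by apply: (@ev_neq0 _ _ _ 0); rewrite !evM !mulf_neq0.
  move=> x; rewrite !evM !mulf_eq0 !negb_or.
  case/andP => /andP[/andP[Tx Qx] /andP[S0x R0x]] /andP[S1x R1x].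
  have := Ea _ (hT x Tx); rewrite big_ord2 E' // EA0 // EA1 // EU0 // EU1 //.
  rewrite !evD !evM => /(congr1 (fun z => z * (ev Q' x * (ev S0 x * ev R0 x) * (ev S1 x * ev R1 x)))).
  move: Qx S0x R0x S1x R1x.
  move: (ev Q' x) (ev S0 x) (ev R0 x) (ev S1 x) (ev R1 x) => q s0 r0 s1 r1 q0 s00 r00 s10 r10 Ex.
  transitivity (ev P' x / q * (q * (s0 * r0) * (s1 * r1))); first by field.
  by rewrite Ex; field; rewrite s10 r10 s00 r00.
have -> : Q' * (S0 * R0) * (S1 * R1) * g -
    (Q' * A0 * (S1 * R1) * U0 + Q' * A1 * (S0 * R0) * U1) =
    - (S0 * R0 * (S1 * R1)) * (P' - g * Q').
  transitivity (Q' * (S0 * R0) * (S1 * R1) * g -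
    Q' * (A0 * U0 * (S1 * R1) + A1 * U1 * (S0 * R0))); first by ring.
  by rewrite -Epoly; ring.
exact: ord_geMl hN'.
Qed.

End Quotient.

(** * Lines and orders along a line *)

Section Irreducible.
Variable T : topologicalType.

Lemma irreducible_open (Z A B : set T) : irreducible_set Z -> open A -> open B ->
  A `&` Z !=set0 -> B `&` Z !=set0 -> A `&` B `&` Z !=set0.
Proof.
move=> [_ irr] oA oB [x [Ax Zx]] [y [By Zy]]; apply: contrapT => none.
have cA : closed (~` A) by rewrite closedC.
have cB : closed (~` B) by rewrite closedC.
have [|sA|sB] := irr _ _ cA cB.
- move=> z Zz; apply: contrapT => /not_orP[/contrapT Az /contrapT Bz].
  by apply: none; exists z.
- exact: sA Zx Ax.
- exact: sB Zy By.
Qed.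

Lemma irreducible_bigcup (I : eqType) (r : seq I) (Z : set T) (A : I -> set T) :
  irreducible_set Z -> (forall i, i \in r -> closed (A i)) ->
  (forall z, Z z -> exists2 i, i \in r & A i z) -> exists2 i, i \in r & Z `<=` A i.
Proof.
move=> irrZ; have [[z Zz] irr] := irrZ; elim: r => [|i r IHr] cA cover.
  by have [j] := cover z Zz.
have cU : closed [set x | exists2 j, j \in r & A j x].
  have: forall j, j \in r -> closed (A j) by move=> j jr; apply: cA; rewrite inE jr orbT.
  elim: (r) => [|j t IHt] ct.
    have -> : [set x | exists2 j, j \in [::] & A j x] = set0.
      by apply/seteqP; split=> x // [].
    exact: closed0.
  have -> : [set x | exists2 k, k \in j :: t & A k x] =
      A j `|` [set x | exists2 k, k \in t & A k x].
    apply/seteqP; split=> x /=.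
      by move=> [k]; rewrite inE => /orP[/eqP ->|kt Akx]; [left|right; exists k].
    by case=> [Ajx|[k kt Akx]]; [exists j|exists k]; rewrite ?inE ?eqxx ?kt ?orbT.
  apply: closedU; first by apply: ct; rewrite inE eqxx.
  by apply: IHt => k kt; apply: ct; rewrite inE kt orbT.
have cAi : closed (A i) by apply: cA; rewrite inE eqxx.
have [|s|s] := irr _ _ cAi cU.
- move=> x /cover[j]; rewrite inE => /orP[/eqP -> Aix|jr Ajx]; first by left.
  by right; exists j.
- by exists i; rewrite ?inE ?eqxx.
have [j jr sj] : exists2 j, j \in r & Z `<=` A j.
  apply: IHr => [j jr|x /s//].
  by apply: cA; rewrite inE jr orbT.
by exists j; rewrite ?inE ?jr ?orbT.
Qed.

End Irreducible.

Section Line.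
Variables (K : numClosedFieldType).
Implicit Types (F Q : {mpoly K[3]}) (v w : 'cV[K]_3) (a : 'rV[K]_3).

Lemma X1_neq0 (i : 'I_3) : 'X_i != 0 :> {mpoly K[3]}.
Proof.
apply/eqP => /(congr1 (fun p => ev p (delta_mx i 0))).
by rewrite evX ev0 mxE !eqxx => /eqP; rewrite oner_eq0.
Qed.

Lemma split_X0 F d : F \is d.-homog -> exists F2 F3,
  [/\ F = 'X_0 * F2 + F3, F2 \is d.-1.-homog &
      forall v v', (forall i, i != 0 -> v i 0 = v' i 0) -> ev F3 v = ev F3 v'].
Proof.
move=> hF.
exists (\sum_(m <- msupp F | m (0%R : 'I_3) != 0%N) F@_m *: 'X_[m - U_((0%R : 'I_3))]),
       (\sum_(m <- msupp F | ~~ (m (0%R : 'I_3) != 0%N)) F@_m *: 'X_[m]); split.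
- rewrite {1}[F]mpolyE (bigID (fun m : 'X_{1..3} => m (0%R : 'I_3) != 0%N)) /=; congr (_ + _).
  rewrite mulr_sumr; apply: eq_bigr => m m0.
  rewrite -scalerAr -mpolyXD addmC submK //; apply/mnm_lepP => j.
  by rewrite mnm1E; case: eqP => [<-|] //; rewrite lt0n.
- rewrite big_seq_cond; apply: rpred_sum => m /andP[mF m0]; apply: rpredZ.
  rewrite dhomogX /= -(dhomog_mf hF mF) /=.
  have Em : m = ((m - U_((0%R : 'I_3))) + U_((0%R : 'I_3)))%MM.
    by rewrite submK //; apply/mnm_lepP => j; rewrite mnm1E; case: eqP => [<-|] //;
      rewrite lt0n.
  by have := congr1 (fun x : 'X_{1..3} => mdeg x) Em; rewrite mdegD mdeg1 addn1 => ->.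
move=> v v' E; rewrite !ev_sum; apply: eq_bigr => m /negPn/eqP m0.
rewrite !evZ /ev !mevalX; congr (_ * _); apply: eq_bigr => i _.
by have [->|/E -> //] := eqVneq i 0; rewrite m0 !expr0.
Qed.

Variable a : 'rV[K]_3.
Hypothesis a0 : a != 0.

Lemma row_completion : exists2 A : 'M[K]_3, A \in unitmx & a *m A = delta_mx 0 0.
Proof.
have ra : \rank a = 1%N.
  by apply/eqP; rewrite eqn_leq rank_leq_row lt0n mxrank_eq0 a0.
have := mulmx_ebase a; rewrite ra => E.
have [r Er] : exists r, col_ebase a = r%:M.
  by exists (col_ebase a 0 0); rewrite [LHS]mx11_scalar.
have r0 : r != 0.
  by have := col_ebase_unit a; rewrite Er unitmxE det_scalar expr1 unitfE.
exists (r^-1 *: invmx (row_ebase a)).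
  by rewrite unitmxZ ?unitfE ?invr_eq0 // unitmx_inv row_ebase_unit.
rewrite -scalemxAr -{1}E mulmxK ?row_ebase_unit // Er mul_scalar_mx scalerA mulVf //.
rewrite scale1r; apply/matrixP => i j; rewrite !mxE !ord1 /= andbT.
by rewrite eq_sym; congr (_%:R).
Qed.

Lemma line_param : exists C : 'M[K]_(3, 2),
  [/\ forall x, a *m (C *m x) = 0 :> 'cV[K]_1, forall x : 'cV[K]_2, C *m x = 0 -> x = 0 &
      forall v, a *m v = 0 -> exists x, v = C *m x].
Proof.
have [A Au aA] := row_completion.
pose D : 'M[K]_(1 + 2, 2) := col_mx 0 1%:M.
have DE (x : 'cV[K]_2) : D *m x = col_mx 0 x by rewrite mul_col_mx mul0mx mul1mx.
have d0 (y : 'cV[K]_(1 + 2)) : (delta_mx 0 0 : 'rV[K]_(1 + 2)) *m y = usubmx y.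
  rewrite -rowE; apply/matrixP => i j; rewrite !mxE !ord1; congr (y _ _); exact/val_inj.
exists (A *m D); split=> [x|x|v av].
- by rewrite mulmxA mulmxA aA -mulmxA DE d0 col_mxKu.
- rewrite -mulmxA DE => /(congr1 (mulmx (invmx A))); rewrite mulKmx // mulmx0.
  by move=> /(congr1 (fun y : 'cV[K]_(1 + 2) => dsubmx y)); rewrite col_mxKd linear0.
pose y : 'cV[K]_(1 + 2) := invmx A *m v.
have vy : A *m y = v by rewrite mulKVmx.
have y0 : usubmx y = 0.
  by rewrite -d0 -[delta_mx 0 0 *m _]/((delta_mx 0 0 : 'rV[K]_3) *m y) -aA -mulmxA vy.
exists (dsubmx y); rewrite -mulmxA DE -vy; congr (A *m _).
by rewrite -[LHS]vsubmxK y0.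
Qed.

Lemma lform_neq0 : lform a != 0.
Proof.
have [A Au aA] := row_completion; apply: (@ev_neq0 _ _ _ (A *m delta_mx 0 0)).
by rewrite ev_lform mulmxA aA mul_delta_mx mxE !eqxx oner_neq0.
Qed.

Definition nonvan F := exists v, [/\ v != 0, a *m v = 0 & ev F v != 0].

Lemma nonvanM F Q : nonvan F -> nonvan Q -> nonvan (F * Q).
Proof.
have [C [aC Cinj Csurj]] := line_param.
move=> [v [v0 /Csurj[x Ex] Fv]] [w [w0 /Csurj[y Ey] Qw]].
have xy0 (z : 'cV[K]_2) : C *m z != 0 -> z != 0.
  by apply: contraNneq => ->; rewrite mulmx0.
have [i xi] := cV0Pn _ (xy0 x (eq_ind _ (fun u => u != 0) v0 _ Ex)).
have nz : lsub C F * lsub C Q * 'X_i != 0.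
  rewrite !mulf_neq0 //.
  - by apply: (@ev_neq0 _ _ _ x); rewrite ev_lsub -Ex.
  - by apply: (@ev_neq0 _ _ _ y); rewrite ev_lsub -Ey.
  - by apply: (@ev_neq0 _ _ _ x); rewrite evX.
have [z] := ev_nonzero nz.
rewrite !evM evX !ev_lsub mulf_eq0 negb_or => /andP[FQ zi].
exists (C *m z); rewrite aC evM; split=> //.
apply/eqP => /Cinj z0; by rewrite z0 mxE eqxx in zi.
Qed.

Lemma nonvan_prod (I : eqType) (r : seq I) (F : I -> {mpoly K[3]}) :
  (forall i, i \in r -> nonvan (F i)) -> nonvan (\prod_(i <- r) F i).
Proof.
elim: r => [|i r IHr] h.
  have [C [aC Cinj _]] := line_param.
  rewrite big_nil; exists (C *m delta_mx 0 0); rewrite aC ev1 oner_neq0; split=> //.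
  apply/eqP => /Cinj /(congr1 (fun y : 'cV[K]_2 => y 0 0)).
  by rewrite !mxE eqxx => /eqP; rewrite oner_eq0.
rewrite big_cons; apply: nonvanM; first by apply: h; rewrite inE eqxx.
by apply: IHr => j jr; apply: h; rewrite inE jr orbT.
Qed.

Lemma nonvan1 : nonvan 1.
Proof. by have := @nonvan_prod _ [::] (fun _ : nat => 0); rewrite big_nil; apply. Qed.

Lemma nonvanX F k : nonvan F -> nonvan (F ^+ k).
Proof.
move=> h; elim: k => [|k IHk]; first by rewrite expr0; exact: nonvan1.
by rewrite exprS; apply: nonvanM.
Qed.

Lemma nonvan_neq0 F : nonvan F -> F != 0.
Proof. by move=> [v [_ _ Fv]]; apply: ev_neq0 Fv. Qed.

(** In coordinates where the line is x_0 = 0, the part of F without x_0 is a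
    polynomial in the other coordinates that vanishes identically. *)
Lemma line_div F d : F \is d.-homog -> ~ nonvan F ->
  exists2 F', F' \is d.-1.-homog & F = lform a * F'.
Proof.
move=> hF nF; have [A Au aA] := row_completion.
have [F2 [F3 [E h2 h3]]] := split_X0 (lsub_homog A hF).
have F30 : F3 = 0.
  apply: (@ev_eq_off0 _ _ _ 'X_1); first exact: X1_neq0.
  move=> v v0; rewrite evX ev0 => v1.
  pose v' : 'cV[K]_3 := \col_i (if i == 0 then 0 else v i 0).
  rewrite (h3 v v') => [|i i0]; last by rewrite mxE (negPf i0).
  have v'0 : v' != 0 by apply: contraNneq v1 => /colP/(_ 1); rewrite !mxE /= => ->.
  have -> : ev F3 v' = ev F (A *m v').
    by rewrite -ev_lsub E evD evM evX mxE eqxx mul0r add0r.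
  apply/eqP/negPn/negP => Fv; apply: nF; exists (A *m v'); split=> //.
    exact: (@GL3_mulv_neq0 _ (exist _ A Au)) v'0.
  by rewrite mulmxA aA -rowE; apply/matrixP => i j; rewrite !mxE eqxx.
exists (lsub (invmx A) F2); first exact: lsub_homog.
apply: ev_inj => v; rewrite evM ev_lsub ev_lform.
rewrite -[v in LHS](mulKVmx Au) -(ev_lsub A F) E F30 addr0 evM evX; congr (_ * _).
rewrite -[a](mulmxK Au) aA -mulmxA -rowE; by rewrite [RHS]mxE.
Qed.

Lemma line_factor F d : F \is d.-homog -> F != 0 -> exists k F',
  [/\ (k <= d)%N, F' \is (d - k).-homog, F = lform a ^+ k * F' & nonvan F'].
Proof.
elim: d F => [|d IHd] F hF F0.
  have [nF|/(line_div hF)[F' hF' E]] := pselect (nonvan F).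
    by exists 0%N, F; rewrite expr0 mul1r.
  have := dhomogM (lform_homog a) hF'; rewrite -E => hF1.
  by have := dhomog_uniq F0 hF hF1.
have [nF|/(line_div hF)[F' /= hF' E]] := pselect (nonvan F).
  by exists 0%N, F; rewrite expr0 mul1r.
have F'0 : F' != 0 by apply: contraNneq F0 => F'0; rewrite E F'0 mulr0.
have [k [F'' [kd h EF' nv]]] := IHd _ hF' F'0.
by exists k.+1, F''; rewrite ltnS subSS exprS -mulrA -EF'.
Qed.

Definition lineset : set (P2 K) := [set p | a *m coords p = 0].

Lemma linesetE v : v != 0 -> lineset (proj_pt v) <-> a *m v = 0.
Proof.
move=> v0; rewrite /lineset /=; have [c [c0 ->]] := coords_proj_pt v0.
rewrite -scalemxAr; split=> [/eqP|->]; last by rewrite scaler0.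
by rewrite scaler_eq0 (negPf c0) => /eqP.
Qed.

Lemma open_meets_line (U : set (P2 K)) : open U -> U `&` lineset !=set0 ->
  exists d Q, [/\ Q \is d.-homog, nonvan Q &
    forall w, w != 0 -> ev Q w != 0 -> U (proj_pt w)].
Proof.
move=> oU [p [Up Lp]]; rewrite -[p]coordsK in Up.
have [d [Q [hQ Qp H]]] := open_rep oU (coords_neq0 p) Up.
by exists d, Q; split=> //; exists (coords p); rewrite coords_neq0.
Qed.

Lemma nonvan_meets (U : set (P2 K)) Q :
  nonvan Q -> (forall w, w != 0 -> ev Q w != 0 -> U (proj_pt w)) ->
  U `&` lineset !=set0.
Proof.
by move=> [v [v0 av Qv]] H; exists (proj_pt v); split; [exact: H|exact/linesetE].
Qed.

Lemma lineset_closed : closed lineset.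
Proof.
have -> : lineset = ~` [set p | peval (lform a) p != 0].
  apply/seteqP; split=> p.
    move=> /= ap; rewrite /peval -/(ev _ (coords p)) ev_lform ap mxE eqxx.
    by [].
  move=> /= /negP/negPn/eqP; rewrite /peval -/(ev _ (coords p)) ev_lform => E.
  by apply/matrixP => i j; rewrite !ord1 E mxE.
by rewrite closedC; apply: open_principal (lform_homog a).
Qed.

Lemma lineset_irreducible : irreducible_set lineset.
Proof.
split.
  have [v [v0 av _]] := nonvan1; by exists (proj_pt v); apply/linesetE.
move=> A B cA cB sub; apply: contrapT => /not_orP[nA nB].
have meets (C : set (P2 K)) : closed C -> ~ lineset `<=` C ->
    exists d Q, [/\ Q \is d.-homog, nonvan Q &
      forall w, w != 0 -> ev Q w != 0 -> (~` C) (proj_pt w)].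
  move=> cC nC; apply: open_meets_line; first by rewrite openC.
  by apply: contrapT => none; apply: nC => p Lp; apply: contrapT => Cp; apply: none; exists p.
have [d [Q [_ nQ HQ]]] := meets A cA nA.
have [e [Q' [_ nQ' HQ']]] := meets B cB nB.
have [v [v0 av]] := nonvanM nQ nQ'; rewrite evM mulf_eq0 negb_or => /andP[Qv Qv'].
by have [|] := sub (proj_pt v) ((linesetE v0).2 av); [apply: HQ|apply: HQ'].
Qed.

Lemma lineset_neqT : lineset != setT.
Proof.
have [w] := ev_nonzero lform_neq0.
rewrite ev_lform => aw; apply/eqP => E.
have w0 : w != 0 by apply: contraNneq aw => ->; rewrite mulmx0 mxE.
have : lineset (proj_pt w) by rewrite E.
by move=> /(linesetE w0) aw0; rewrite aw0 mxE eqxx in aw.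
Qed.

Lemma closed_form (W : set (P2 K)) : closed W -> W != setT ->
  exists d F, [/\ F \is d.-homog, F != 0 & forall w, w != 0 -> W (proj_pt w) -> ev F w = 0].
Proof.
move=> cW /eqP WT; have [p Wp] : exists p, ~ W p.
  by apply: contrapT => none; apply: WT; apply/seteqP; split=> // p _;
     apply: contrapT => Wp; apply: none; exists p.
have oW : open (~` W) by rewrite openC.
rewrite -[p]coordsK in Wp.
have [d [F [hF Fp H]]] := open_rep oW (coords_neq0 p) Wp.
exists d, F; split=> //; first exact: ev_neq0 Fp.
by move=> w w0 Ww; apply/eqP/negPn/negP => Fw; apply: H Fw Ww.
Qed.

Lemma lineset_prime : prime_divisor lineset.
Proof.
split; [exact: lineset_closed|exact: lineset_irreducible|exact: lineset_neqT|].
move=> W cW irrW sub; have [->|WT] := eqVneq W setT; [by right|left].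
have [d [F [hF F0 FW]]] := closed_form cW WT.
have [k [F' [kd hF' E nF']]] := line_factor hF F0.
have cF' : closed (~` [set p | peval F' p != 0]).
  by rewrite closedC; apply: open_principal hF'.
have [|s|s] := irrW.2 _ _ lineset_closed cF'.
- move=> p Wp; rewrite -[p]coordsK in Wp *; have p0 := coords_neq0 p.
  have := FW _ p0 Wp; rewrite E evM evXn => /eqP; rewrite mulf_eq0.
  case/orP => [|F'p]; last by right; rewrite /= (peval_proj_neq0 hF' p0) F'p.
  rewrite expf_eq0 ev_lform => /andP[_ /eqP ap]; left; apply/linesetE => //.
  by apply/matrixP => i j; rewrite !ord1 ap mxE.
- by apply/seteqP; split.
have [v [v0 av F'v]] := nF'.
have /sub/s : lineset (proj_pt v) by apply/linesetE.
by rewrite /= (peval_proj_neq0 hF' v0) F'v.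
Qed.

(** [ordl k f]: f is a rational function of order k along the line. *)
Definition ordl k (f : P2 K -> K) := exists d F Q,
  [/\ F \is d.-homog, Q \is (d + k).-homog, nonvan F, nonvan Q &
   forall w, w != 0 -> ev F w != 0 -> ev Q w != 0 ->
     f (proj_pt w) = ((a *m w) 0 0) ^+ k * ev F w / ev Q w].

Lemma ordlM j k f g : ordl j f -> ordl k g -> ordl (j + k) (fun p => f p * g p).
Proof.
move=> [d [F [Q [hF hQ nF nQ E]]]] [d' [F' [Q' [hF' hQ' nF' nQ' E']]]].
have e : (d + d' + (j + k) = (d + j) + (d' + k))%N by rewrite addnACA.
exists (d + d')%N, (F * F'), (Q * Q'); split.
- exact: dhomogM.
- by rewrite e; apply: dhomogM.
- exact: nonvanM.
- exact: nonvanM.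
move=> w w0; rewrite !evM !mulf_eq0 !negb_or => /andP[Fw F'w] /andP[Qw Q'w].
by rewrite E // E' // mulf_div exprD mulrACA.
Qed.

Lemma ordl_eq k f g d Q : Q \is d.-homog -> nonvan Q ->
  (forall w, w != 0 -> ev Q w != 0 -> f (proj_pt w) = g (proj_pt w)) ->
  ordl k f -> ordl k g.
Proof.
move=> hQ nQ E [e [F [P [hF hP nF nP EF]]]].
exists (d + e)%N, (Q * F), (Q * P); split.
- exact: dhomogM.
- by rewrite -addnA; apply: dhomogM.
- exact: nonvanM.
- exact: nonvanM.
move=> w w0; rewrite !evM !mulf_eq0 !negb_or => /andP[Qw Fw] /andP[_ Pw].
by rewrite -E // EF // mulrCA -mulf_div divff // mul1r.
Qed.

Lemma ordl1 : ordl 0 (fun _ => 1).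
Proof.
exists 0%N, 1, 1; split; [exact: dhomog1|exact: dhomog1|exact: nonvan1|exact: nonvan1|].
by move=> w _ _ _; rewrite ev1 expr0 mul1r divr1.
Qed.

Lemma ordlX j k f : ordl j f -> ordl (j * k) (fun p => f p ^+ k).
Proof.
move=> h; elim: k => [|k IHk].
  by rewrite muln0; apply: (ordl_eq (f := fun _ => 1) (dhomog1 _ _) nonvan1) ordl1.
rewrite mulnS; apply: (ordl_eq (f := fun p => f p * f p ^+ k) (dhomog1 _ _) nonvan1).
  by move=> w _ _; rewrite exprS.
exact: ordlM.
Qed.

Lemma ordl_le j k f : ordl j f -> ordl k f -> (k <= j)%N.
Proof.
move=> [d [F [Q [hF hQ nF nQ E]]]] [d' [F' [Q' [hF' hQ' nF' nQ' E']]]].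
rewrite leqNgt; apply/negP => jk.
have al0 := lform_neq0.
have EP : F * Q' = lform a ^+ (k - j) * (F' * Q).
  apply: (mulfI (expf_neq0 j al0)); rewrite [RHS]mulrA -exprD subnKC ?(ltnW jk) //.
  apply: (@ev_eq_off0 _ _ _ (F * Q * (F' * Q'))).
    by apply: nonvan_neq0; do !apply: nonvanM.
  move=> w w0; rewrite !evM !mulf_eq0 !negb_or => /andP[/andP[Fw Qw] /andP[F'w Q'w]].
  have := E w w0 Fw Qw; rewrite E' // !evXn ev_lform.
  move: Qw Q'w (_ ^+ k) (_ ^+ j); move: (ev Q w) (ev Q' w) (ev F w) (ev F' w).
  move=> q q' f1 f2 q0 q0' x y E1.
  transitivity (y * f1 / q * (q * q')); first by field.
  by rewrite -E1; field.
have [v [v0 av]] := nonvanM nF nQ'.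
rewrite EP evM evXn ev_lform av mxE expr0n subn_eq0 leqNgt jk mul0r eqxx.
by [].
Qed.

Lemma ordl_uniq j k f : ordl j f -> ordl k f -> j = k.
Proof. by move=> h h'; apply/eqP; rewrite eqn_leq (ordl_le h' h) (ordl_le h h'). Qed.

Lemma germ_line_rep (U : set (P2 K)) f : open U -> U `&` lineset !=set0 ->
  regular U f -> exists d F Q, [/\ F \is d.-homog, Q \is d.-homog, nonvan Q &
    forall w, w != 0 -> ev Q w != 0 ->
      U (proj_pt w) /\ f (proj_pt w) = ev F w / ev Q w].
Proof.
move=> oU [p [Up Lp]] rf; rewrite -[p]coordsK in Up.
have [d [F [Q [hF hQ Qp E]]]] := regular_rep oU rf (coords_neq0 p) Up.
by exists d, F, Q; split=> //; exists (coords p); rewrite coords_neq0.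
Qed.

Lemma germ_ordl f : germ lineset f ->
  (exists d Q, [/\ Q \is d.-homog, nonvan Q &
     forall w, w != 0 -> ev Q w != 0 -> f (proj_pt w) = 0]) \/
  exists k, ordl k f.
Proof.
move=> [U [oU mU rU]].
have [d [F [Q [hF hQ nQ E]]]] := germ_line_rep oU mU rU.
have [F0|F0] := eqVneq F 0.
  left; exists d, Q; split=> // w w0 Qw.
  by have [_ ->] := E w w0 Qw; rewrite F0 ev0 mul0r.
right; have [k [F' [kd hF' EF nF']]] := line_factor hF F0.
exists k, (d - k)%N, F', Q; rewrite subnK //; split=> // w w0 _ Qw.
by have [_ ->] := E w w0 Qw; rewrite EF evM evXn ev_lform.
Qed.

Lemma ordl_vanishing k f : ordl k f -> vanishing lineset lineset f <-> (0 < k)%N.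
Proof.
move=> [d [F [Q [hF hQ nF nQ E]]]]; split=> [[U [oU mU H]]|k0].
  have [e [P [hP nP HP]]] := open_meets_line oU mU.
  have [v [v0 av]] := nonvanM (nonvanM nF nQ) nP.
  rewrite !evM !mulf_eq0 !negb_or => /andP[/andP[Fv Qv] Pv].
  have := H _ (HP v v0 Pv) ((linesetE v0).2 av).
  rewrite E // av mxE lt0n => /eqP; apply: contraTneq => ->.
  by rewrite expr0 mul1r mulf_neq0 // invr_eq0.
exists ([set p | peval F p != 0] `&` [set p | peval Q p != 0]); split.
- by apply: openI; [apply: open_principal hF|apply: open_principal hQ].
- apply: (nonvan_meets (nonvanM nF nQ)) => w w0.
  rewrite evM mulf_eq0 negb_or => /andP[Fw Qw].
  by split; rewrite /= ?(peval_proj_neq0 hF w0) ?(peval_proj_neq0 hQ w0).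
move=> p [/= Fp Qp] Lp; rewrite -[p]coordsK in Lp *.
have p0 := coords_neq0 p; move/(linesetE p0) in Lp.
by rewrite E // Lp mxE expr0n eqn0Ngt k0 !mul0r.
Qed.

Lemma ordl_not0 k f d Q : ordl k f -> Q \is d.-homog -> nonvan Q ->
  ~ forall w, w != 0 -> ev Q w != 0 -> f (proj_pt w) = 0.
Proof.
move=> [e [F [P [hF hP nF nP E]]]] hQ nQ H.
have nz : F * P * Q * lform a != 0.
  apply: mulf_neq0; last exact: lform_neq0.
  by apply: nonvan_neq0; do !apply: nonvanM.
have [w] := ev_nonzero nz; rewrite !evM ev_lform !mulf_eq0 !negb_or.
case/andP => /andP[/andP[Fw Pw] Qw] aw.
have w0 : w != 0 by apply: contraNneq aw => ->; rewrite mulmx0 mxE.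
have := H w w0 Qw; rewrite E // => /eqP.
by rewrite !mulf_eq0 invr_eq0 (negPf Fw) (negPf Pw) expf_eq0 (negPf aw) andbF.
Qed.

Definition line_ratio (b : 'rV[K]_3) (p : P2 K) :=
  peval (lform a) p / peval (lform b) p.

Lemma ordl_line_ratio b : nonvan (lform b) -> ordl 1 (line_ratio b).
Proof.
move=> nb; exists 0%N, 1, (lform b); split; [exact: dhomog1|exact: lform_homog|exact: nonvan1|exact: nb|].
move=> w w0 _ _; rewrite ev1 mulr1 expr1.
by rewrite /line_ratio (peval_proj_ratio (lform_homog a) (lform_homog b) w0) !ev_lform.
Qed.

Lemma nonvan_lform : exists b, nonvan (lform b).
Proof.
have [v [v0 av _]] := nonvan1.
have [b Hb] := avoid (s := [:: v]) (fun x (xs : x \in [:: v]) => 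
  eq_ind_r (fun y => y != 0) v0 (eqP (etrans (esym (mem_seq1 x v)) xs))).
by exists b, v; split=> //; rewrite ev_lform; apply: Hb; rewrite inE.
Qed.

Lemma line_germ_eq Z (f g : P2 K -> K) d Q : Z = lineset -> Q \is d.-homog -> nonvan Q ->
  (forall w, w != 0 -> ev Q w != 0 -> f (proj_pt w) = g (proj_pt w)) -> germ_eq Z f g.
Proof.
move=> -> hQ nQ E; exists [set p | peval Q p != 0]; split.
- exact: open_principal hQ.
- by apply: (nonvan_meets nQ) => w w0; rewrite /= (peval_proj_neq0 hQ w0).
move=> p; rewrite -[p]coordsK /= (peval_proj_neq0 hQ (coords_neq0 p)).
exact: E (coords_neq0 p).
Qed.

(** A germ that vanishes on the line is a fraction of forms whose numerator
    vanishes on the line, hence is divisible by its equation. *)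
Lemma line_local_equation b : nonvan (lform b) ->
  local_equation lineset lineset (line_ratio b).
Proof.
move=> nb; have hb := lform_homog b; have ha := lform_homog a.
have gs : germ lineset (line_ratio b).
  exists [set p | peval (lform b) p != 0]; split.
  - exact: open_principal hb.
  - by apply: (nonvan_meets nb) => w w0; rewrite /= (peval_proj_neq0 hb w0).
  - by apply: (regular_ratio ha hb) => p.
split=> // f gf; split=> [vf|[c [gc [U [oU mU E]]]]].
  have [U [oU mU rU]] := gf.
  have [d [F [Q [hF hQ nQ E]]]] := germ_line_rep oU mU rU.
  have nF : ~ nonvan F.
    move=> nF; have [V [oV mV HV]] := vf.
    have [e [P [hP nP HP]]] := open_meets_line oV mV.
    have [v [v0 av]] := nonvanM (nonvanM nF nQ) nP.
    rewrite !evM !mulf_eq0 !negb_or => /andP[/andP[Fv Qv] Pv].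
    have := HV _ (HP v v0 Pv) ((linesetE v0).2 av).
    have [_ ->] := E v v0 Qv => /eqP.
    by rewrite mulf_eq0 invr_eq0 (negPf Fv) (negPf Qv).
  have [F' hF' EF] := line_div hF nF.
  case: d hF hQ hF' => [|d] hF hQ /= hF'.
    have F0 : F = 0.
      apply/eqP/negPn/negP => F0; have := dhomogM ha hF'; rewrite -EF => hF1.
      by have := dhomog_uniq F0 hF hF1.
    exists (fun _ _ => 0); split=> [_|].
      by exists setT; split; [exact: openT| |exact/regular_cst/openT];
        have [p Lp] := lineset_irreducible.1; exists p.
    apply: (line_germ_eq erefl hQ nQ) => w w0 Qw; rewrite big_ord1 mul0r.
    by have [_ ->] := E w w0 Qw; rewrite F0 ev0 mul0r.
  have hFb : F' * lform b \is (d + 1).-homog by apply: dhomogM.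
  rewrite addn1 in hFb.
  exists (fun _ p => peval (F' * lform b) p / peval Q p); split=> [_|].
    exists [set p | peval Q p != 0]; split.
    - exact: open_principal hQ.
    - by apply: (nonvan_meets nQ) => w w0; rewrite /= (peval_proj_neq0 hQ w0).
    - by apply: (regular_ratio hFb hQ) => p.
  apply: (line_germ_eq erefl (dhomogM hQ hb) (nonvanM nQ nb)) => w w0.
  rewrite evM mulf_eq0 negb_or => /andP[Qw bw].
  rewrite big_ord1 /line_ratio (peval_proj_ratio hFb hQ w0) (peval_proj_ratio ha hb w0).
  have [_ ->] := E w w0 Qw; rewrite EF !evM.
  by move: Qw bw; move: (ev Q w) (ev (lform b) w) => q c q0 c0; field; rewrite q0 c0.
exists U; split=> // y Uy Ly; rewrite E // big_ord1.
have -> : line_ratio b y = 0.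
  by rewrite /line_ratio {1}/peval -/(ev _ (coords y)) ev_lform Ly mxE mul0r.
by rewrite mulr0.
Qed.

Lemma local_equation_vanishes (T : funSpaceType K) (Z D : set T) t :
  irreducible_set Z -> local_equation Z D t -> vanishing Z D t.
Proof.
move=> [[z Zz] _] [gt gen]; apply: (gen _ (gt ord0)).2.
exists (fun _ _ => 1); split=> [_|].
  by exists setT; split; [exact: openT|exists z|exact/regular_cst/openT].
by exists setT; split; [exact: openT|exists z|move=> y _; rewrite big_ord1 mul1r].
Qed.

Lemma germ_eq_rep (f g : P2 K -> K) : germ_eq lineset f g ->
  exists d Q, [/\ Q \is d.-homog, nonvan Q &
    forall w, w != 0 -> ev Q w != 0 -> f (proj_pt w) = g (proj_pt w)].
Proof.
move=> [U [oU mU E]]; have [d [Q [hQ nQ HQ]]] := open_meets_line oU mU.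
by exists d, Q; split=> // w w0 Qw; apply/E/HQ.
Qed.

(** Two equations divide each other, and orders add up. *)
Lemma local_equation_ordl s : local_equation lineset lineset s -> ordl 1 s.
Proof.
move=> es; have vs := local_equation_vanishes lineset_irreducible es.
have [b nb] := nonvan_lform; have o1 := ordl_line_ratio nb.
have [gs0 gens0] := line_local_equation nb.
have v0 : vanishing lineset lineset (line_ratio b) by apply/(ordl_vanishing o1).
have [gs gens] := es; have [c [gc ec]] := (gens _ (gs0 ord0)).1 v0.
have [d [Q [hQ nQ E]]] := germ_eq_rep ec.
have nz f : (f = s \/ f = c ord0) -> ~ exists d Q, [/\ Q \is d.-homog, nonvan Q &
    forall w, w != 0 -> ev Q w != 0 -> f (proj_pt w) = 0].
  move=> fE [d' [Q' [hQ' nQ' E']]].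
  apply: (ordl_not0 o1 (dhomogM hQ hQ') (nonvanM nQ nQ')) => w w0.
  rewrite evM mulf_eq0 negb_or => /andP[Qw Q'w]; rewrite E // big_ord1.
  by case: fE => <-; rewrite E' ?mulr0 ?mul0r.
have [/(nz s (or_introl erefl)) //|[k ok]] := germ_ordl (gs ord0).
have [/(nz _ (or_intror erefl)) //|[j oj]] := germ_ordl (gc ord0).
have : ordl (j + k) (line_ratio b).
  apply: (ordl_eq hQ nQ _ (ordlM oj ok)) => w w0 Qw.
  by rewrite E // big_ord1.
move=> /(ordl_uniq o1) E1; have := (ordl_vanishing ok).1 vs.
by case: k ok E1 => [|k] // ok; rewrite addnS => -[/esym/eqP]; rewrite addn_eq0 => /andP[_ /eqP <-] _.
Qed.

Lemma germ_unit_ordl f : germ_unit lineset f -> ordl 0 f.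
Proof.
move=> [U [oU mU rU U0]]; have gw : germ lineset f by exists U.
have [[d [Q [hQ nQ E]]]|[k ok]] := germ_ordl gw.
  have [e [P [hP nP HP]]] := open_meets_line oU mU.
  have [v [v0 av]] := nonvanM nQ nP.
  rewrite evM mulf_eq0 negb_or => /andP[Qv Pv].
  by have := U0 _ (HP v v0 Pv); rewrite E // eqxx.
case: k ok => // k ok; have [V [oV mV HV]] := (ordl_vanishing ok).2 isT.
have [q [[Uq Vq] Lq]] := irreducible_open lineset_irreducible oU oV mU mV.
by have := U0 q Uq; rewrite HV // eqxx.
Qed.

End Line.

(** * Ramification along lines *)

Section Branch.
Variables (K : numClosedFieldType) (G : finSubgroup (PGL3 K)).
Local Notation X := (P2quot G).
Local Notation pi := (@piG K G).
Implicit Types (a c : 'rV[K]_3) (v w : 'cV[K]_3).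

Lemma regular_zero (U : set (P2 K)) f Q : open U -> regular U f -> Q != 0 ->
  (forall w, w != 0 -> ev Q w != 0 -> U (proj_pt w) -> f (proj_pt w) = 0) ->
  forall q, U q -> f q = 0.
Proof.
move=> oU rf Q0 H q Uq; rewrite -[q]coordsK in Uq *.
have := regular_global oU rf (rpred0 _ : 0 \is 0.-homog) (dhomog1 _ _) Q0 _ (coords_neq0 q) Uq.
by rewrite ev1 ev0 mulr1; apply=> v v0 Qv Uv; rewrite ev1 ev0 mulr1 H.
Qed.

Lemma lsub_neq0 (A : 'M[K]_3) Q : A \in unitmx -> Q != 0 -> lsub A Q != 0.
Proof.
move=> Au /ev_nonzero[v Qv]; apply: (@ev_neq0 _ _ _ (invmx A *m v)).
by rewrite ev_lsub mulKVmx.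
Qed.

Local Opaque PGL3_act proj_pt.

(** As al agrees generically with a function on the quotient, it takes the
    same value at all points of a fibre, by irreducibility; and the image of
    an open set in the quotient is open. *)
Lemma descend_local (V : set (P2 K)) al (b : X -> K) Q : open V ->
  regular V al -> Q != 0 ->
  (forall w, w != 0 -> ev Q w != 0 -> V (proj_pt w) ->
     al (proj_pt w) = b (pi (proj_pt w))) ->
  exists (U : set X) (f : X -> K), [/\ open U, regular U f &
    forall q, V q -> U (pi q) /\ f (pi q) = al q].
Proof.
move=> oV ral Q0 E.
have cons q1 q2 : V q1 -> V q2 -> pi q1 = pi q2 -> al q1 = al q2.
  move=> V1 V2 /pi_eq[d Gd E2]; rewrite E2 in V2 *.
  have oV' := act_open d oV.
  have oW : open (V `&` (PGL3_act d @^-1` V)) by apply: openI.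
  have rW : regular (V `&` (PGL3_act d @^-1` V)) (fun q => al q + - al (PGL3_act d q)).
    apply: (regular_add _ _ _ oW).
      by apply: (regular_sub _ _ _ oV oW _ ral) => q [].
    apply: (regular_opp oW); apply: (regular_sub _ _ _ oV' oW _ (act_regular oV ral)).
    by move=> q [].
  have du := valP (repr d).
  have := regular_zero oW rW (mulf_neq0 Q0 (lsub_neq0 du Q0)).
  move=> H; apply/eqP; rewrite -subr_eq0; apply/eqP; apply: (H _ q1); last by split.
  move=> w w0; rewrite evM ev_lsub mulf_eq0 negb_or => /andP[Qw Qdw] [Vw].
  rewrite /preimage /= => Vdw; rewrite E //.
  have dw0 := GL3_mulv_neq0 (repr d) w0.
  move: Vdw; rewrite act_repr // => Vdw; rewrite (E _ dw0 Qdw Vdw).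
  by rewrite -act_repr // pi_act // subrr.
pose U : set X := pi @` V.
have oU : open U.
  rewrite pi_open.
  have -> : pi @^-1` U = \bigcup_(g in [set g | fsubg G g]) (PGL3_act g @^-1` V).
    apply/seteqP; split=> q.
      by move=> [q' Vq' /esym /pi_eq[g Gg Eq']]; exists g => //; rewrite /preimage /= -Eq'.
    by move=> [g /= Gg Vgq]; exists (PGL3_act g q); rewrite ?pi_act.
  by apply: bigcup_open => g _; apply: act_open.
have /choice[ch hch] : forall x : X, exists q, U x -> V q /\ pi q = x.
  move=> x; have [[q Vq <-]|n] := pselect (U x); first by exists q.
  by have [q _] := pi_surj x; exists q.
pose f x := al (ch x).
have fE q : V q -> f (pi q) = al q.
  by move=> Vq; have [|Vc pc] := hch (pi q); [exists q|apply: cons].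
exists U, f; split=> //; last by move=> q Vq; split; [exists q|exact: fE].
rewrite pi_regular; apply: regular_glue => // q [q0 Vq0 /esym/pi_eq[g Gg Eq]].
exists (PGL3_act g @^-1` V); split.
- exact: act_open.
- by rewrite /preimage /= -Eq.
- by move=> q' Vq'; exists (PGL3_act g q'); rewrite ?pi_act.
apply: (@regular_ext _ _ _ (al \o PGL3_act g)).
  by move=> q' Vq' /=; rewrite -fE // pi_act.
exact: act_regular.
Qed.

Section OneLine.
Variable a : 'rV[K]_3.
Hypothesis a0 : a != 0.
Local Notation L := (lineset a).
Local Notation D := (pi @` L).

Definition act_row (g : PGL3 K) : 'rV[K]_3 := a *m val (repr g).

Lemma act_row_neq0 g : act_row g != 0.
Proof.
apply: contraNneq a0 => E; rewrite -[a](mulmxK (valP (repr g))).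
by rewrite -/(act_row g) E mul0mx.
Qed.

Lemma lineset_act g q : lineset (act_row g) q <-> L (PGL3_act g q).
Proof.
rewrite -[q]coordsK; have q0 := coords_neq0 q; rewrite act_repr //.
by rewrite (linesetE _ q0) (linesetE _ (GL3_mulv_neq0 _ q0)) mulmxA.
Qed.

Lemma pi_image q : D (pi q) <-> exists2 g, fsubg G g & lineset (act_row g) q.
Proof.
split=> [[q' Lq' /esym/pi_eq[g Gg E]]|[g Gg /lineset_act Lq]].
  by exists g => //; apply/lineset_act; rewrite -E.
by exists (PGL3_act g q); rewrite ?pi_act.
Qed.

Lemma image_closed : closed D.
Proof.
have [s [us sG]] := group_seq G.
have E : pi @^-1` (~` D) =
    \bigcap_(g in [set` s]) ~` lineset (act_row g).
  apply/seteqP; split=> q /=.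
    by move=> nD g /sG Gg Lq; apply: nD; apply/pi_image; exists g.
  by move=> H /pi_image[g /sG Gg Lq]; apply: (H g).
rewrite -openC pi_open E bigcap_seq.
elim: (s) => [|g t IHt]; first by rewrite big_nil; exact: openT.
by rewrite big_cons; apply: openI => //; rewrite openC; apply: lineset_closed.
Qed.

Lemma image_irreducible (Z : set (P2 K)) : irreducible_set Z -> irreducible_set (pi @` Z).
Proof.
move=> [[z Zz] irr]; split; first by exists (pi z), z.
have cpi (A : set X) : closed A -> closed (pi @^-1` A).
  by rewrite -!openC pi_open.
move=> A B /cpi cA /cpi cB sub; have [|sA|sB] := irr _ _ cA cB.
- by move=> q Zq; apply: sub; exists q.
- by left=> _ [q Zq <-]; apply: sA.
- by right=> _ [q Zq <-]; apply: sB.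
Qed.

Lemma strip_lines (r : seq 'rV[K]_3) d F : (forall c, c \in r -> c != 0) ->
  F \is d.-homog -> F != 0 -> exists e F',
  [/\ F' \is e.-homog, forall c, c \in r -> nonvan c F' &
      forall w, ev F w = 0 -> (exists2 c, c \in r & (c *m w) 0 0 = 0) \/ ev F' w = 0].
Proof.
move=> r0; elim: d F => [|d IHd] F hF F0.
  have [H|] := pselect (forall c, c \in r -> nonvan c F).
    by exists 0%N, F; split=> // w; right.
  move=> /existsNP[c /not_implyP[cr nF]].
  have [F' hF' E] := line_div (r0 c cr) hF nF.
  have := dhomogM (lform_homog c) hF'; rewrite -E => hF1.
  by have := dhomog_uniq F0 hF hF1.
have [H|] := pselect (forall c, c \in r -> nonvan c F).
  by exists d.+1, F; split=> // w; right.
move=> /existsNP[c /not_implyP[cr nF]].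
have [F1 /= hF1 E] := line_div (r0 c cr) hF nF.
have F10 : F1 != 0 by apply: contraNneq F0 => F10; rewrite E F10 mulr0.
have [e [F' [hF' nF' H]]] := IHd F1 hF1 F10.
exists e, F'; split=> // w; rewrite E evM ev_lform => /eqP.
by rewrite mulf_eq0 => /orP[/eqP cw|/eqP /H //]; left; exists c.
Qed.

(** An equation of W, pulled back to the plane and divided by the equations of
    the translates of the line, cuts out a residual curve. So W is covered by
    the image of the line and that of the residual curve, and the latter does
    not contain the former. *)
Lemma image_prime : prime_divisor D.
Proof.
have [s [us sG]] := group_seq G; split.
- exact: image_closed.
- exact/image_irreducible/lineset_irreducible.
- apply/eqP => DT.
  have : \prod_(g <- s) lform (act_row g) != 0.
    by rewrite prodf_seq_neq0; apply/allP => g _ /=; apply/lform_neq0/act_row_neq0.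
  case/ev_nonzero => w; rewrite ev_prod => /[dup] H.
  have w0 : w != 0.
    apply: contraNneq H => ->; have s1 : 1%g \in s by apply/sG; apply: fsubg1.
    by rewrite (big_rem _ s1) /= ev_lform mulmx0 mxE mul0r.
  have : D (pi (proj_pt w)) by rewrite DT.
  case/pi_image => g /sG gs /(linesetE _ w0) gw.
  by rewrite (big_rem _ gs) /= ev_lform gw mxE mul0r eqxx.
move=> W cW irrW sub; have [->|WT] := eqVneq W setT; [by right|left].
have cW' : closed (pi @^-1` W) by move: cW; rewrite -!openC pi_open.
have WT' : pi @^-1` W != setT.
  apply/eqP => E; move/eqP: WT; apply; apply/seteqP; split=> // x _.
  by have [q <-] := pi_surj x; have : (pi @^-1` W) q by rewrite E.
have [d [F [hF F0 FW]]] := closed_form cW' WT'.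
have [|e [F' [hF' nF' HF]]] := @strip_lines [seq act_row g | g <- s] d F _ hF F0.
  by move=> c /mapP[g _ ->]; apply: act_row_neq0.
pose N := \prod_(g <- s) lsub (val (repr g)) F'.
pose T : set X := [set x | exists2 q, pi q = x & peval F' q = 0].
have NT q : T (pi q) <-> exists2 g, g \in s & peval F' (PGL3_act g q) = 0.
  split=> [[q' /esym/pi_eq[g /sG gs ->] F'q]|[g /sG Gg F'q]]; first by exists g.
  by exists (PGL3_act g q); rewrite ?pi_act.
have cT : closed T.
  have E : pi @^-1` (~` T) = \bigcap_(g in [set` s])
      (PGL3_act g @^-1` [set q | peval F' q != 0]).
    apply/seteqP; split=> q /=.
      by move=> nT g gs; apply/eqP => F'q; apply: nT; apply/NT; exists g.
    by move=> H /NT[g gs F'q]; have /eqP := H g gs.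
  rewrite -openC pi_open E bigcap_seq.
  elim: (s) => [|g t IHt]; first by rewrite big_nil; exact: openT.
  by rewrite big_cons; apply: openI => //; apply/act_open/(open_principal hF').
have [|s1|s1] := irrW.2 _ _ image_closed cT.
- move=> x Wx; have [q Eq] := pi_surj x; rewrite -Eq in Wx *.
  have q0 := coords_neq0 q.
  have Wq : (pi @^-1` W) (proj_pt (coords q)) by rewrite coordsK.
  have [[c /mapP[g /sG Gg ->] cq]|F'q] := HF _ (FW _ q0 Wq).
    left; apply/pi_image; exists g => //.
    by rewrite /lineset /=; apply/matrixP => i j; rewrite !ord1 cq mxE.
  by right; exists q.
- by apply/seteqP; split.
have nN : nonvan a N.
  apply: nonvan_prod => // g /sG Gg.
  have gVs : (g^-1)%g \in s by apply/sG; apply: fsubgV.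
  have [v [v0 av F'v]] := nF' _ (map_f act_row gVs).
  exists (val (repr (g^-1)%g) *m v); split; first exact: GL3_mulv_neq0.
    by rewrite mulmxA.
  have l := lifts_mul (lifts_repr g) (lifts_repr (g^-1)%g).
  rewrite mulgV in l; have [k [k0 Ek]] := lifts_eq l (lifts1 K).
  rewrite ev_lsub mulmxA Ek -scalemxAl mul1mx (ev_homog _ _ hF').
  by rewrite mulf_neq0 // expf_neq0.
have [v [v0 av]] := nN.
have /sub/s1/NT[g gs] : D (pi (proj_pt v)) by exists (proj_pt v) => //; apply/linesetE.
move=> F'v; rewrite /N ev_prod (big_rem _ gs) /= ev_lsub.
move/eqP: F'v; rewrite act_repr // (peval_proj_eq0 hF' (GL3_mulv_neq0 _ v0)) => /eqP ->.
by rewrite mul0r eqxx.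
Qed.

Lemma germ_pi f : germ D f -> germ L (f \o pi).
Proof.
move=> [U [oU [z [Uz [q Lq Eq]]] rU]]; rewrite -Eq in Uz.
by exists (pi @^-1` U); split=> //; exists q.
Qed.

Lemma vanishing_pi f : vanishing D D f -> vanishing L L (f \o pi).
Proof.
move=> [U [oU [z [Uz [q Lq Eq]]] H]]; rewrite -Eq in Uz.
exists (pi @^-1` U); split=> //.
  by exists q.
by move=> q' Uq' Lq'; apply: H => //; exists q'.
Qed.

(** The product over G of the translates of the equation of the line, divided
    by another linear form, is invariant and vanishes on the line. *)
Lemma positive_order : exists k f, [/\ (0 < k)%N, germ D f & ordl a k (f \o pi)].
Proof.
have [s [us sG]] := group_seq G.
have [v [v0 av _]] := nonvan1 a0.
have nz x : x \in [seq val (repr g) *m v | g <- s] -> x != 0.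
  by move=> /mapP[g _ ->]; apply: GL3_mulv_neq0.
have [b Hb] := avoid nz.
have hb := lform_homog b.
pose Vb := [set q : P2 K | peval (lform b) q != 0].
have oVb : open Vb := open_principal hb.
pose V := [set q | forall g, g \in s -> Vb (PGL3_act g q)].
have oV : open V.
  have -> : V = \bigcap_(g in [set` s]) (PGL3_act g @^-1` Vb).
    by apply/seteqP; split=> q Hq g; apply: Hq.
  rewrite bigcap_seq; elim: (s) => [|g t IHt]; first by rewrite big_nil; exact: openT.
  by rewrite big_cons; apply: openI => //; apply: act_open.
have Vv : V (proj_pt v).
  move=> g gs; rewrite act_repr // /Vb /= (peval_proj_neq0 hb (GL3_mulv_neq0 _ v0)) ev_lform.
  by apply: Hb; apply: (map_f (fun g => val (repr g) *m v)).
have invV g q : fsubg G g -> V q -> V (PGL3_act g q).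
  move=> Gg Vq h /sG Gh; rewrite -PGL3_actM; apply: Vq; apply/sG.
  exact: fsubgM.
pose rho q := \prod_(g <- s) line_ratio a b (PGL3_act g q).
have invrho g q : fsubg G g -> rho (PGL3_act g q) = rho q.
  move=> Gg; have perm : perm_eq [seq (h * g)%g | h <- s] s.
    apply: perm_map_self => [|x y|x xs]; [exact: us|exact: mulIg|].
    by apply/sG; apply: fsubgM; [apply/sG|].
  rewrite /rho -[RHS](perm_big _ perm) big_map; apply: eq_bigr => h _.
  by rewrite PGL3_actM.
have rrho : regular V rho.
  have -> : rho = fun q => \prod_(g <- s | g \in s) line_ratio a b (PGL3_act g q).
    by apply: funext => q; rewrite -big_seq.
  suff: forall t : seq (PGL3 K), {subset t <= s} -> regular V (fun q => \prod_(g <- t) line_ratio a b (PGL3_act g q)).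
    move=> H; apply: regular_eq (H s (fun _ x => x)) => q; exact: big_seq.
  elim=> [|g t IHt] ts.
    by apply: (@regular_eq _ _ _ (fun _ => 1)) => [q|]; [rewrite big_nil|exact: regular_cst].
  apply: (@regular_eq _ _ _ (fun q => line_ratio a b (PGL3_act g q) *
      \prod_(h <- t) line_ratio a b (PGL3_act h q))) => [q|].
    by rewrite big_cons.
  apply: (regular_mul _ _ _ oV); last first.
    by apply: IHt => h ht; apply: ts; rewrite inE ht orbT.
  apply: (regular_sub (PGL3_act g @^-1` Vb)) => //; first exact: act_open.
    by move=> q Vq; apply: Vq; apply: ts; rewrite inE eqxx.
  apply: (act_regular oVb).
  by apply: (regular_ratio (lform_homog a) hb) => q.
have [U [oU UV]] := descend_open oV invV.
have [f fE] := descend invrho.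
have EU : pi @^-1` U = V by apply/seteqP; split=> q /UV.
have rf : regular U f.
  rewrite pi_regular EU; apply: regular_eq rrho => q.
  by rewrite /= fE.
have gf : germ D f.
  exists U; split=> //; exists (pi (proj_pt v)); split; first exact/UV.
  by exists (proj_pt v) => //; apply/linesetE.
have vf : vanishing L L (f \o pi).
  exists setT; split; first exact: openT.
    by exists (proj_pt v); split=> //; apply/linesetE.
  move=> q _ Lq; rewrite /= fE /rho (big_rem (1%g : PGL3 K)) /=; last first.
    by apply/sG; apply: fsubg1.
  rewrite PGL3_act1 /line_ratio {1}/peval -/(ev _ (coords q)) ev_lform Lq mxE.
  by rewrite !mul0r.
have [[d [Q [hQ nQ E]]]|[k ok]] := germ_ordl a0 (germ_pi gf); last first.
  by exists k, f; split=> //; apply/(ordl_vanishing a0 ok).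
exfalso.
have b0 : b != 0.
  have v1 : val (repr (1%g : PGL3 K)) *m v \in [seq val (repr g) *m v | g <- s].
    by apply: (map_f (fun g => val (repr g) *m v)); apply/sG; apply: fsubg1.
  by apply/eqP => b0; have := Hb _ v1; rewrite b0 mul0mx mxE eqxx.
have : Q * \prod_(g <- s) (lsub (val (repr g)) (lform a * lform b)) * 'X_0 != 0.
  apply: mulf_neq0; last exact: X1_neq0.
  apply: mulf_neq0; first exact: nonvan_neq0 nQ.
  rewrite prodf_seq_neq0; apply/allP => g _; apply: (lsub_neq0 (valP (repr g))).
  by apply: mulf_neq0; apply: lform_neq0.
case/ev_nonzero => w; rewrite !evM evX !mulf_eq0 !negb_or => /andP[/andP[Qw ab] wX].
have w0 : w != 0 by apply: contraNneq wX => ->; rewrite mxE.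
have := E w w0 Qw; rewrite /= fE /rho => /eqP; rewrite prodf_seq_eq0 => /hasP[g gs /=].
rewrite act_repr //; have gw0 := GL3_mulv_neq0 (repr g) w0.
rewrite /line_ratio (peval_proj_ratio (lform_homog a) hb gw0) => /eqP gE.
move: ab; rewrite ev_prod (big_rem _ gs) /= ev_lsub evM !mulf_eq0 !negb_or.
move=> /andP[/andP[aw bw] _].
by move/eqP: gE; rewrite mulf_eq0 invr_eq0 (negPf aw) (negPf bw).
Qed.

(** Among the functions of the quotient, one of minimal positive order e along
    the line divides all those that vanish on the line, so it is a
    uniformizer; and it is a unit times the e-th power of the equation of the
    line. *)
Lemma ramification_exists : exists e, ramification_index pi L e.
Proof.
pose P k := `[< (0 < k)%N /\ exists2 f, germ D f & ordl a k (f \o pi) >].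
have exP : exists k, P k.
  by have [k [f [k0 gf of_]]] := positive_order; exists k; apply/asboolP; split=> //; exists f.
have [e /asboolP[e0 [t gt oT]] emin] := ex_minnP exP.
exists e.
have [b nb] := nonvan_lform a0; have hb := lform_homog b.
have [dT [Ft [Qt [hFt hQt nFt nQt Et]]]] := oT.
have irrL := lineset_irreducible a0.
have [U0 [oU0 mU0 rU0]] := gt.
have vt : forall y, U0 y -> D y -> t y = 0.
  move=> y U0q [q Lq Eq]; rewrite -Eq in U0q *; apply/eqP/negPn/negP => tq.
  have [V [oV mV HV]] := (ordl_vanishing a0 oT).2 e0.
  have [o1 _] := regular_inv _ _ oU0 rU0.
  rewrite pi_open in o1.
  have [|q' [[[_ /= tq'] Vq'] Lq']] := irreducible_open irrL o1 oV _ mV.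
    by exists q.
  by have /eqP := tq'; apply; exact: HV.
have loct : local_equation D D t.
  split=> // f gf; split=> [vf|[c [gc [U [oU mU E]]]]]; last first.
    exists (U `&` U0); split; first exact: openI.
      have irrD := image_irreducible irrL.
      exact: irreducible_open irrD oU oU0 mU mU0.
    by move=> y [Uy U0y] Dy; rewrite E // big_ord1 vt // mulr0.
  have [Uf [oUf mUf rUf]] := gf.
  have [z [Uz [q Lq Eq]]] := mUf.
  have [[d [Q [hQ nQ E]]]|[k ok]] := germ_ordl a0 (germ_pi gf).
    exists (fun _ _ => 0); split=> [_|].
      by exists setT; split; [exact: openT|exists z; split=> //; exists q|exact/regular_cst/openT].
    exists Uf; split=> // y Uy; rewrite big_ord1 mul0r.
    have [q' Eq'] := pi_surj y; rewrite -Eq' in Uy *.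
    apply: (regular_zero (f := f \o pi) oUf rUf (nonvan_neq0 nQ)) Uy => w w0 Qw _.
    exact: E.
  have vk := (ordl_vanishing a0 ok).1 (vanishing_pi vf).
  have ek : (e <= k)%N by apply: emin; apply/asboolP; split=> //; exists f.
  have [df [Ff [Qf [hFf hQf nFf nQf Ef]]]] := ok.
  (* The ratio of f and t is regular near a general point of the line because
     e <= k. *)
  pose Num := lform a ^+ (k - e) * Ff * Qt; pose Den := Qf * Ft.
  have hNum : Num \is (1 * (k - e) + df + (dT + e)).-homog.
    by apply: dhomogM hQt; apply: dhomogM hFf; apply/dhomogMn/lform_homog.
  have eNum : (1 * (k - e) + df + (dT + e) = df + k + dT)%N.
    by rewrite mul1n; move: ek; lia.
  rewrite eNum in hNum.
  have hDen : Den \is (df + k + dT).-homog by apply: dhomogM.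
  pose Gd := Den * (Ff * Qt).
  have nGd : nonvan a Gd by do !apply: nonvanM.
  have hGd := dhomogM hDen (dhomogM hFf hQt).
  pose V := [set p | peval Gd p != 0].
  have oV : open V := open_principal hGd.
  have ral : regular V (fun p => peval Num p / peval Den p).
    apply: (regular_ratio hNum hDen) => p; rewrite /V /= /peval mevalM mulf_eq0 negb_or.
    by case/andP.
  have gen w : w != 0 -> ev (Gd * lform a) w != 0 ->
     [/\ f (pi (proj_pt w)) = (a *m w) 0 0 ^+ k * ev Ff w / ev Qf w,
         t (pi (proj_pt w)) = (a *m w) 0 0 ^+ e * ev Ft w / ev Qt w,
         [/\ (a *m w) 0 0 != 0, ev Ff w != 0 & ev Qf w != 0],
         ev Ft w != 0 & ev Qt w != 0].
    move=> w0; rewrite !evM ev_lform !mulf_eq0 !negb_or.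
    case/andP => /andP[/andP[Qfw Ftw] /andP[Ffw Qtw]] aw.
    by split=> //; [exact: Ef|exact: Et].
  have numE w : w != 0 -> ev (Gd * lform a) w != 0 ->
      peval Num (proj_pt w) / peval Den (proj_pt w) * t (pi (proj_pt w)) = f (pi (proj_pt w))
      /\ t (pi (proj_pt w)) != 0.
    move=> w0 Gw; have [-> -> [aw Ffw Qfw] Ftw Qtw] := gen w w0 Gw.
    rewrite (peval_proj_ratio hNum hDen w0) /Num /Den !evM evXn ev_lform.
    have -> : (a *m w) 0 0 ^+ k = (a *m w) 0 0 ^+ (k - e) * (a *m w) 0 0 ^+ e.
      by rewrite -exprD subnK.
    split; last by rewrite !mulf_neq0 ?invr_eq0 // expf_neq0.
    move: Ffw Qfw Ftw Qtw (expf_neq0 e aw) => n1 n2 n3 n4 n5.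
    move: n1 n2 n3 n4 n5; move: (ev Ff w) (ev Qf w) (ev Ft w) (ev Qt w) (_ ^+ e) (_ ^+ (k - e)).
    by move=> x1 x2 x3 x4 x5 x6 n1 n2 n3 n4 n5; field; rewrite n2 n3 n4.
  have Ga0 : Gd * lform a != 0 by apply: mulf_neq0; [exact: nonvan_neq0 nGd|exact: lform_neq0].
  have [|U [c [oU rc cE]]] := descend_local (b := fun y => f y / t y) oV ral Ga0.
    by move=> w w0 Gw _; have [<- t0] := numE w w0 Gw; rewrite mulfK.
  have mUV : U `&` D !=set0.
    have [v [v0 av Gv]] := nGd; exists (pi (proj_pt v)); split.
      by apply: (cE _ _).1; rewrite /V /= (peval_proj_neq0 hGd v0).
    by exists (proj_pt v) => //; apply/linesetE.
  exists (fun _ => c); split=> [_|]; first by exists U.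
  have irrD := image_irreducible irrL.
  have [z' [[[Uz' Ufz'] U0z'] Dz']] : (U `&` Uf) `&` U0 `&` D !=set0.
    apply: irreducible_open => //; first exact: openI.
    exact: irreducible_open irrD oU oUf mUV mUf.
  exists ((U `&` Uf) `&` U0); split.
  - by apply: openI => //; apply: openI.
  - by exists z'.
  have oW : open ((U `&` Uf) `&` U0) by apply: openI => //; apply: openI.
  have rW : regular ((U `&` Uf) `&` U0) (fun y => f y + - (c y * t y)).
    apply: (regular_add _ _ _ oW); first by apply: (regular_sub Uf) => // y [[]].
    apply: (regular_opp oW); apply: (regular_mul _ _ _ oW).
      by apply: (regular_sub U) => // y [[]].
    by apply: (regular_sub U0) => // y [].
  move=> y Wy; rewrite big_ord1; apply/eqP; rewrite -subr_eq0; apply/eqP.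
  have [q' Eq'] := pi_surj y; rewrite -Eq' in Wy *.
  apply: (regular_zero (f := (fun y => f y + - (c y * t y)) \o pi) oW rW Ga0) Wy.
  move=> w w0 Gw _ /=; have [E1 _] := numE w w0 Gw.
  have Vw : V (proj_pt w).
    by rewrite /V /= (peval_proj_neq0 hGd w0); move: Gw; rewrite evM mulf_eq0 negb_or => /andP[].
  by rewrite (cE _ Vw).2 E1 subrr.
pose wn := lform b ^+ e * Ft.
have hwn : wn \is (1 * e + dT).-homog by apply: dhomogM hFt; apply/dhomogMn.
rewrite mul1n addnC in hwn.
exists t, (line_ratio a b), (fun p => peval wn p / peval Qt p); split=> //.
- exact: line_local_equation.
- have nW : nonvan a (wn * Qt) by apply: nonvanM => //; apply: nonvanM => //; apply: nonvanX.
  have hW := dhomogM hwn hQt.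
  exists [set p | peval (wn * Qt) p != 0]; split.
  + exact: open_principal hW.
  + by apply: (nonvan_meets nW) => w w0; rewrite /= (peval_proj_neq0 hW w0).
  + apply: (regular_ratio hwn hQt) => p; rewrite /= /peval mevalM mulf_eq0 negb_or.
    by case/andP.
  + move=> p; rewrite /= {1}/peval mevalM mulf_eq0 negb_or => /andP[n1 n2].
    by rewrite mulf_neq0 // invr_eq0.
have hGG := dhomogM (dhomogM hFt hQt) hb; have nGG := nonvanM a0 (nonvanM a0 nFt nQt) nb.
apply: (@line_germ_eq _ _ L _ _ _ _ erefl hGG nGG).
move=> w w0; rewrite !evM !mulf_eq0 !negb_or => /andP[/andP[Ftw Qtw] bw].
rewrite /= -[LHS]/((t \o pi) (proj_pt w)) Et //.
rewrite /line_ratio (peval_proj_ratio hwn hQt w0) (peval_proj_ratio (lform_homog a) hb w0).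
rewrite /wn !evM evXn !ev_lform expr_div_n.
rewrite ev_lform in bw.
move: (expf_neq0 e bw) Qtw; move: ((b *m w) 0 0 ^+ e) ((a *m w) 0 0 ^+ e) (ev Qt w) (ev Ft w).
by move=> x1 x2 x3 x4 n1 n2; field; rewrite n1 n2.
Qed.

End OneLine.
End Branch.

Section Reflections.
Variables (K : numClosedFieldType) (G : finSubgroup (PGL3 K)).
Local Notation X := (P2quot G).
Local Notation pi := (@piG K G).
Implicit Types (a c : 'rV[K]_3) (u v w : 'cV[K]_3) (g h : PGL3 K).

Local Opaque PGL3_act proj_pt.

Lemma mulmx_ext m n (A B : 'M[K]_(m, n)) :
  (forall x : 'cV[K]_n, A *m x = B *m x) -> A = B.
Proof.
move=> H; apply/matrixP => i j; have := H (delta_mx j 0).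
by rewrite -!colE => /matrixP/(_ i 0); rewrite !mxE.
Qed.

Lemma cV2E (x : 'cV[K]_2) : x = x 0 0 *: delta_mx 0 0 + x 1 0 *: delta_mx 1 0.
Proof.
apply/colP => i; rewrite !mxE eqxx !andbT.
by case: i => -[|[|//]] lt_i; rewrite /= ?mulr1 ?mulr0 ?addr0 ?add0r; congr (x _ _); apply: val_inj.
Qed.

(** A collineation fixing every point of a line has all its eigenvalues on
    this line equal, so it is a rank one perturbation of the identity. *)
Lemma pointwise_fixed_lift c g : c != 0 ->
  (forall q, lineset c q -> PGL3_act g q = q) -> exists u, lifts (1%:M + u *m c) g.
Proof.
move=> c0 fix_g; have [C [cC Cinj Csurj]] := line_param c0.
pose A := val (repr g).
have nz (x : 'cV[K]_2) : x != 0 -> C *m x != 0.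
  by apply: contraNneq => /Cinj ->.
have eig (x : 'cV[K]_2) : x != 0 -> exists k, A *m (C *m x) = k *: (C *m x).
  move=> x0; have := fix_g (proj_pt (C *m x)) ((linesetE c (nz x x0)).2 (cC x)).
  rewrite act_repr ?nz // => E.
  by have [k [_ Ek]] := proj_pt_eq (GL3_mulv_neq0 (repr g) (nz x x0)) (nz x x0) E; exists k.
have d0 (i : 'I_2) : delta_mx i 0 != 0 :> 'cV[K]_2.
  by apply/cV0Pn; exists i; rewrite mxE !eqxx oner_neq0.
have d01 : delta_mx 0 0 + delta_mx 1 0 != 0 :> 'cV[K]_2.
  by apply/cV0Pn; exists 0; rewrite !mxE addr0 oner_neq0.
have [k0 E0] := eig _ (d0 0); have [k1 E1] := eig _ (d0 1); have [k E01] := eig _ d01.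
have E : ((k - k0) *: delta_mx 0 0 + (k - k1) *: delta_mx 1 0) = 0 :> 'cV[K]_2.
  apply: Cinj.
  rewrite mulmxDr -!scalemxAr !scalerBl -E0 -E1 addrACA -scalerDr -mulmxDr.
  by rewrite -E01 -opprD -!mulmxDr subrr.
have Ek0 : k0 = k.
  by move/matrixP/(_ 0 0): E; rewrite !mxE mulr1 mulr0 addr0 => /eqP; rewrite subr_eq0 => /eqP.
have Ek1 : k1 = k.
  by move/matrixP/(_ 1 0): E; rewrite !mxE mulr1 mulr0 add0r => /eqP; rewrite subr_eq0 => /eqP.
have AC (x : 'cV[K]_2) : A *m (C *m x) = k *: (C *m x).
  rewrite (cV2E x) !mulmxDr -!scalemxAr E0 E1 Ek0 Ek1.
  by rewrite scalerDr !scalerA !(mulrC k).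
have k_neq0 : k != 0.
  apply: contraTneq (GL3_mulv_neq0 (repr g) (nz _ (d0 0))) => k_0.
  by rewrite -/A E0 Ek0 k_0 scale0r eqxx.
have [w] := ev_nonzero (lform_neq0 c0); rewrite ev_lform => cw.
pose A1 := k^-1 *: A; exists (((c *m w) 0 0)^-1 *: (A1 *m w - w)).
have lA : lifts A1 g by apply: lifts_scale (lifts_repr g); rewrite invr_eq0.
suff <- : A1 = 1%:M + (((c *m w) 0 0)^-1 *: (A1 *m w - w)) *m c by [].
apply: mulmx_ext => x; rewrite mulmxDl mul1mx -mulmxA.
pose r := (c *m x) 0 0 / (c *m w) 0 0.
have [y Ey] : exists y, x - r *: w = C *m y.
  apply: Csurj; rewrite mulmxBr -scalemxAr [c *m x]mx11_scalar [c *m w]mx11_scalar.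
  by rewrite scale_scalar_mx /r divfK ?subrr.
have xE : x = C *m y + r *: w by rewrite -Ey subrK.
have A1C : A1 *m (C *m y) = C *m y by rewrite /A1 -scalemxAl AC scalerA mulVf // scale1r.
rewrite {1}xE mulmxDr -scalemxAr A1C [c *m x]mx11_scalar mul_mx_scalar scalerA -/r scalerBr.
by rewrite {1}xE -addrA [_ + (_ - _)]addrC subrK.
Qed.

(** Write f = c F / Q with F and Q nonzero on the line. The collineation
    multiplies the equation c by the eigenvalue 1 + c u; at a point of the
    line with F and Q nonzero, invariance of f forces this eigenvalue to be
    one. *)
Lemma invariant_simple_zero c u g f : c != 0 -> lifts (1%:M + u *m c) g ->
  ordl c 1 f -> (forall q, f (PGL3_act g q) = f q) -> c *m u = 0.
Proof.
move=> c0 lg [d [F [Q [hF hQ nF nQ E]]]] inv.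
pose A : 'M[K]_3 := 1%:M + u *m c; have Au : A \in unitmx := lifts_unit lg.
pose z := 1 + (c *m u) 0 0.
have cA w : (c *m (A *m w)) 0 0 = z * (c *m w) 0 0.
  rewrite /A mulmxDl mul1mx mulmxDr !mulmxA -(mulmxA (c *m u)) [c *m u]mx11_scalar.
  rewrite mul_scalar_mx /z mulrDl mul1r; move: (c *m w) ((c *m u) 0 0) => x y.
  by rewrite !mxE.
have EP : F * lsub A Q = z *: (lsub A F * Q).
  apply: (@ev_eq_off0 _ _ _ (F * Q * lsub A (F * Q) * lform c)).
    apply: mulf_neq0; last exact: lform_neq0.
    have FQ0 : F * Q != 0 by apply: mulf_neq0; [exact: nonvan_neq0 nF|exact: nonvan_neq0 nQ].
    by apply: mulf_neq0 => //; apply: lsub_neq0.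
  move=> w w0; rewrite !evM !ev_lsub ev_lform !mulf_eq0 !negb_or evM mulf_eq0 negb_or.
  move=> /andP[/andP[/andP[Fw Qw] /andP[FAw QAw]] cw].
  have Aw0 : A *m w != 0 by exact: (@GL3_mulv_neq0 _ (exist _ A Au)).
  have := inv (proj_pt w); rewrite (lifts_act lg w0) -/A (E _ Aw0 FAw QAw) (E _ w0 Fw Qw).
  rewrite !expr1 cA evZ !evM !ev_lsub.
  move: cw Qw QAw; clear -z; move: z => x6.
  move: ((c *m w) 0 0) (ev Q w) (ev F w) (ev Q (A *m w)) (ev F (A *m w)).
  move=> x1 x2 x3 x4 x5 n1 n2 n3 E1; apply: (mulfI n1).
  have := congr1 (fun y => y * (x2 * x4)) E1.
  have -> : x6 * x1 * x5 / x4 * (x2 * x4) = x1 * (x6 * (x5 * x2)) by field.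
  have -> : x1 * x3 / x2 * (x2 * x4) = x1 * (x3 * x4) by field.
  by [].
have [v [v0 cv]] := nonvanM c0 nF nQ; rewrite evM => FQv.
have Av : A *m v = v by rewrite /A mulmxDl mul1mx -mulmxA cv mulmx0 addr0.
have := congr1 (fun P => ev P v) EP; rewrite evZ !evM !ev_lsub Av -{1}[_ * _]mul1r.
move/(mulIf FQv)/eqP; rewrite -subr_eq0 /z opprD addNKr oppr_eq0 => /eqP z1.
by apply/matrixP => i j; rewrite !ord1 z1 mxE.
Qed.

(** In characteristic zero the powers 1 + k u c of a nontrivial transvection
    are pairwise distinct, whereas only finitely many lifts of elements of G
    fix a given vector. *)
Lemma transvection_trivial c u g : c != 0 -> fsubg G g ->
  lifts (1%:M + u *m c) g -> c *m u = 0 -> g = 1%g.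
Proof.
move=> c0 Gg lg cu; have [C [cC Cinj _]] := line_param c0.
pose v : 'cV[K]_3 := C *m delta_mx 0 0; have v0 : v != 0.
  apply/eqP => /(Cinj _) /matrixP /(_ 0 0) /eqP; by rewrite !mxE oner_eq0.
have [Hs [[us H1 HM HU] memH]] := stabilizer_lift G v0.
have inH k : (1%:M + (k%:R *: u) *m c) \in Hs.
  elim: k => [|k IHk]; first by rewrite scale0r mul0mx addr0.
  have H2 : (1%:M + u *m c) \in Hs.
    apply/memH; split; last by exists g.
    by rewrite mulmxDl mul1mx -mulmxA cC mulmx0 addr0.
  suff -> : 1%:M + (k.+1%:R *: u) *m c = (1%:M + u *m c) *m (1%:M + (k%:R *: u) *m c).
    exact: HM.
  rewrite mulmxDl mul1mx mulmxDr mulmx1 -!mulmxA.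
  have -> : c *m (k%:R *: u *m c) = 0 by rewrite mulmxA -scalemxAr cu scaler0 mul0mx.
  by rewrite mulmx0 addr0 -addrA -mulmxDl -natr1 scalerDl scale1r.
have [u0|u0] := eqVneq u 0.
  by move: lg; rewrite u0 mul0mx addr0 => lg; apply: lifts_inj lg (lifts1 K).
have [i ui] := cV0Pn _ u0; have [j cj] := rV0Pn _ c0.
have inj : injective (fun k : nat => 1%:M + (k%:R *: u) *m c).
  move=> k l /addrI /matrixP /(_ i j); rewrite !mxE !big_ord1 !mxE.
  by move=> /(mulIf cj) /(mulIf ui) /eqP; rewrite eqr_nat => /eqP.
have sub : {subset [seq 1%:M + (k%:R *: u) *m c | k <- iota 0 (size Hs).+1] <= Hs}.
  by move=> B /mapP[k _ ->].
have := uniq_leq_size _ sub; rewrite (map_inj_uniq inj) iota_uniq size_map size_iota ltnn.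
by move=> /(_ isT).
Qed.

(** If the quotient were unramified along the line, the pullback of a
    uniformizer would be an invariant function with a simple zero along the
    line; the reflection would then be a transvection. *)
Theorem mirror_ramified a h : a != 0 -> fsubg G h -> h != 1%g ->
  (forall q, lineset a q -> PGL3_act h q = q) ->
  branch_coef pi (pi @` lineset a) != 0.
Proof.
move=> a0 Gh h1 fixh; rewrite /branch_coef.
have [e0 re0] := ramification_exists G a0.
case: xgetP => [e _ [C [pC piC [t [s [w [lt ls uw E]]]]]]|none]; last first.
  by have := none e0; case; exists (lineset a); split=> //; exact: lineset_prime.
rewrite subr_eq0; apply/eqP => e_1.
have {e_1} e1 : e = 1%N.
  by apply/eqP; rewrite -(pnatr_eq1 rat) -[e%:R]invrK -e_1 invr1.
rewrite {}e1 in E.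
have [sG [us sGP]] := group_seq G; have [cC irrC _ maxC] := pC.
have [||g gs Cg] := @irreducible_bigcup _ _ sG C (fun g => lineset (act_row a g)) irrC.
- by move=> g _; apply: lineset_closed.
- move=> z Cz; have : (pi @` lineset a) (pi z) by rewrite -piC; exists z.
  by move=> /pi_image[g /sGP gs Lz]; exists g.
pose c := act_row a g; have c0 : c != 0 := act_row_neq0 a0 g.
have CE : C = lineset c.
  have [//|/eqP] := maxC _ (@lineset_closed _ c) (lineset_irreducible c0) Cg.
  by rewrite (negPf (lineset_neqT c0)).
have Gg : fsubg G g by apply/sGP.
pose h' := (g^-1 * (h * g))%g.
have Gh' : fsubg G h' by apply: fsubgM; [exact: fsubgV|exact: fsubgM].
have fixh' q : lineset c q -> PGL3_act h' q = q.
  move=> /lineset_act Lq; rewrite /h' PGL3_actM [PGL3_act (h * g)%g q]PGL3_actM.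
  by rewrite (fixh _ Lq) -PGL3_actM mulVg PGL3_act1.
have [u lu] := pointwise_fixed_lift c0 fixh'.
have ot : ordl c 1 (t \o pi).
  rewrite CE in ls uw E.
  have := ordlM c0 (germ_unit_ordl c0 uw) (ordlX c0 1 (local_equation_ordl c0 ls)).
  have [U [oU mU HE]] := E; have [d [Q [hQ nQ HQ]]] := open_meets_line oU mU.
  by apply: (ordl_eq c0 hQ nQ) => v v0 Qv; rewrite (HE _ (HQ v v0 Qv)).
have cu : c *m u = 0.
  apply: (invariant_simple_zero c0 lu ot) => q.
  by rewrite /= pi_act.
have h'1 := transvection_trivial c0 Gh' lu cu.
move/eqP: h1; apply; apply: (mulIg g); rewrite mul1g.
by apply: (mulgI g^-1%g); rewrite mulVg -h'1.
Qed.

End Reflections.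

(** * Point stabilizers in the plane *)

Section Stabilizers.
Variables (K : numClosedFieldType) (G : finSubgroup (PGL3 K)).
Local Notation X := (P2quot G).
Local Notation pi := (@piG K G).

Local Opaque PGL3_act proj_pt.

Definition dg (x y z : K) : 'M[K]_3 := diag_mx (\row_i [:: x; y; z]`_i).

Definition tor (B : 'M[K]_3) x y z : 'M[K]_3 := B *m dg x y z *m invmx B.

Definition standard_stabilizer p B e1 e2 :=
  [/\ B \in unitmx, proj_pt (B *m delta_mx 0 0) = p, (0 < e1)%N /\ (0 < e2)%N &
   forall g, (fsubg G g /\ PGL3_act g p = p) <->
     exists a b, [/\ a ^+ e1 = 1, b ^+ e2 = 1 & lifts (tor B 1 a b) g]].

Lemma cc0E : cc 0 = delta_mx 0 0 :> 'cV[K]_3.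
Proof.
apply/colP => i; rewrite /cc.
by case: (@split_ordP 1 2 i) => j ->;
  [rewrite (@col_mxEu _ 1 2) !ord1 !mxE|rewrite (@col_mxEd _ 1 2) !mxE].
Qed.

Lemma blk_dg (P : 'M[K]_2) a b : blk (P *m diag_mx (\row_i [:: a; b]`_i)) = blk P *m dg 1 a b.
Proof.
rewrite -blkM; congr (_ *m _); apply/matrixP => i j.
rewrite /blk.
case: (@split_ordP 1 2 i) => i' ->; case: (@split_ordP 1 2 j) => j' ->.
- by rewrite (@block_mxEul _ 1 2 1 2) !ord1 !mxE.
- by rewrite (@block_mxEur _ 1 2 1 2) !ord1 !mxE.
- by rewrite (@block_mxEdl _ 1 2 1 2) !ord1 !mxE.
- by rewrite (@block_mxEdr _ 1 2 1 2) !mxE; case: (ord2P i') => ->; case: (ord2P j') => ->.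
Qed.

Section AtPoint.
Variables (B : 'M[K]_3) (H : seq 'M[K]_2).
Hypotheses (Bu : B \in unitmx) (gH : matrix_group H).
Hypothesis HG : forall M, M \in H ->
  exists2 g, fsubg G g & lifts (B *m blk M *m invmx B) g.
Hypothesis GH : forall g, fsubg G g -> PGL3_act g (chart B 0) = chart B 0 ->
  exists2 M, M \in H & lifts (B *m blk M *m invmx B) g.
Local Notation p := (chart B 0).

(** The line of the plane through p in the direction v. *)
Definition direction (v : 'cV[K]_2) : 'rV[K]_3 :=
  row_mx (0 : 'M[K]_1) (\row_j [:: v 1 0; - v 0 0]`_j) *m invmx B.

Lemma direction_cc v x : direction v *m (B *m cc x) = (dt x v)%:M.
Proof.
rewrite /direction -mulmxA mulKmx // /cc mul_row_col mul0mx add0r.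
apply/matrixP => i j; rewrite !ord1 !mxE big_ord2 !mxE /dt /= mulr1n.
by ring.
Qed.

Lemma direction_neq0 v : v != 0 -> direction v != 0.
Proof.
move=> v0; apply: contraNneq v0 => E; apply/eqP/colP => i; rewrite mxE.
have dv x : dt x v = 0.
  have := direction_cc v x; rewrite E mul0mx => /matrixP/(_ 0 0).
  by rewrite !mxE mulr1n.
have := dv (delta_mx 0 0); have := dv (delta_mx 1 0); rewrite /dt !mxE /= !mulr1n !mulr0n.
rewrite !mul0r !mul1r sub0r subr0 => /eqP; rewrite oppr_eq0 => /eqP v1 v2.
by have [->|->] := ord2P i.
Qed.

Lemma mirror_of_axis v M : v != 0 -> M \in H -> M *m v = v -> M != 1%:M ->
  exists h, [/\ fsubg G h, h != 1%g & forall q, lineset (direction v) q -> PGL3_act h q = q].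
Proof.
move=> v0 MH Mv M1; have [h Gh lh] := HG MH; exists h; split=> //.
  apply: contraNneq M1 => h1; rewrite h1 in lh.
  have [c [c0 E]] := lifts_eq lh (lifts1 K).
  have E1 : blk M = c%:M.
    have : B *m blk M = c *: B.
      by rewrite -[B *m blk M](mulmxKV Bu) E -scalemxAl mul1mx.
    move=> /(congr1 (mulmx (invmx B))); rewrite mulKmx // -scalemxAr mulVmx //.
    by rewrite scalemx1.
  move: E1; rewrite /blk scalar_mx_block => /eq_block_mx[E1 _ _ ->].
  by move/matrixP/(_ 0 0): E1; rewrite !mxE !mulr1n => <-.
move=> q; rewrite -[q]coordsK; set w := coords q; have w0 : w != 0 := coords_neq0 q.
move=> /(linesetE _ w0) dw; rewrite (lifts_act lh w0); congr proj_pt.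
pose y : 'cV[K]_(1 + 2) := invmx B *m w; have wE : w = B *m y by rewrite mulKVmx.
have dz : direction v *m w = (dt (dsubmx y) v)%:M.
  rewrite wE /direction -mulmxA mulKmx // -{1}[y]vsubmxK mul_row_col mul0mx add0r.
  by apply/matrixP => i j; rewrite !ord1 mxE big_ord2 [RHS]mxE /dt !(mxE, eqxx) /= mulr1n; ring.
have {}dz : dt (dsubmx y) v = 0.
  by move: dz; rewrite dw => /matrixP/(_ 0 0); rewrite !mxE mulr1n.
have Mz x : dt x v = 0 -> M *m x = x.
  move=> dx; have [i vi] := cV0Pn _ v0.
  suff -> : x = (x i 0 / v i 0) *: v by rewrite -scalemxAr Mv.
  apply/colP => j; rewrite mxE; apply: (mulIf vi); rewrite mulrAC divfK //.
  move: dx vi; rewrite /dt; have [->|->] := ord2P i; have [->|->] := ord2P j => // /eqP.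
    by rewrite subr_eq0 => /eqP -> .
  by rewrite subr_eq0 => /eqP ->.
have My : blk M *m y = y.
  rewrite -{1}[y]vsubmxK /blk mul_block_col mul1mx !mul0mx addr0 add0r Mz //.
  exact: vsubmxK.
by rewrite wE -!mulmxA mulKmx // [X in B *m X = _]My.
Qed.

Hypothesis snc_pi : exists u, local_parameters (pi p) u /\
  forall D, prime_divisor D -> branch_coef pi D != 0 -> D (pi p) ->
    exists i, local_equation [set pi p] D (u i).

(** A matrix that fixes an axis gives a collineation that fixes a line
    pointwise, so the quotient branches along the image of this line. By
    normal crossings one of the two local parameters vanishes on this image,
    hence one of the two generators vanishes on the axis. *)
Lemma stabilizer_diagonal_group : exists b1 b2 e1 e2,
  [/\ dt b1 b2 != 0, (0 < e1)%N, (0 < e2)%N & diagonal_group H b1 b2 e1 e2].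
Proof.
have [u [lu snc_u]] := snc_pi.
have [U [R [hU gen]]] := smooth_generators Bu gH HG GH lu.
have [i0 R00 E0] := hU 0; have [i1 R10 E1] := hU 1.
apply: (@snc_quotient_diagonal _ H (size H).+1 (U 0) (U 1) gH _ i0 i1) => //.
  by move=> g; apply: gen.
move=> v v0 big_stab.
have [M [MH Mv M1]] : exists M, [/\ M \in H, M *m v = v & M != 1%:M].
  have [us _ _ _] := stab_group gH v.
  have [/hasP[M MS M1]|] := boolP (has (fun M => M != 1%:M) (stab H v)).
    by have [Mv MH] := stabP _ _ _ MS; exists M.
  move=> /hasPn H1; have sub : {subset stab H v <= [:: 1%:M]}.
    by move=> M /H1; rewrite negbK inE.
  by have := uniq_leq_size us sub; rewrite leqNgt big_stab.
have [h [Gh h1 fixh]] := mirror_of_axis v0 MH Mv M1.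
have a0 := direction_neq0 v0; pose D := pi @` lineset (direction v).
have Lt t : lineset (direction v) (chart B (t *: v)).
  apply/(linesetE _ (chart_neq0 Bu _)); rewrite direction_cc.
  suff -> : dt (t *: v) v = 0 by rewrite raddf0.
  by rewrite /dt !mxE; ring.
have Dp : D (pi p) by exists p => //; have := Lt 0; rewrite scale0r.
have [i loc] := snc_u D (image_prime G a0) (mirror_ramified a0 Gh h1 fixh) Dp.
have irr : irreducible_set [set pi p].
  split; first by exists (pi p).
  by move=> A1 A2 _ _ /(_ _ erefl)[]; [left|right] => _ ->.
have [W [oW [y [Wy Ey]] vW]] := local_equation_vanishes irr loc.
rewrite /= in Ey; rewrite Ey in Wy; have [T [T0 TW]] := open_chart Bu oW Wy.
have [_ Ri0 Ei] := hU i.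
suff vU t : ev (U i) (t *: v) = 0 by move: vU; have [->|->] := ord2P i; [left|right].
have lineE F s : (along 0 v F).[s] = ev F (s *: v) by rewrite horner_along add0r.
have line0 F : ev F 0 != 0 -> along 0 v F != 0.
  by apply: contraNneq => E; have := lineE F 0; rewrite E horner0 scale0r => <-.
have : along 0 v (U i * T * R i) = 0.
  apply: poly_fun0 => s; rewrite lineE !evM; apply/eqP; rewrite !mulf_eq0.
  have [//|Ts] := eqVneq (ev T (s *: v)) 0; first by rewrite orbT.
  have [//|Rs] := eqVneq (ev (R i) (s *: v)) 0; first by rewrite orbT.
  rewrite !orbF; have := Ei _ Rs; rewrite (vW _ (TW _ Ts)) => [/esym/eqP|].
    by rewrite mulf_eq0 invr_eq0 (negPf Rs) orbF.
  by exists (chart B (s *: v)).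
rewrite !alongM => /eqP; rewrite !mulf_eq0 (negPf (line0 _ T0)) (negPf (line0 _ Ri0)) !orbF.
by move=> /eqP U0; rewrite -lineE U0 horner0.
Qed.

Lemma standard_stabilizer_chart : exists B' e1 e2, standard_stabilizer p B' e1 e2.
Proof.
have [b1 [b2 [e1 [e2 [db e10 e20 [diagH Hdiag]]]]]] := stabilizer_diagonal_group.
pose P : 'M[K]_2 := \matrix_(i, j) [:: b1 i 0; b2 i 0]`_j.
have Pu : P \in unitmx.
  by rewrite unitmxE unitfE det2E !mxE /=; move: db; rewrite /dt mulrC [b1 1 0 * _]mulrC [b2 1 0 * _]mulrC.
have PE (M : 'M[K]_2) a b : M *m b1 = a *: b1 /\ M *m b2 = b *: b2 <->
    M *m P = P *m diag_mx (\row_i [:: a; b]`_i).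
  have colPj j : col j P = [:: b1; b2]`_j.
    by apply/colP => i; rewrite !mxE; have [->|->] := ord2P j.
  have colM j : col j (M *m P) = M *m [:: b1; b2]`_j by rewrite !colE -mulmxA -colE colPj.
  have colD j : col j (P *m diag_mx (\row_i [:: a; b]`_i)) = [:: a; b]`_j *: [:: b1; b2]`_j.
    by apply/colP => i; rewrite mul_mx_diag !mxE mulrC; have [->|->] := ord2P j.
  split=> [[E1 E2]|E]; last by rewrite -(colM 0) -(colM 1) E !colD.
  apply/matrixP => i j; have := congr1 (fun A : 'cV[K]_2 => A i 0) (colM j).
  have := congr1 (fun A : 'cV[K]_2 => A i 0) (colD j); rewrite ![col _ _ _ _]mxE => -> ->.
  by have [->|->] := ord2P j; rewrite /= ?E1 ?E2.
pose B' : 'M[K]_3 := B *m blk P.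
have B'u : B' \in unitmx by rewrite unitmx_mul Bu blk_unit.
have torE M a b : M *m P = P *m diag_mx (\row_i [:: a; b]`_i) ->
    B *m blk M *m invmx B = tor B' 1 a b.
  move=> E; apply: (can_inj (mulmxK B'u)); rewrite /tor mulmxKV // /B'.
  rewrite !mulmxA mulmxKV //; rewrite -!mulmxA; congr (_ *m _).
  by rewrite -blk_dg -E; exact: blkM.
have gp M g : lifts (B *m blk M *m invmx B) g -> PGL3_act g p = p.
  by move=> l; rewrite (act_chart Bu 0 l) mulmx0.
exists B', e1, e2; split=> //.
  rewrite -cc0E /B' /chart -mulmxA; congr (proj_pt (_ *m _)).
  by rewrite -[LHS]/(blk P *m cc 0) blk_cc mulmx0.
move=> g; split=> [[Gg /(GH Gg)[M MH l]]|[a [b [a1 b1' l]]]].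
  have [a [b [a1 b1' Ma Mb]]] := diagH M MH; exists a, b; split=> //.
  by rewrite -(torE M) //; apply/PE.
have [M MH /PE E] := Hdiag a b a1 b1'; rewrite -(torE _ _ _ E) in l.
have [g' Gg' l'] := HG MH; have Eg := lifts_inj l l'.
by rewrite {1}Eg; split=> //; apply: gp l.
Qed.

End AtPoint.

(** Linearize the stabilizer of p. The two coordinates on which it acts
    diagonally complete p to a triangle. *)
Theorem snc_standard_stabilizer p :
  (exists u, local_parameters (pi p) u /\
    forall D, prime_divisor D -> branch_coef pi D != 0 -> D (pi p) ->
      exists i, local_equation [set pi p] D (u i)) ->
  exists B e1 e2, standard_stabilizer p B e1 e2.
Proof.
have [B [H [Bu Bp gH HG GH]]] := linearization G p; rewrite -/(chart B 0) in Bp; subst p.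
exact: (standard_stabilizer_chart Bu gH HG GH).
Qed.
End Stabilizers.

(** * Groups whose point stabilizers are products of homologies *)

Section Triangle.
Variables (K : numClosedFieldType) (G : finSubgroup (PGL3 K)).
Implicit Types (A B : 'M[K]_3) (g h : PGL3 K) (a b x y z : K).

Local Opaque PGL3_act proj_pt.

Lemma ord3P (i : 'I_3) : [\/ i = 0, i = 1 | i = 2%:R].
Proof.
by case: i => -[|[|[|//]]] i3; [apply: Or31|apply: Or32|apply: Or33]; apply: val_inj.
Qed.

Lemma dg_mul n x y z (M : 'M[K]_(3, n)) i j : (dg x y z *m M) i j = [:: x; y; z]`_i * M i j.
Proof. by rewrite mul_diag_mx !mxE. Qed.

Lemma mul_dg n x y z (M : 'M[K]_(n, 3)) i j : (M *m dg x y z) i j = M i j * [:: x; y; z]`_j.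
Proof. by rewrite mul_mx_diag !mxE. Qed.

Lemma dgM x y z x' y' z' : dg x y z *m dg x' y' z' = dg (x * x') (y * y') (z * z').
Proof.
apply/matrixP => i j; rewrite dg_mul !mxE mulrnAr.
by have [->|->|->] := ord3P i.
Qed.

Lemma tor1 B : B \in unitmx -> tor B 1 1 1 = 1%:M.
Proof.
move=> Bu; rewrite /tor -[RHS](mulmxV Bu); congr (_ *m _).
rewrite -[RHS]mulmx1; congr (_ *m _).
by apply/matrixP => i j; rewrite !mxE; have [->|->|->] := ord3P i.
Qed.

Lemma torM B x y z x' y' z' : B \in unitmx ->
  tor B x y z *m tor B x' y' z' = tor B (x * x') (y * y') (z * z').
Proof. by move=> Bu; rewrite /tor !mulmxA mulmxKV // -(mulmxA B) dgM. Qed.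

Lemma tor_eigen B x y z i : B \in unitmx ->
  tor B x y z *m (B *m delta_mx i 0) = [:: x; y; z]`_i *: (B *m delta_mx i 0) :> 'cV[K]_3.
Proof.
move=> Bu; rewrite /tor -!mulmxA mulKmx // scalemxAr; congr (_ *m _).
apply/colP => j; rewrite dg_mul !mxE.
by have [->|ji] := eqVneq j i; rewrite ?mulr0.
Qed.

Lemma basis_neq0 B (i : 'I_3) : B \in unitmx -> B *m delta_mx i 0 != 0 :> 'cV[K]_3.
Proof.
move=> Bu; apply: (@GL3_mulv_neq0 _ (exist _ B Bu)).
by apply/cV0Pn; exists i; rewrite mxE !eqxx oner_neq0.
Qed.

Lemma tor_trace B x y z : B \in unitmx -> \tr (tor B x y z) = x + y + z.
Proof.
move=> Bu; rewrite /tor mxtrace_mulC mulKmx // mxtrace_diag !big_ord_recl big_ord0 !mxE /=.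
by rewrite addr0 addrA.
Qed.

Lemma tor_det B x y z : B \in unitmx -> \det (tor B x y z) = x * y * z.
Proof.
move=> Bu; rewrite /tor !det_mulmx mulrAC -det_mulmx mulmxV // det1 mul1r.
by rewrite det_diag !big_ord_recl big_ord0 !mxE /= mulr1 mulrA.
Qed.

Lemma tor_mirror1 B a (w : 'cV[K]_3) : B \in unitmx -> row 1 (invmx B) *m w = 0 :> 'cV[K]_1 ->
  tor B 1 a 1 *m w = w.
Proof.
move=> Bu; rewrite -row_mul => /matrixP/(_ 0 0); rewrite mxE [RHS]mxE => E.
rewrite /tor -!mulmxA -[RHS](mulKVmx Bu); congr (_ *m _).
apply/colP => i; rewrite dg_mul.
by have [->|->|->] := ord3P i; rewrite /= ?mul1r // E mulr0.
Qed.

Lemma tor_mirror2 B a (w : 'cV[K]_3) : B \in unitmx -> row 2%:R (invmx B) *m w = 0 :> 'cV[K]_1 ->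
  tor B 1 1 a *m w = w.
Proof.
move=> Bu; rewrite -row_mul => /matrixP/(_ 0 0); rewrite mxE [RHS]mxE => E.
rewrite /tor -!mulmxA -[RHS](mulKVmx Bu); congr (_ *m _).
apply/colP => i; rewrite dg_mul.
by have [->|->|->] := ord3P i; rewrite /= ?mul1r // E mulr0.
Qed.

Lemma lines_meet (a b : 'rV[K]_3) : exists w : 'cV[K]_3, [/\ w != 0, a *m w = 0 & b *m w = 0].
Proof.
pose M : 'M[K]_(3, 2) := (col_mx a b : 'M[K]_(1 + 1, 3))^T.
have k0 : kermx M != 0.
  rewrite -mxrank_eq0 mxrank_ker subn_eq0 -ltnNge.
  by apply: leq_ltn_trans (rank_leq_col M) _.
have E := sub_kermxP (nz_row_sub (kermx M)); exists (nz_row (kermx M))^T.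
have: col_mx a b *m (nz_row (kermx M))^T = col_mx 0 0.
  rewrite col_mx0 -[LHS]trmxK trmx_mul trmxK -[X in _ *m X]/M E.
  exact: trmx0.
rewrite mul_col_mx.
by move=> /eq_col_mx[-> ->]; rewrite trmx_eq0 nz_row_eq0.
Qed.

Lemma nontrivial_root e : (1 < e)%N -> exists2 z : K, z ^+ e = 1 & z != 1.
Proof.
move=> e1; pose p : {poly K} := \poly_(i < e) 1.
have sp : size p = e by rewrite size_poly_eq // oner_neq0.
have /closed_rootP[z /rootP pz] : size p != 1%N by rewrite sp; case: (e) e1 => [|[]].
move: pz; rewrite horner_poly (eq_bigr (fun i : 'I_e => z ^+ i)) => [pz|i _]; last exact: mul1r.
exists z; first by apply/eqP; rewrite -subr_eq0 subrX1 pz mulr0.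
apply: contra_eq_neq pz => ->; rewrite (eq_bigr (fun=> 1)) => [|i _]; last exact: expr1n.
by rewrite sumr_const card_ord pnatr_eq0; case: (e) e1.
Qed.

Lemma standard_stabilizer_sym p B e1 e2 : standard_stabilizer G p B e1 e2 ->
  standard_stabilizer G p (B *m tperm_mx 1 2%:R) e2 e1.
Proof.
move=> [Bu Bp [e10 e20] stab]; set S := tperm_mx _ _.
have Su : S \in unitmx by exact: unitmx_perm.
have BSu : B *m S \in unitmx by rewrite unitmx_mul Bu.
have sdg x y z : S *m dg x z y = dg x y z *m S.
  apply/matrixP => i j; rewrite mul_dg dg_mul !mxE.
  have [<-|ne] := eqVneq (tperm 1 2%:R i) j; last by rewrite mul0r mulr0.
  rewrite mulrC; congr (_ * _); have [->|->|->] := ord3P i; last by rewrite tpermR.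
    by rewrite tpermD.
  by rewrite tpermL.
have E x y z : tor (B *m S) x z y = tor B x y z.
  apply: (can_inj (mulmxK BSu)); rewrite /tor mulmxKV // !mulmxA mulmxKV //.
  by rewrite -mulmxA sdg mulmxA.
split=> //.
  rewrite -mulmxA -Bp; congr (proj_pt (_ *m _)); apply/colP => i.
  rewrite -colE !mxE eqxx andbT; have [->|->|->] := ord3P i; rewrite ?tpermL ?tpermR ?tpermD //.
move=> g; split=> [/stab[a [b [a1 b1 l]]]|[b [a [b1 a1]]]].
  by exists b, a; rewrite E.
by rewrite E => l; apply/stab; exists a, b.
Qed.

Hypothesis all_standard : forall p, exists B e1 e2, standard_stabilizer G p B e1 e2.

Lemma stabilizer_comm g h r : fsubg G g -> fsubg G h -> PGL3_act g r = r ->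
  PGL3_act h r = r -> (g * h)%g = (h * g)%g.
Proof.
move=> Gg Gh gr hr; have [B [e1 [e2 [Bu _ _ stab]]]] := all_standard r.
have [a [b [_ _ lg]]] := (stab g).1 (conj Gg gr).
have [a' [b' [_ _ lh]]] := (stab h).1 (conj Gh hr).
apply: (lifts_inj (lifts_mul lg lh)); have := lifts_mul lh lg.
by rewrite !torM // [a' * a]mulrC [b' * b]mulrC.
Qed.

(** The two mirrors meet, and the stabilizer of a common point r is
    commutative. So the lifts commute up to a scalar, which is one because
    both fix a vector over r. *)
Lemma homologies_commute A A' (a a' : 'rV[K]_3) g g' : fsubg G g -> fsubg G g' ->
  lifts A g -> lifts A' g' ->
  (forall w : 'cV[K]_3, a *m w = 0 -> A *m w = w) ->
  (forall w : 'cV[K]_3, a' *m w = 0 -> A' *m w = w) -> A *m A' = A' *m A.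
Proof.
move=> Gg Gg' l l' fixA fixA'; have [w [w0 /fixA Aw /fixA' A'w]] := lines_meet a a'.
have E : (g * g' = g' * g)%g.
  by apply: (@stabilizer_comm _ _ (proj_pt w)) => //;
    [rewrite (lifts_act l w0) Aw|rewrite (lifts_act l' w0) A'w].
have l1 := lifts_mul l' l; rewrite -E in l1.
have [c [c0 Ec]] := lifts_eq (lifts_mul l l') l1.
have : c *: w = w.
  by have := congr1 (fun M => M *m w) Ec; rewrite -scalemxAl -!mulmxA Aw A'w Aw.
move/eqP; rewrite -{2}[w]scale1r -subr_eq0 -scalerBl scaler_eq0 (negPf w0) orbF subr_eq0.
by move=> /eqP c1; rewrite Ec c1 scale1r.
Qed.

Definition full_stabilizer p B e1 e2 :=
  standard_stabilizer G p B e1 e2 /\ ((1 < e1)%N /\ (1 < e2)%N).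

(** An element of the stabilizer of p' is a product of two homologies. Each of
    them commutes with homologies of both kinds in the stabilizer of p, hence
    fixes p, where the mirrors of the latter meet. *)
Lemma full_stabilizer_sub p B e1 e2 p' B' f1 f2 g :
  full_stabilizer p B e1 e2 -> full_stabilizer p' B' f1 f2 ->
  fsubg G g -> PGL3_act g p' = p' -> PGL3_act g p = p.
Proof.
move=> [[Bu Bp _ stab] [e1_gt e2_gt]] [[B'u B'p _ stab'] [f1_gt f2_gt]] Gg gp'.
have [z ze z1] := nontrivial_root e1_gt; have [y ye y1] := nontrivial_root e2_gt.
have [h [Gh lh]] : exists h, fsubg G h /\ lifts (tor B 1 z 1) h.
  have Tu : tor B 1 z 1 \in unitmx.
    rewrite unitmxE unitfE tor_det // mul1r mulr1; apply: contra_eq_neq ze => ->.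
    by rewrite expr0n; case: (e1) e1_gt => //= k _; rewrite eq_sym oner_eq0.
  have [h lh] := lifts_exists Tu; exists h; split=> //.
  by have [] := (stab h).2 (ex_intro _ z (ex_intro _ 1 (And3 ze (expr1n _ _) lh))).
have [k [Gk lk]] : exists h, fsubg G h /\ lifts (tor B 1 1 y) h.
  have Tu : tor B 1 1 y \in unitmx.
    rewrite unitmxE unitfE tor_det // !mul1r; apply: contra_eq_neq ye => ->.
    by rewrite expr0n; case: (e2) e2_gt => //= j _; rewrite eq_sym oner_eq0.
  have [h' lh'] := lifts_exists Tu; exists h'; split=> //.
  by have [] := (stab h').2 (ex_intro _ 1 (ex_intro _ y (And3 (expr1n _ _) ye lh'))).
have core A (a : 'rV[K]_3) h' : fsubg G h' -> lifts A h' ->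
    (forall w : 'cV[K]_3, a *m w = 0 -> A *m w = w) -> PGL3_act h' p = p.
  move=> Gh' l' fixA; pose M := invmx B *m A *m B.
  have conjE D : tor B D.1.1 D.1.2 D.2 *m A = A *m tor B D.1.1 D.1.2 D.2 ->
      dg D.1.1 D.1.2 D.2 *m M = M *m dg D.1.1 D.1.2 D.2.
    move=> E; have := congr1 (fun X => invmx B *m X *m B) E.
    by rewrite /M /tor !mulmxA mulVmx // mul1mx !mulmxKV.
  have M10 : M 1 0 = 0.
    have := conjE (1, z, 1) (homologies_commute Gh Gh' lh l' (fun w => @tor_mirror1 B z w Bu) fixA).
    move/matrixP/(_ 1 0); rewrite dg_mul mul_dg /= mulr1 => /eqP.
    by rewrite -subr_eq0 -{2}[M 1 0]mul1r -mulrBl mulf_eq0 subr_eq0 (negPf z1) => /eqP.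
  have M20 : M 2%:R 0 = 0.
    have := conjE (1, 1, y) (homologies_commute Gk Gh' lk l' (fun w => @tor_mirror2 B y w Bu) fixA).
    move/matrixP/(_ 2%:R 0); rewrite dg_mul mul_dg /= mulr1 => /eqP.
    by rewrite -subr_eq0 -{2}[M 2%:R 0]mul1r -mulrBl mulf_eq0 subr_eq0 (negPf y1) => /eqP.
  have Me : M *m delta_mx 0 0 = M 0 0 *: delta_mx 0 0 :> 'cV[K]_3.
    apply/colP => i; rewrite -colE [LHS]mxE [RHS]mxE [delta_mx _ _ _ _]mxE eqxx andbT.
    by have [->|->|->] := ord3P i; rewrite ?M10 ?M20 /= ?mulr0 ?mulr1.
  have AB : A *m (B *m delta_mx 0 0) = M 0 0 *: (B *m delta_mx 0 0) :> 'cV[K]_3.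
    by rewrite scalemxAr -Me /M !mulmxA mulmxV // mul1mx.
  have v0 := basis_neq0 0 Bu.
  have M0 : M 0 0 != 0.
    apply: contraTneq (@GL3_mulv_neq0 _ (exist _ A (lifts_unit l')) _ v0) => M0.
    by rewrite [val _]/= AB M0 scale0r eqxx.
  by rewrite -Bp (lifts_act l' v0) AB proj_ptZ.
have [a [b [a1 b1 l]]] := (stab' g).1 (conj Gg gp').
have unit_root (x : K) e : (1 < e)%N -> x ^+ e = 1 -> x != 0.
  move=> e0; apply: contra_eq_neq => ->; rewrite expr0n.
  by case: (e) e0 => //= j _; rewrite eq_sym oner_eq0.
have Tu : tor B' 1 a 1 \in unitmx.
  by rewrite unitmxE unitfE tor_det // mul1r mulr1; exact: unit_root a1.
have Tu' : tor B' 1 1 b \in unitmx.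
  by rewrite unitmxE unitfE tor_det // !mul1r; exact: unit_root b1.
have [r lr] := lifts_exists Tu; have [s ls] := lifts_exists Tu'.
have [Gr _] := (stab' r).2 (ex_intro _ a (ex_intro _ 1 (And3 a1 (expr1n _ _) lr))).
have [Gs _] := (stab' s).2 (ex_intro _ 1 (ex_intro _ b (And3 (expr1n _ _) b1 ls))).
have -> : g = (r * s)%g.
  apply: (lifts_inj l); have := lifts_mul lr ls; rewrite torM //.
  by rewrite !mulr1 !mul1r.
rewrite PGL3_actM (core _ _ _ Gs ls (fun w => @tor_mirror2 B' b w B'u)).
exact: core Gr lr (fun w => @tor_mirror1 B' a w B'u).
Qed.

Lemma tor_proportional B B' x y z x' y' z' c : B \in unitmx -> B' \in unitmx ->
  tor B x y z = c *: tor B' x' y' z' ->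
  x + y + z = c * (x' + y' + z') /\ x * y * z = c ^+ 3 * (x' * y' * z').
Proof.
move=> Bu B'u E; split.
  by rewrite -(tor_trace x y z Bu) E mxtraceZ tor_trace.
by rewrite -(tor_det x y z Bu) E detZ tor_det.
Qed.

Lemma tor_at_axis B B' x y s t c : B \in unitmx -> B' \in unitmx ->
  proj_pt (B' *m delta_mx 0 0) = proj_pt (B *m delta_mx 1 0) ->
  tor B' 1 x y = c *: tor B 1 s t -> c * s = 1.
Proof.
move=> Bu B'u Eq E; have v0 := basis_neq0 1 Bu.
have [k [k0 Ek]] := proj_pt_eq (basis_neq0 0 B'u) v0 Eq.
have := tor_eigen 1 x y 0 B'u; rewrite /= scale1r Ek E -scalemxAl -scalemxAr.
rewrite tor_eigen // !scalerA /= => /eqP; rewrite -subr_eq0 -scalerBl scaler_eq0 (negPf v0) orbF.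
by rewrite mulrAC -{2}[k]mul1r -mulrBl mulf_eq0 (negPf k0) orbF subr_eq0 => /eqP.
Qed.

Lemma fixes_eigenvector g A (v : 'cV[K]_3) k : v != 0 -> lifts A g ->
  A *m v = k *: v -> PGL3_act g (proj_pt v) = proj_pt v.
Proof.
move=> v0 l Av; have k0 : k != 0.
  apply: contraTneq (@GL3_mulv_neq0 _ (exist _ A (lifts_unit l)) _ v0) => k0.
  by rewrite [val _]/= Av k0 scale0r eqxx.
by rewrite (lifts_act l v0) Av proj_ptZ.
Qed.

Lemma has_fixed_point g : exists p, PGL3_act g p = p.
Proof.
have [c /eigenvalueP[v vA v0]] := eigenvalue_closed (val (repr g))^T (ltn0Sn 2).
have vT0 : v^T != 0 by rewrite trmx_eq0.
exists (proj_pt v^T); apply: (fixes_eigenvector vT0 (lifts_repr g)).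
by apply: trmx_inj; rewrite trmx_mul trmxK vA linearZ /= trmxK.
Qed.

(** If e2 = 1, then g is a homology; its center v1 is the second vertex of the
    triangle at p, and g acts as a nontrivial scalar on the tangent space at
    v1. Hence both factors of the stabilizer of v1 are nontrivial. *)
Lemma in_full_stabilizer_of_homology g p B e1 e2 : standard_stabilizer G p B e1 e2 ->
  (1 < e1)%N -> fsubg G g -> PGL3_act g p = p -> g != 1%g ->
  exists p' B' f1 f2, full_stabilizer p' B' f1 f2 /\ PGL3_act g p' = p'.
Proof.
move=> sp e1_gt Gg gp g1; have [Bu Bp [_ e2_gt0] stab] := sp.
have [e2_gt|] := ltnP 1 e2; first by exists p, B, e1, e2.
move=> e2_le; have e2E : e2 = 1%N by apply/eqP; rewrite eqn_leq e2_le e2_gt0.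
have [a [b [_ b1 l]]] := (stab g).1 (conj Gg gp).
rewrite e2E expr1 in b1; rewrite {}b1 in l.
have a1 : a != 1.
  apply: contraNneq g1 => a1; rewrite a1 in l; apply/eqP.
  by apply: lifts_inj l _; rewrite tor1 //; exact: lifts1.
pose v := B *m delta_mx 1 0 : 'cV[K]_3; have v0 : v != 0 := basis_neq0 1 Bu.
have gv : PGL3_act g (proj_pt v) = proj_pt v := fixes_eigenvector v0 l (tor_eigen 1 a 1 1 Bu).
have [B' [f1 [f2 sv]]] := all_standard (proj_pt v).
have [B'u B'v [f1_gt0 f2_gt0] stab'] := sv.
have [x [y [x1 y1 l']]] := (stab' g).1 (conj Gg gv).
exists (proj_pt v), B', f1, f2; split=> //; split=> //.
have [c [c0 E]] := lifts_eq l' l.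
have ca : c * a = 1 := tor_at_axis Bu B'u B'v E.
have [tE dE] := tor_proportional B'u Bu E.
have c1 : c != 1 by apply: contraNneq a1 => c1; rewrite -ca c1 mul1r.
have xy : x + y = c + c.
  by apply: (addrI 1); rewrite addrA tE !mulrDr ca !mulr1 -addrA addrCA.
have xy2 : x * y = c * c by move: dE; rewrite !mul1r mulr1 => ->; rewrite -[RHS]mulr1 -ca; ring.
have xc : x = c.
  have : (x - c) ^+ 2 = 0.
    have -> : (x - c) ^+ 2 = x * (x + y) - x * y - (x + x) * c + c * c by ring.
    by rewrite xy xy2; ring.
  by move/eqP; rewrite expf_eq0 /= subr_eq0 => /eqP.
have yc : y = c by apply: (addrI x); rewrite xy xc.
have big f z : (0 < f)%N -> z ^+ f = 1 -> z != 1 -> (1 < f)%N.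
  by case: f => [|[|]] // _; rewrite expr1 => ->; rewrite eqxx.
by split; [apply: (big f1 x) => //; rewrite xc|apply: (big f2 y) => //; rewrite yc].
Qed.

Lemma in_full_stabilizer g : fsubg G g -> g != 1%g ->
  exists p B e1 e2, full_stabilizer p B e1 e2 /\ PGL3_act g p = p.
Proof.
move=> Gg g1; have [p gp] := has_fixed_point g.
have [B [e1 [e2 sp]]] := all_standard p; have [Bu Bp [e10 e20] stab] := sp.
have [e1_gt|e1_le] := ltnP 1 e1; first exact: in_full_stabilizer_of_homology sp e1_gt Gg gp g1.
have [e2_gt|e2_le] := ltnP 1 e2.
  exact: in_full_stabilizer_of_homology (standard_stabilizer_sym sp) e2_gt Gg gp g1.
have [a [b [a1 b1 l]]] := (stab g).1 (conj Gg gp).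
have E1 : e1 = 1%N by apply/eqP; rewrite eqn_leq e1_le e10.
have E2 : e2 = 1%N by apply/eqP; rewrite eqn_leq e2_le e20.
move: a1 b1 l; rewrite E1 E2 !expr1 => -> -> l; exfalso; move/eqP: g1; apply.
by apply: lifts_inj l _; rewrite tor1 //; exact: lifts1.
Qed.

(** If G fixes p, then it also fixes the other vertices of its triangle. At
    the second vertex, the homology with center this vertex is a product of
    two elements of G, by the form of the stabilizer there; one of the two
    belongs to the second factor at p. *)
Lemma first_order_divides p B c d a : standard_stabilizer G p B c d ->
  (forall g, fsubg G g -> PGL3_act g p = p) -> a ^+ c = 1 -> a ^+ d = 1.
Proof.
move=> [Bu Bp [c0 d0] stab] fixp ac.
have [->|a1] := eqVneq a 1; first exact: expr1n.
have a0 : a != 0.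
  by apply: contra_eq_neq ac => ->; rewrite expr0n; case: (c) c0 => //= j _; rewrite eq_sym oner_eq0.
pose v := B *m delta_mx 1 0 : 'cV[K]_3; have v0 : v != 0 := basis_neq0 1 Bu.
have fixv g : fsubg G g -> PGL3_act g (proj_pt v) = proj_pt v.
  move=> Gg; have [x [y [_ _ l]]] := (stab g).1 (conj Gg (fixp g Gg)).
  exact: fixes_eigenvector v0 l (tor_eigen 1 x y 1 Bu).
have [B' [f1 [f2 [B'u B'v [f10 f20] stab']]]] := all_standard (proj_pt v).
have Tu : tor B 1 a 1 \in unitmx by rewrite unitmxE unitfE tor_det // mul1r mulr1.
have [g l] := lifts_exists Tu.
have [Gg _] := (stab g).2 (ex_intro _ a (ex_intro _ 1 (And3 ac (expr1n _ _) l))).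
have [x [y [xf yf l']]] := (stab' g).1 (conj Gg (fixv g Gg)).
have [k [k0 E]] := lifts_eq l' l.
have ka : k * a = 1 := tor_at_axis Bu B'u B'v E.
have [tE dE] := tor_proportional B'u Bu E.
have xy : x + y = k + k.
  by apply: (addrI 1); rewrite addrA tE !mulrDr ka !mulr1 -addrA addrCA.
have xy2 : x * y = k * k by move: dE; rewrite !mul1r mulr1 => ->; rewrite -[RHS]mulr1 -ka; ring.
have xk : x = k.
  have : (x - k) ^+ 2 = 0.
    have -> : (x - k) ^+ 2 = x * (x + y) - x * y - (x + x) * k + k * k by ring.
    by rewrite xy xy2; ring.
  by move/eqP; rewrite expf_eq0 /= subr_eq0 => /eqP.
(* Both entries of g at the second vertex are equal to k; the element of G
   that has only the first one is a homology in the basis B as well. *)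
have T'u : tor B' 1 x 1 \in unitmx.
  by rewrite unitmxE unitfE tor_det // mul1r mulr1 xk.
have [h lh] := lifts_exists T'u.
have [Gh _] := (stab' h).2 (ex_intro _ x (ex_intro _ 1 (And3 xf (expr1n _ _) lh))).
have [s [t [sc td lst]]] := (stab h).1 (conj Gh (fixp h Gh)).
have [r [r0 Er]] := lifts_eq lh lst.
have rs : r * s = 1 := tor_at_axis Bu B'u B'v Er.
have [tE' dE'] := tor_proportional B'u Bu Er.
have ax : a * x = 1 by rewrite xk mulrC.
have sumE : r + r * t = 1 + x.
  by apply: (addIr 1); rewrite tE' !mulrDr rs mulr1 [RHS]addrAC.
have prodE : r * (r * t) = x.
  move: dE'; have -> : r ^+ 3 * (1 * s * t) = r * (r * t) * (r * s) by ring.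
  by rewrite rs !mulr1 mul1r.
have : (r - 1) * (r - x) = 0.
  have -> : (r - 1) * (r - x) = r * r - (1 + x) * r + x by ring.
  by rewrite -sumE -prodE; ring.
move/eqP; rewrite mulf_eq0 !subr_eq0 => /orP[/eqP r1|/eqP rx].
  move: prodE; rewrite r1 !mul1r => tx.
  by have := expr1n K d; rewrite -{1}ax exprMn -tx td mulr1.
have rt : r * t = 1 by apply: (addrI r); rewrite sumE rx addrC.
suff -> : a = t by [].
by apply: (mulfI r0); rewrite rt rx mulrC.
Qed.

(** If G is not trivial, every element of G lies in the stabilizer of a point
    whose two factors are nontrivial. All these stabilizers coincide, so G is
    one of them, and its two factors have the same order. *)
Theorem diagonal_subgroup : exists B m, [/\ B \in unitmx, (0 < m)%N &
  forall g, fsubg G g <->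
    exists a b, [/\ a ^+ m = 1, b ^+ m = 1 & lifts (tor B 1 a b) g]].
Proof.
have [[g0 [Gg0 g01]]|triv] := pselect (exists g, fsubg G g /\ g != 1%g); last first.
  exists 1%:M, 1%N; split=> //; first exact: unitmx1.
  have T1 : tor 1%:M 1 1 1 = 1%:M :> 'M[K]_3 := tor1 (unitmx1 K 3).
  move=> g; split=> [Gg|[a [b]]].
    have -> : g = 1%g by apply/eqP/negPn/negP => g1; apply: triv; exists g.
    by exists 1, 1; rewrite expr1 T1; split=> //; exact: lifts1.
  by rewrite !expr1 => -[-> ->]; rewrite T1 => l; rewrite (lifts_inj l (lifts1 K)); exact: fsubg1.
have [p [B [c [d [fp _]]]]] := in_full_stabilizer Gg0 g01.
have fixp g : fsubg G g -> PGL3_act g p = p.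
  move=> Gg; have [->|g1] := eqVneq g 1%g; first exact: PGL3_act1.
  have [p' [B' [c' [d' [fp' gp']]]]] := in_full_stabilizer Gg g1.
  exact: full_stabilizer_sub fp fp' Gg gp'.
have [sp _] := fp; have [Bu Bp [c0 d0] stab] := sp.
have cd := first_order_divides sp fixp.
have dc := first_order_divides (standard_stabilizer_sym sp) fixp.
exists B, c; split=> // g; split=> [Gg|[a [b [ac bc l]]]].
  have [a [b [ac bd l]]] := (stab g).1 (conj Gg (fixp g Gg)).
  by exists a, b; split=> //; apply: dc.
by have [] := (stab g).2 (ex_intro _ a (ex_intro _ b (And3 ac (cd b bc) l))).
Qed.

End Triangle.

(** * The power map *)

Section PowerForms.
Variables (K : numClosedFieldType) (m : nat).
Hypothesis m0 : (0 < m)%N.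
Implicit Types (F Q : {mpoly K[3]}) (x y w : 'cV[K]_3).

Lemma primitive_root_exists : exists z : K, m.-primitive_root z.
Proof.
pose p : {poly K} := 'X^m - 1; have [r Er] := closed_field_poly_normal p.
have mp : p \is monic by apply: monicXnsubC.
rewrite (monicP mp) scale1r in Er.
have us : uniq r.
  by rewrite -separable_prod_XsubC -Er separable_Xn_sub_1 // pnatr_eq0 -lt0n.
have ar : all m.-unity_root r.
  apply/allP => z zr; have : root p z by rewrite Er root_prod_XsubC.
  by rewrite /root !hornerE => pz; rewrite unity_rootE -subr_eq0.
have sr : (m <= size r)%N.
  have := congr1 (fun q : {poly K} => size q) Er.
  by rewrite size_prod_XsubC size_XnsubC // => -[->].
by have /hasP[z _ pz] := has_prim_root m0 ar us sr; exists z.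
Qed.

Definition pw x : 'cV[K]_3 := \col_i x i 0 ^+ m.

Definition pwsub F : {mpoly K[3]} := psub (fun i => 'X_i ^+ m) F.

Lemma ev_pwsub F x : ev (pwsub F) x = ev F (pw x).
Proof.
by rewrite ev_psub; congr (ev F _); apply/colP => i; rewrite !mxE evXn evX.
Qed.

Lemma ev_pull (A : 'M[K]_3) F x : ev (lsub A (pwsub F)) x = ev F (pw (A *m x)).
Proof. exact: etrans (ev_lsub A (pwsub F) x) (ev_pwsub F (A *m x)). Qed.

Lemma pwsub_homog F d : F \is d.-homog -> pwsub F \is (m * d).-homog.
Proof.
move=> hF; apply: psub_homog => // i.
by rewrite -[X in X.-homog]mul1n; apply: dhomogMn; rewrite dhomogX /= mdeg1.
Qed.

Lemma pw_neq0 x : x != 0 -> pw x != 0.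
Proof.
move=> /cV0Pn[i xi]; apply/cV0Pn; exists i.
by rewrite mxE expf_neq0.
Qed.

Lemma pwZ c x : pw (c *: x) = c ^+ m *: pw x.
Proof. by apply/colP => i; rewrite !mxE exprMn. Qed.

Lemma pw_surj w : exists x, pw x = w.
Proof.
by exists (\col_i m.-root (w i 0)); apply/colP => i; rewrite !mxE rootCK.
Qed.

Variable z : K.
Hypothesis pz : m.-primitive_root z.

Definition sc (i : 'I_3) c : 'M[K]_3 := diag_mx (\row_j if j == i then c else 1).

Lemma sc_mul i c x j : (sc i c *m x) j 0 = (if j == i then c else 1) * x j 0.
Proof. by rewrite mul_diag_mx !mxE. Qed.

Lemma sc_comm i j c d x : sc i c *m (sc j d *m x) = sc j d *m (sc i c *m x).
Proof. by apply/colP => k; rewrite !sc_mul mulrCA. Qed.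

Lemma scM i c d x : sc i c *m (sc i d *m x) = sc i (c * d) *m x.
Proof. by apply/colP => k; rewrite !sc_mul mulrA; case: eqP; rewrite ?mul1r. Qed.

Lemma sc1 i x : sc i 1 *m x = x.
Proof. by apply/colP => k; rewrite sc_mul; case: eqP; rewrite mul1r. Qed.

Lemma sc_neq0 i c x : c != 0 -> x != 0 -> sc i c *m x != 0.
Proof.
move=> c0 /cV0Pn[j xj]; apply/cV0Pn; exists j.
by rewrite sc_mul mulf_neq0 //; case: ifP => _ //; exact: oner_neq0.
Qed.

Lemma pw_sc i c x : c ^+ m = 1 -> pw (sc i c *m x) = pw x.
Proof.
move=> c1; apply/colP => j; rewrite [LHS]mxE [RHS]mxE sc_mul exprMn.
by case: eqP; rewrite ?c1 ?expr1n mul1r.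
Qed.

Lemma zX k : (z ^+ k) ^+ m = 1.
Proof. by rewrite exprAC (prim_expr_order pz) expr1n. Qed.

Lemma zX_neq0 k : z ^+ k != 0.
Proof. by rewrite expf_neq0 // (prim_root_eq0 pz) -lt0n. Qed.

(** The projection of a form onto a weight space of the group of m-th roots of
    unity that acts on the i-th coordinate. *)
Definition weight i a F : {mpoly K[3]} :=
  \sum_(k < m) z ^+ (a * k) *: lsub (sc i (z ^+ k)) F.

Lemma ev_weight i a F x :
  ev (weight i a F) x = \sum_(k < m) z ^+ (a * k) * ev F (sc i (z ^+ k) *m x).
Proof. by rewrite ev_sum; apply: eq_bigr => k _; rewrite evZ ev_lsub. Qed.

Lemma weight_homog i a F d : F \is d.-homog -> weight i a F \is d.-homog.
Proof. by move=> hF; apply: rpred_sum => k _; apply/rpredZ/lsub_homog. Qed.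

Lemma weight_sc i a F x : z ^+ a * ev (weight i a F) (sc i z *m x) = ev (weight i a F) x.
Proof.
rewrite !ev_weight mulr_sumr.
pose h k := z ^+ (a * k) * ev F (sc i (z ^+ k) *m x).
rewrite (eq_bigr (fun k : 'I_m => h k.+1)) => [|k _]; last first.
  by rewrite /h scM mulrA -exprD mulnS -exprSr.
rewrite -[RHS]/(\sum_(k < m) h k).
have hm : h m = h 0%N.
  by rewrite /h muln0 expr0 (mulnC a) exprM (prim_expr_order pz) expr1n.
apply: (addrI (h 0%N)); transitivity (\sum_(k < m.+1) h k).
  by rewrite big_ord_recl.
by rewrite big_ord_recr /= hm addrC.
Qed.

(** The weight components add up to m times the form. *)
Lemma weight_nonzero i F x : ev F x != 0 -> exists a, ev (weight i a F) x != 0.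
Proof.
move=> Fx; apply: contrapT => /forallNP none.
have : \sum_(a < m) ev (weight i a F) x = 0.
  by apply: big1 => a _; apply/eqP/negPn/negP/none.
rewrite (eq_bigr (fun a : 'I_m => \sum_(k < m) z ^+ (a * k) * ev F (sc i (z ^+ k) *m x)))
  => [|a _]; last exact: ev_weight.
rewrite exchange_big /=.
rewrite (bigD1 (Ordinal m0)) //= [X in _ + X]big1 ?addr0 => [|k k0]; last first.
  rewrite -mulr_suml (eq_bigr (fun a : 'I_m => (z ^+ k) ^+ a)) => [|a _]; last first.
    by rewrite -exprM mulnC.
  have zk : z ^+ k - 1 != 0.
    rewrite subr_eq0 -(prim_order_dvd pz) gtnNdvd ?ltn_ord // lt0n.
    by apply: contra k0 => /eqP k0; apply/eqP/val_inj.
  have E : \sum_(a < m) (z ^+ k) ^+ a = 0.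
    by apply: (mulfI zk); rewrite -subrX1 zX subrr mulr0.
  by rewrite E mul0r.
rewrite expr0 sc1 (eq_bigr (fun=> ev F x)) => [|a _]; last by rewrite muln0 mul1r.
rewrite sumr_const card_ord => /eqP; rewrite mulrn_eq0 (negPf Fx) orbF.
by rewrite eqn0Ngt m0.
Qed.

Definition sc_inv i F := forall x, ev F (sc i z *m x) = ev F x.

Lemma weight_inv i j a F : sc_inv j F -> sc_inv j (weight i a F).
Proof.
by move=> iF x; rewrite !ev_weight; apply: eq_bigr => k _; rewrite sc_comm iF.
Qed.

(** Comparing coefficients after scaling one coordinate by a primitive root of
    unity shows that its exponents are divisible by m. *)
Lemma pwsub_invariant F d : F \is d.-homog -> (forall i, sc_inv i F) ->
  exists F', F' \is (d %/ m).-homog /\ F = pwsub F'.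
Proof.
move=> hF iF.
have dvd k i : k \in msupp F -> (m %| k i)%N.
  move=> kF; pose F1 := \sum_(k <- msupp F) (F@_k * z ^+ (k i)) *: 'X_[k].
  have EF : F1 = F.
    apply: ev_inj => x; rewrite -(iF i x) ev_sum [RHS]/ev mevalE.
    apply: eq_bigr => l _; rewrite evZ /ev mevalX -mulrA; congr (_ * _).
    rewrite (bigD1 i) //= [in RHS](bigD1 i) //= sc_mul eqxx exprMn -mulrA.
    congr (_ * (_ * _)); apply: eq_bigr => j ji.
    by rewrite sc_mul (negPf ji) mul1r.
  have := congr1 (mcoeff k) EF; rewrite /F1 raddf_sum /= (bigD1_seq k) ?msupp_uniq //=.
  rewrite mcoeffZ mcoeffX eqxx mulr1 big1 ?addr0 => [|l lk]; last first.
    by rewrite mcoeffZ mcoeffX (negPf lk) mulr0.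
  move/eqP; rewrite -subr_eq0 -{2}[F@_k]mulr1 -mulrBr mulf_eq0 mcoeff_eq0 kF /=.
  by rewrite subr_eq0 -(prim_order_dvd pz).
pose q (k : 'X_{1..3}) : 'X_{1..3} := [multinom (k i %/ m)%N | i < 3].
exists (\sum_(k <- msupp F) F@_k *: 'X_[q k]); split.
  rewrite big_seq; apply: rpred_sum => k kF; apply: rpredZ.
  rewrite dhomogX /= -(dhomog_mf hF kF) /= !mdegE.
  rewrite [X in _ == X](_ : _ = (\sum_(i < 3) (k i %/ m) * m) %/ m)%N.
    by rewrite -big_distrl mulnK //; apply/eqP/eq_bigr => i _; rewrite mnmE.
  by congr (_ %/ _)%N; apply: eq_bigr => i _; rewrite divnK // dvd.
apply: ev_inj => x; rewrite ev_pwsub ev_sum [LHS]/ev mevalE big_seq [RHS]big_seq.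
apply: eq_bigr => k kF; rewrite evZ /ev mevalX; congr (_ * _); apply: eq_bigr => i _.
by rewrite mxE mnmE -exprM mulnC divnK // dvd.
Qed.

(** Some weight component of the denominator does not vanish at y; its m-th
    power is an invariant denominator. The weight components of the numerator
    and of the denominator are still in the ratio f because f is invariant. *)
Lemma weight_fraction i d F Q y (U : 'cV[K]_3 -> Prop) (f : 'cV[K]_3 -> K) :
  F \is d.-homog -> Q \is d.-homog -> y != 0 -> ev Q y != 0 ->
  (forall x, x != 0 -> ev Q x != 0 -> U (pw x)) ->
  (forall x, x != 0 -> U (pw x) -> f (pw x) * ev Q x = ev F x) ->
  exists d' F' Q', [/\ F' \is d'.-homog, Q' \is d'.-homog, ev Q' y != 0,
    [/\ (forall x, x != 0 -> ev Q' x != 0 -> U (pw x)),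
     (forall x, x != 0 -> U (pw x) -> f (pw x) * ev Q' x = ev F' x),
     sc_inv i F' & sc_inv i Q'] &
    forall j, sc_inv j F -> sc_inv j Q -> sc_inv j F' /\ sc_inv j Q'].
Proof.
move=> hF hQ y0 Qy HQ HF; have [a Qa] := weight_nonzero i Qy.
have wF := weight_homog i a hF; have wQ := weight_homog i a hQ.
have sat k x : pw (sc i (z ^+ k) *m x) = pw x by rewrite pw_sc ?zX.
have mE : m = m.-1.+1 by rewrite prednK.
exists (d * m)%N, (weight i a F * weight i a Q ^+ m.-1), (weight i a Q ^+ m).
have inv1 x : z ^+ a * ev (weight i a Q) (sc i z *m x) = ev (weight i a Q) x := weight_sc i a Q x.
have za : (z ^+ a) ^+ m = 1 := zX a.
split.
- by rewrite [X in X.-homog](_ : _ = d + d * m.-1)%N; [apply/dhomogM/dhomogMn|rewrite -mulnS -mE].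
- exact: dhomogMn.
- by rewrite evXn expf_neq0.
- split.
  + move=> x x0; rewrite evXn expf_eq0 m0 /= => Qx.
    have [k Qk] : exists k : 'I_m, ev Q (sc i (z ^+ k) *m x) != 0.
      apply: contrapT => /forallNP none; move/eqP: Qx; apply; rewrite ev_weight.
      apply: big1 => k _; have /negP/negPn/eqP -> := none k.
      by rewrite mulr0.
    by rewrite -(sat k); apply: HQ => //; exact: sc_neq0 (zX_neq0 k) x0.
  + move=> x x0 Ux; rewrite evM !evXn {1}mE exprS mulrA; congr (_ * _).
    rewrite !ev_weight mulr_sumr; apply: eq_bigr => k _.
    rewrite mulrCA -(sat k) HF ?sat //; exact: sc_neq0 (zX_neq0 k) x0.
  + move=> x; rewrite !evM !evXn -[in RHS]weight_sc -[in RHS](weight_sc i a Q).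
    by rewrite exprMn mulrACA -exprS -mE za mul1r.
  + by move=> x; rewrite !evXn -[in RHS]weight_sc exprMn za mul1r.
- move=> j iF iQ; split=> x; rewrite ?evM !evXn.
    by rewrite (weight_inv i a iF) (weight_inv i a iQ).
  by rewrite (weight_inv i a iQ).
Qed.

Lemma fraction_descends d F Q y (U : 'cV[K]_3 -> Prop) (f : 'cV[K]_3 -> K) :
  F \is d.-homog -> Q \is d.-homog -> y != 0 -> ev Q y != 0 ->
  (forall x, x != 0 -> ev Q x != 0 -> U (pw x)) ->
  (forall x, x != 0 -> U (pw x) -> f (pw x) * ev Q x = ev F x) ->
  exists e F' Q', [/\ F' \is e.-homog, Q' \is e.-homog, ev Q' (pw y) != 0 &
    forall w, w != 0 -> ev Q' w != 0 -> U w /\ f w = ev F' w / ev Q' w].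
Proof.
move=> hF hQ y0 Qy HQ HF.
have [d1 [F1 [Q1 [hF1 hQ1 Qy1 [HQ1 HF1 iF1 iQ1] k1]]]] := weight_fraction 0 hF hQ y0 Qy HQ HF.
have [d2 [F2 [Q2 [hF2 hQ2 Qy2 [HQ2 HF2 iF2 iQ2] k2]]]] := weight_fraction 1 hF1 hQ1 y0 Qy1 HQ1 HF1.
have [d3 [F3 [Q3 [hF3 hQ3 Qy3 [HQ3 HF3 iF3 iQ3] k3]]]] := weight_fraction 2%:R hF2 hQ2 y0 Qy2 HQ2 HF2.
have [i2F i2Q] := k2 _ iF1 iQ1; have [i3F i3Q] := k3 _ i2F i2Q.
have [j3F j3Q] := k3 _ iF2 iQ2.
have allF i : sc_inv i F3 by have [->|->|->] := ord3P i.
have allQ i : sc_inv i Q3 by have [->|->|->] := ord3P i.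
have [F4 [hF4 E4]] := pwsub_invariant hF3 allF.
have [Q4 [hQ4 E4']] := pwsub_invariant hQ3 allQ.
exists (d3 %/ m)%N, F4, Q4; split=> //; first by rewrite -ev_pwsub -E4'.
move=> w w0 Qw; have [x Ex] := pw_surj w; rewrite -Ex -!ev_pwsub -E4 -E4' in Qw *.
have x0 : x != 0.
  apply: contraNneq w0 => x0; rewrite -Ex x0; apply/eqP/colP => i; rewrite !mxE.
  by rewrite expr0n eqn0Ngt m0.
have Ux := HQ3 x x0 Qw; split=> //.
by rewrite -(HF3 x x0 Ux) mulfK.
Qed.

End PowerForms.

(** * The quotient by a diagonal group is the plane *)

Section PowerMap.
Variables (K : numClosedFieldType) (G : finSubgroup (PGL3 K)) (B : 'M[K]_3) (m : nat).
Hypotheses (Bu : B \in unitmx) (m0 : (0 < m)%N).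
Hypothesis hG : forall g, fsubg G g <->
  exists a b, [/\ a ^+ m = 1, b ^+ m = 1 & lifts (tor B 1 a b) g].
Local Notation X := (P2quot G).
Local Notation pi := (@piG K G).
Local Notation pw := (pw m).
Implicit Types (p q : P2 K) (v w : 'cV[K]_3).

Local Opaque PGL3_act proj_pt.

Definition power_map p : P2 K := proj_pt (pw (invmx B *m coords p)).

Lemma unit_mulv_neq0 (A : 'M[K]_3) v : A \in unitmx -> v != 0 -> A *m v != 0.
Proof. by move=> Au; exact: (@GL3_mulv_neq0 _ (exist _ A Au)). Qed.

Lemma invB_neq0 v : v != 0 -> invmx B *m v != 0.
Proof.
by apply: unit_mulv_neq0; rewrite unitmx_inv.
Qed.

Lemma B_neq0 v : v != 0 -> B *m v != 0.
Proof. exact: unit_mulv_neq0. Qed.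

Lemma power_map_proj v : v != 0 -> power_map (proj_pt v) = proj_pt (pw (invmx B *m v)).
Proof.
move=> v0; rewrite /power_map; have [c [c0 ->]] := coords_proj_pt v0.
by rewrite -scalemxAr pwZ proj_ptZ ?expf_neq0 // pw_neq0 // invB_neq0.
Qed.

Lemma power_map_basis w : w != 0 -> power_map (proj_pt (B *m w)) = proj_pt (pw w).
Proof. by move=> w0; rewrite power_map_proj ?B_neq0 // mulKmx. Qed.

Lemma power_map_inv g q : fsubg G g -> power_map (PGL3_act g q) = power_map q.
Proof.
move=> /hG[a [b [a1 b1 l]]]; rewrite -[q]coordsK; have q0 := coords_neq0 q.
have Tq : tor B 1 a b *m coords q != 0.
  exact: unit_mulv_neq0 (lifts_unit l) q0.
rewrite (lifts_act l q0) !power_map_proj //; congr proj_pt.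
rewrite /tor !mulmxA mulVmx // mul1mx -mulmxA; apply/colP => i.
rewrite [LHS]mxE [RHS]mxE dg_mul exprMn.
by have [->|->|->] := ord3P i; rewrite /= ?a1 ?b1 ?expr1n mul1r.
Qed.

Lemma power_map_surj q : exists p, power_map p = q.
Proof.
have [w Ew] := pw_surj m0 (coords q).
have w0 : w != 0.
  apply: contraNneq (coords_neq0 q) => w0; rewrite -Ew w0; apply/eqP/colP => i.
  by rewrite !mxE expr0n eqn0Ngt m0.
by exists (proj_pt (B *m w)); rewrite power_map_basis // Ew coordsK.
Qed.

(** After extracting an m-th root of the factor between the m-th powers of the
    coordinates of p and q, these coordinates only differ by roots of unity. *)
Lemma power_map_fiber p q : power_map p = power_map q ->
  exists2 g, fsubg G g & q = PGL3_act g p.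
Proof.
have p0 := coords_neq0 p; have q0 := coords_neq0 q.
pose y := invmx B *m coords p; pose x := invmx B *m coords q.
move=> E; have [l [l0 El]] := proj_pt_eq (pw_neq0 m (invB_neq0 p0)) (pw_neq0 m (invB_neq0 q0)) E.
pose c := m.-root l; have cm : c ^+ m = l := rootCK m0 l.
have c0 : c != 0 by apply: contraNneq l0 => c0; rewrite -cm c0 expr0n eqn0Ngt m0.
pose zt (i : 'I_3) := if y i 0 == 0 then 1 else c * x i 0 / y i 0.
have xy i : y i 0 ^+ m = (c * x i 0) ^+ m.
  by move/colP/(_ i): El; rewrite !mxE exprMn cm.
have ztm i : zt i ^+ m = 1.
  rewrite /zt; case: eqP => [_|/eqP yi]; first exact: expr1n.
  by rewrite expr_div_n -xy divff // expf_neq0.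
have ztE i : zt i * y i 0 = c * x i 0.
  rewrite /zt; case: eqP => [yi|/eqP yi]; last by rewrite divfK.
  have /esym/eqP := xy i; rewrite yi expr0n eqn0Ngt m0 /= expf_eq0 m0 => /eqP ->.
  by rewrite mulr0.
have zt0 i : zt i != 0.
  apply: contraTneq (oner_neq0 K) => zi; rewrite -(ztm i) zi expr0n eqn0Ngt m0.
  by rewrite eqxx.
pose a := zt 1 / zt 0; pose b := zt 2%:R / zt 0.
have Tu : tor B 1 a b \in unitmx.
  by rewrite unitmxE unitfE tor_det // mul1r !mulf_neq0 ?invr_eq0.
have [g lg] := lifts_exists Tu; exists g.
  by apply/hG; exists a, b; split=> //; rewrite /a /b expr_div_n !ztm divr1.
rewrite -[p]coordsK (lifts_act lg p0) -[LHS]coordsK.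
have dE : zt 0 *: (dg 1 a b *m y) = c *: x.
  apply/colP => i; rewrite [LHS]mxE [RHS]mxE dg_mul -ztE.
  by have [->|->|->] := ord3P i; rewrite /= ?mul1r // mulrA [zt 0 * _]mulrC divfK.
have TE : zt 0 *: (tor B 1 a b *m coords p) = c *: coords q.
  by rewrite /tor -!mulmxA scalemxAr -/y dE -scalemxAr mulKVmx.
have Tp0 : tor B 1 a b *m coords p != 0 by exact: unit_mulv_neq0.
by rewrite -(proj_ptZ c0 q0) -TE proj_ptZ.
Qed.

Lemma open_local (U : set (P2 K)) : (forall p, U p -> exists d F,
  [/\ F \is d.-homog, peval F p != 0 & forall q, peval F q != 0 -> U q]) -> open U.
Proof.
move=> H; rewrite openE => p /H[d [F [hF Fp FU]]]; rewrite /interior nbhsE.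
by exists [set q | peval F q != 0] => //; split=> //; apply: open_principal hF.
Qed.

Lemma power_map_morphism : morphism power_map.
Proof.
have iu : invmx B \in unitmx by rewrite unitmx_inv.
have ne p : pw (invmx B *m coords p) != 0 by apply/pw_neq0/invB_neq0/coords_neq0.
pose pull F := lsub (invmx B) (pwsub m F).
have hpull d F : F \is d.-homog -> pull F \is (m * d).-homog.
  by move=> hF; apply/lsub_homog/pwsub_homog.
have ev_pull F v : ev (pull F) v = ev F (pw (invmx B *m v)) := ev_pull m (invmx B) F v.
move=> U oU; split.
  apply: open_local => p Up; have [d [F [hF Fp HF]]] := open_rep oU (ne p) Up.
  exists (m * d)%N, (pull F); split; first exact: hpull.
    by rewrite /peval -/(ev _ (coords p)) ev_pull.
  by move=> q; rewrite /peval -/(ev _ (coords q)) ev_pull => /(HF _ (ne q)).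
move=> f rf; apply: regular_local => v v0; rewrite /preimage /= power_map_proj // => Uv.
have y0 : pw (invmx B *m v) != 0 by apply/pw_neq0/invB_neq0.
have [d [F [Q [hF hQ Qv E]]]] := regular_rep oU rf y0 Uv.
exists (m * d)%N, (pull F), (pull Q); split; [exact: hpull|exact: hpull|by rewrite ev_pull|].
move=> w w0 _; rewrite !ev_pull => Qw /=; rewrite power_map_proj //.
by have [_ ->] := E _ (pw_neq0 m (invB_neq0 w0)) Qw.
Qed.

Lemma power_map_fraction (U : set (P2 K)) f w : open (power_map @^-1` U) ->
  regular (power_map @^-1` U) (f \o power_map) -> w != 0 -> U (proj_pt w) ->
  exists e F Q, [/\ F \is e.-homog, Q \is e.-homog, ev Q w != 0 &
    forall w', w' != 0 -> ev Q w' != 0 ->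
      U (proj_pt w') /\ f (proj_pt w') = ev F w' / ev Q w'].
Proof.
move=> oV rV w0 Uw; have [z pz] := primitive_root_exists K m0.
have [y Ey] := pw_surj m0 w.
have y0 : y != 0.
  apply: contraNneq w0 => y0; rewrite -Ey y0; apply/eqP/colP => i.
  by rewrite !mxE expr0n eqn0Ngt m0.
have VE x : x != 0 -> (power_map @^-1` U) (proj_pt (B *m x)) <-> U (proj_pt (pw x)).
  by move=> x0; rewrite /preimage /= power_map_basis.
have Vy : (power_map @^-1` U) (proj_pt (B *m y)) by apply/VE; rewrite ?Ey.
have [d [F [Q [hF hQ Qy E]]]] := regular_rep oV rV (B_neq0 y0) Vy.
have glob := regular_global oV rV hF hQ (@ev_neq0 _ _ _ _ Qy).
have := @fraction_descends K m m0 z pz d (lsub B F) (lsub B Q) y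
  (fun x => U (proj_pt x)) (fun x => f (proj_pt x)) (lsub_homog B hF) (lsub_homog B hQ) y0.
rewrite ev_lsub Ey; apply=> // x x0; rewrite !ev_lsub.
  by move=> Qx; have [] := E _ (B_neq0 x0) Qx; rewrite VE.
move=> Ux; rewrite -power_map_basis //; apply: glob => //.
- by move=> v v0 Qv Vv; have [_ ->] := E v v0 Qv; rewrite divfK.
- exact: B_neq0.
- exact/VE.
Qed.

Lemma power_map_open (U : set (P2 K)) : open (power_map @^-1` U) -> open U.
Proof.
move=> oV; apply: open_local => p; rewrite -[p]coordsK => Up; have p0 := coords_neq0 p.
have [e [F [Q [hF hQ Qp E]]]] :=
  power_map_fraction (f := fun=> 0) oV (regular_cst _ 0 oV) p0 Up.
exists e, Q; split=> //; first by rewrite (peval_proj_neq0 hQ).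
move=> q; rewrite -[q]coordsK (peval_proj_neq0 hQ (coords_neq0 q)) => Qq.
by have [] := E _ (coords_neq0 q) Qq.
Qed.

Lemma power_map_regular (U : set (P2 K)) f : open (power_map @^-1` U) ->
  regular (power_map @^-1` U) (f \o power_map) -> regular U f.
Proof.
move=> oV rV; apply: regular_local => v v0 Uv.
have [e [F [Q [hF hQ Qv E]]]] := power_map_fraction oV rV v0 Uv.
by exists e, F, Q; split=> // w w0 _ Qw; have [] := E w w0 Qw.
Qed.

(** The power map is a quotient map for the topology and for the sheaf of
    functions, because invariant fractions are fractions in the m-th powers,
    and its fibres are the orbits of G. *)
Theorem quotient_is_plane : exists phi : X -> P2 K,
  (forall p, phi (pi p) = power_map p) /\ isomorphism phi.
Proof.
have [phi phiE] := descend (G := G) power_map_inv.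
have /choice[s sE] := power_map_surj.
pose psi q : X := pi (s q).
have psiE p : psi (power_map p) = pi p.
  by apply/esym/pi_eq/power_map_fiber; rewrite sE.
exists phi; split=> //; exists psi; split.
- by move=> x; have [p <-] := pi_surj x; rewrite phiE psiE.
- by move=> q; rewrite /psi phiE sE.
- move=> U oU; have [oV rV] := power_map_morphism oU.
  have E : pi @^-1` (phi @^-1` U) = power_map @^-1` U.
    by apply/seteqP; split=> p; rewrite /preimage /= phiE.
  split; first by rewrite pi_open E.
  move=> h /rV rh; rewrite pi_regular E.
  by apply: regular_eq rh => p; rewrite /= phiE.
move=> U; rewrite pi_open => oU.
have E : power_map @^-1` (psi @^-1` U) = pi @^-1` U.
  by apply/seteqP; split=> p; rewrite /preimage /= psiE.
split; first by apply: power_map_open; rewrite E.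
move=> h; rewrite pi_regular => rh; apply: power_map_regular; rewrite E //.
by apply: regular_eq rh => p; rewrite /= psiE.
Qed.

End PowerMap.

(** * Transport along isomorphisms *)

Section Transport.
Variables (K : numClosedFieldType).

Definition inverse_morphisms (X Y : funSpaceType K) (f : X -> Y) (g : Y -> X) :=
  [/\ cancel f g, cancel g f, morphism f & morphism g].

Lemma inverse_morphisms_sym (X Y : funSpaceType K) (f : X -> Y) (g : Y -> X) :
  inverse_morphisms f g -> inverse_morphisms g f.
Proof. by case. Qed.

Section Forward.
Variables (X Y : funSpaceType K) (f : X -> Y) (g : Y -> X).
Hypothesis fg : inverse_morphisms f g.

Lemma preimage_cancel (Z : set X) : f @^-1` (g @^-1` Z) = Z.
Proof. by case: fg => fK _ _ _; apply/seteqP; split=> x; rewrite /preimage /= fK. Qed.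

Lemma image_preimage (Z : set X) : f @` Z = g @^-1` Z.
Proof.
case: fg => fK gK _ _; apply/seteqP; split=> [_ [x Zx <-]|y Zy].
  by rewrite /preimage /= fK.
by exists (g y); rewrite ?gK.
Qed.

Lemma transport_open (U Z : set X) : open U -> U `&` Z !=set0 ->
  open (g @^-1` U) /\ (g @^-1` U) `&` (g @^-1` Z) !=set0.
Proof.
case: fg => fK _ _ mg oU [x [Ux Zx]]; split; first exact: (mg U oU).1.
by exists (f x); rewrite /preimage /= fK.
Qed.

Lemma transport_germ Z h : germ Z h -> germ (g @^-1` Z) (h \o g).
Proof.
move=> [U [oU mU rU]]; have [oV mV] := transport_open oU mU.
by exists (g @^-1` U); split=> //; case: fg => _ _ _ mg; apply: (mg U oU).2.
Qed.

Lemma transport_germ_eq Z h k : germ_eq Z h k -> germ_eq (g @^-1` Z) (h \o g) (k \o g).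
Proof.
move=> [U [oU mU E]]; have [oV mV] := transport_open oU mU.
by exists (g @^-1` U); split=> // y /E.
Qed.

Lemma transport_vanishing Z D h : vanishing Z D h ->
  vanishing (g @^-1` Z) (g @^-1` D) (h \o g).
Proof.
move=> [U [oU mU E]]; have [oV mV] := transport_open oU mU.
by exists (g @^-1` U); split=> // y Uy Dy; apply: E.
Qed.

Lemma transport_closed (A : set X) : closed A -> closed (g @^-1` A).
Proof. by case: fg => _ _ _ mg; rewrite -!openC => /mg[]. Qed.

Lemma transport_irreducible (Z : set X) : irreducible_set Z -> irreducible_set (g @^-1` Z).
Proof.
move=> [[z Zz] irr]; case: fg => fK gK mf _; split.
  by exists (f z); rewrite /preimage /= fK.
have cf (A : set Y) : closed A -> closed (f @^-1` A) by rewrite -!openC => /mf[].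
move=> A B /cf cA /cf cB sub; have [|H|H] := irr _ _ cA cB.
- by move=> x Zx; apply: sub; rewrite /preimage /= fK.
- by left=> y Zy; have := H _ Zy; rewrite /preimage /= gK.
- by right=> y Zy; have := H _ Zy; rewrite /preimage /= gK.
Qed.

End Forward.

Section Both.
Variables (X Y : funSpaceType K) (f : X -> Y) (g : Y -> X).
Hypothesis fg : inverse_morphisms f g.

Lemma transport_prime (Z : set X) : prime_divisor Z -> prime_divisor (g @^-1` Z).
Proof.
have gf := inverse_morphisms_sym fg; move=> [cZ irrZ ZT maxZ]; split.
- exact: transport_closed fg _ cZ.
- exact: transport_irreducible fg _ irrZ.
- apply: contraNneq ZT => E; apply/eqP.
  by rewrite -(preimage_cancel fg Z) E preimage_setT.
move=> W cW irrW sub.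
have [|E|E] := maxZ _ (transport_closed gf cW) (transport_irreducible gf irrW).
- by move=> x Zx; apply: sub; rewrite /preimage /=; case: fg => -> _ _ _.
- by left; rewrite -E (preimage_cancel gf).
- by right; rewrite -(preimage_cancel gf W) E preimage_setT.
Qed.

Lemma transport_generates Z D n (s : 'I_n -> X -> K) :
  generates Z s (vanishing Z D) ->
  generates (g @^-1` Z) (fun i => s i \o g) (vanishing (g @^-1` Z) (g @^-1` D)).
Proof.
have gf := inverse_morphisms_sym fg; case: (fg) => fK gK _ _ [gs gen]; split.
  by move=> i; exact: transport_germ fg _ _ (gs i).
move=> h gh; have gh' := transport_germ gf gh; rewrite (preimage_cancel fg) in gh'.
have [E1 E2] := gen _ gh'.
have hK : (h \o f) \o g = h by apply: funext => y; rewrite /= gK.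
split=> [vh|[a [ga Ea]]].
  have vh' := transport_vanishing gf vh; rewrite !(preimage_cancel fg) in vh'.
  have [a [ga Ea]] := E1 vh'; exists (fun i => a i \o g); split=> [i|].
    exact: transport_germ fg _ _ (ga i).
  by have := transport_germ_eq fg Ea; rewrite hK.
rewrite -hK; apply: (transport_vanishing fg); apply: E2.
exists (fun i => a i \o f); split=> [i|].
  by have := transport_germ gf (ga i); rewrite (preimage_cancel fg).
have := transport_germ_eq gf Ea; rewrite (preimage_cancel fg).
suff -> : (fun y => \sum_(i < n) a i y * (s i \o g) y) \o f =
  (fun x => \sum_(i < n) (a i \o f) x * s i x) by [].
by apply: funext => x; apply: eq_bigr => i _; rewrite /= fK.
Qed.

End Both.
End Transport.

(** * Branching of the power map *)

Section PowerDerivative.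
Variables (K : numClosedFieldType) (m : nat).
Implicit Types F Q : {mpoly K[3]}.

Lemma mderiv_exp n j F : (F ^+ n)^`M(j) = n%:R *: (F ^+ n.-1 * F^`M(j)).
Proof.
elim: n => [|n IHn]; first by rewrite expr0 -mpolyC1 mderivC scale0r.
rewrite exprS mderivM IHn [F^`M(j) * _]mulrC -scalerAr mulrA.
case: n {IHn} => [|n]; first by rewrite scale0r addr0 scale1r.
by rewrite -exprS -{1}[F ^+ n.+1 * _]scale1r -scalerDl /= [1 + _]addrC natr1.
Qed.

Lemma mderiv_pwsub F j :
  (pwsub m F)^`M(j) = pwsub m F^`M(j) * (m%:R *: 'X_j ^+ m.-1).
Proof.
have subU (k : 'I_3) : (U_(k) - U_(k) = 0)%MM by apply/mnmP => l; rewrite mnmBE subnn mnm0E.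
have pwD F1 F2 : pwsub m (F1 + F2) = pwsub m F1 + pwsub m F2.
  by apply: ev_inj => v; rewrite evD !ev_pwsub evD.
have pwM F1 F2 : pwsub m (F1 * F2) = pwsub m F1 * pwsub m F2.
  by apply: ev_inj => v; rewrite evM !ev_pwsub evM.
have pwC c : pwsub m c%:MP = c%:MP.
  by apply: ev_inj => v; rewrite ev_pwsub !evC.
elim/mpoly_closed: F => [c|i|F1 F2 H1 H2|F1 F2 H1 H2].
- by rewrite pwC !mderivC pwC mul0r.
- have -> : pwsub m 'X_i = 'X_i ^+ m :> {mpoly K[3]}.
    by apply: ev_inj => v; rewrite ev_pwsub evXn !evX mxE.
  have -> : 'X_i^`M(j) = (i == j)%:R%:MP :> {mpoly K[3]}.
    rewrite mderivX mnm1E; have [->|ne] := eqVneq i j; last by rewrite scale0r.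
    by rewrite scale1r subU mpolyX0.
  rewrite mderiv_exp mderivX mnm1E pwC.
  have [->|ne] := eqVneq i j; last by rewrite scale0r mulr0 scaler0 mul0r.
  by rewrite scale1r subU mpolyX0 mulr1 mul1r.
- by rewrite pwD !mderivD H1 H2 pwD mulrDl.
- rewrite pwM !mderivM H1 H2 pwD !pwM mulrDl; congr (_ + _); last by rewrite mulrA.
  by rewrite mulrAC.
Qed.

End PowerDerivative.

(** By Leibniz's rule, every term of the derivative of the right-hand side
    keeps a factor S. *)
Lemma double_zero_deriv (K : numClosedFieldType) (P A M S Q : {mpoly K[3]}) j v :
  P * A = M * (S * (S * Q)) -> ev P v = 0 -> ev S v = 0 -> ev A v != 0 ->
  ev P^`M(j) v = 0.
Proof.
move=> E Pv Sv Av; have := congr1 (fun F => ev F^`M(j) v) E.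
rewrite !mderivM !(evD, evM) Pv Sv !(mul0r, mulr0, addr0) => /eqP.
by rewrite mulf_eq0 (negPf Av) orbF => /eqP.
Qed.

Section BranchPower.
Variables (K : numClosedFieldType) (G : finSubgroup (PGL3 K)) (B : 'M[K]_3) (m : nat).
Hypotheses (Bu : B \in unitmx) (m0 : (0 < m)%N).
Local Notation pw := (pw m).
Local Notation sg := (power_map B m).
Implicit Types (p q : P2 K) (v w : 'cV[K]_3) (Z C : set (P2 K)).

Local Opaque PGL3_act proj_pt lsub pwsub.

(** The i-th coordinate line, and its preimage under the power map. *)
Definition side (i : 'I_3) : 'rV[K]_3 := delta_mx 0 i.
Definition axis (i : 'I_3) : 'rV[K]_3 := row i (invmx B).

Lemma side_neq0 i : side i != 0.
Proof. by apply/rV0Pn; exists i; rewrite mxE !eqxx oner_neq0. Qed.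

Lemma side_mul i v : (side i *m v) 0 0 = v i 0.
Proof. by rewrite -rowE mxE. Qed.

Lemma axis_mul i v : (axis i *m v) 0 0 = (invmx B *m v) i 0.
Proof. by rewrite -row_mul mxE. Qed.

Lemma row_eq0 (a : 'rV[K]_3) v : a *m v = 0 <-> (a *m v) 0 0 = 0.
Proof.
by split=> [->|E]; [rewrite mxE|apply/matrixP => i j; rewrite !ord1 E mxE].
Qed.

Lemma axis_neq0 i : axis i != 0.
Proof.
apply/eqP => E; have := axis_mul i (B *m delta_mx i 0).
rewrite E mul0mx mulKmx // !mxE !eqxx => /esym/eqP.
by rewrite oner_eq0.
Qed.

Lemma axis_side i p : lineset (axis i) p <-> lineset (side i) (sg p).
Proof.
rewrite -[p]coordsK; have p0 := coords_neq0 p.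
rewrite (power_map_proj m Bu p0) (linesetE _ p0) (linesetE _ (pw_neq0 m (invB_neq0 Bu p0))).
rewrite !row_eq0 side_mul axis_mul [pw _ _ _]mxE.
split=> [->|/eqP]; first by rewrite expr0n eqn0Ngt m0.
by rewrite expf_eq0 m0 => /eqP.
Qed.

Lemma nonvan_pull i Q : nonvan (side i) Q -> nonvan (axis i) (lsub (invmx B) (pwsub m Q)).
Proof.
move=> [w [w0 /row_eq0 iw Qw]]; have [x Ex] := pw_surj m0 w.
exists (B *m x); split.
- apply: (B_neq0 Bu); apply: contraNneq w0 => x0; rewrite -Ex x0.
  by apply/eqP/colP => k; rewrite !mxE expr0n eqn0Ngt m0.
- apply/row_eq0; rewrite axis_mul mulKmx //.
  move: iw; rewrite side_mul -Ex mxE => /eqP.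
  by rewrite expf_eq0 m0 => /eqP.
by rewrite (ev_pull m _ Q) mulKmx // Ex.
Qed.

Lemma ordl_germ_eq c k (f g : P2 K -> K) : c != 0 -> germ_eq (lineset c) f g ->
  ordl c k g -> ordl c k f.
Proof.
move=> c0 [U [oU mU E]] og; have [d [Q [hQ nQ HQ]]] := open_meets_line oU mU.
by apply: (ordl_eq c0 hQ nQ _ og) => w w0 Qw; rewrite E //; apply: HQ.
Qed.

Lemma ordl_power i t : ordl (side i) 1 t -> ordl (axis i) m (t \o sg).
Proof.
move=> [d [F [Q [hF hQ nF nQ E]]]].
exists (m * d)%N, (lsub (invmx B) (pwsub m F)), (lsub (invmx B) (pwsub m Q)); split.
- exact/lsub_homog/pwsub_homog.
- rewrite -[X in (_ + X)%N]muln1 -mulnDr; exact/lsub_homog/pwsub_homog.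
- exact: nonvan_pull.
- exact: nonvan_pull.
move=> w w0; rewrite (ev_pull m _ F) (ev_pull m _ Q) => Fw Qw.
rewrite /= (power_map_proj m Bu w0) E ?pw_neq0 ?invB_neq0 //.
by rewrite side_mul axis_mul expr1 mxE.
Qed.

(** This is the ramification index of the power map along C, for the curve Z =
    sg (C). *)
Definition ramified_along C Z e := exists t s (u : P2 K -> K),
  [/\ local_equation Z Z t, local_equation C C s, germ_unit C u &
      germ_eq C (t \o sg) (fun y => u y * s y ^+ e)].

(** The equation of the side pulls back to the m-th power of the equation of
    the axis. *)
Lemma side_index C i e : prime_divisor C -> sg @` C = lineset (side i) ->
  ramified_along C (lineset (side i)) e -> e = m.
Proof.
move=> [cC irrC _ maxC] img [t [s [w [lt ls uw E]]]]; have a0 := axis_neq0 i.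
have sub : C `<=` lineset (axis i).
  by move=> q Cq; apply/axis_side; rewrite -img; exists q.
have CE : C = lineset (axis i).
  have [//|/eqP] := maxC _ (@lineset_closed _ _) (lineset_irreducible a0) sub.
  by rewrite (negPf (lineset_neqT a0)).
rewrite CE in ls uw E.
have o1 := ordl_power (local_equation_ordl (side_neq0 i) lt).
have := ordlM a0 (germ_unit_ordl a0 uw) (ordlX a0 e (local_equation_ordl a0 ls)).
rewrite add0n mul1n => /(ordl_germ_eq a0 E).
by move=> o2; apply: (ordl_uniq a0 o2 o1).
Qed.

Lemma sg_open U : open U -> open (sg @^-1` U).
Proof. by move=> /(power_map_morphism m Bu)[]. Qed.

Lemma sg_meets C Z U : sg @` C = Z -> U `&` Z !=set0 -> (sg @^-1` U) `&` C !=set0.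
Proof. by move=> <- [x [Ux [q Cq Eq]]]; exists q; split=> //; rewrite /preimage /= Eq. Qed.

Lemma prime_minimal_form Z : prime_divisor Z -> exists d F,
  [/\ F \is d.-homog, F != 0, (0 < d)%N, forall v, v != 0 -> Z (proj_pt v) -> ev F v = 0 &
   forall F', F' \is d.-1.-homog ->
     (forall v, v != 0 -> Z (proj_pt v) -> ev F' v = 0) -> F' = 0].
Proof.
move=> [cZ [[z Zz] _] ZT _].
pose P d := `[< exists F : {mpoly K[3]}, [/\ F \is d.-homog, F != 0 &
  forall v, v != 0 -> Z (proj_pt v) -> ev F v = 0] >].
have exP : exists d, P d.
  by have [d [F H]] := closed_form cZ ZT; exists d; apply/asboolP; exists F.
have [d /asboolP[F [hF F0 FZ]] dmin] := ex_minnP exP.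
have d0 : (0 < d)%N.
  case: d hF {dmin} => // hF; have z0 := coords_neq0 z; case/eqP: F0.
  have Fz : ev F (coords z) = 0 by apply: FZ; rewrite ?coordsK.
  apply: ev_inj => v; rewrite ev0 -[v]scale1r.
  have E u c : ev F (c *: u) = ev F u by rewrite (ev_homog _ _ hF) expr0 mul1r.
  by rewrite -(E _ 0) scale0r -(scale0r (coords z)) E.
exists d, F; split=> // F' hF' FZ'; apply/eqP/negPn/negP => F'0.
have /dmin : P d.-1 by apply/asboolP; exists F'.
by rewrite leqNgt prednK // leqnn.
Qed.

(** Along a curve that is not one of the sides, the power map is locally
    invertible: if the index e were at least two, then the derivatives of an
    equation of least degree of the image would vanish on it. *)
Lemma other_index C Z e : irreducible_set C -> sg @` C = Z -> prime_divisor Z ->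
  (forall i, lineset (side i) <> Z) -> ramified_along C Z e -> e = 1%N.
Proof.
move=> irrC img pZ notside [t [s [u [lt ls [W3 [oW3 mW3 ru nu]] [W1 [oW1 mW1 E]]]]]].
have [cZ irrZ ZT maxZ] := pZ.
have Zs q : C q -> Z (sg q) by move=> Cq; rewrite -img; exists q.
have off j : (~` lineset (axis j)) `&` C !=set0.
  apply: contrapT => none; apply: (notside j).
  have [|//|/eqP] := maxZ (lineset (side j)) (@lineset_closed _ _) (lineset_irreducible (side_neq0 j)).
    move=> y; rewrite -img => -[q Cq <-]; apply/axis_side.
    by apply: contrapT => nq; apply: none; exists q.
  by rewrite (negPf (lineset_neqT (side_neq0 j))).
have ooff j : open (~` lineset (axis j)) by rewrite openC; apply: lineset_closed.
have [Vt [oVt mVt tZ]] := local_equation_vanishes irrZ lt.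
have [W4 [oW4 mW4 sC]] := local_equation_vanishes irrC ls.
have mWt := sg_meets img mVt; have oWt := sg_open oVt.
have [e0|e0] := posnP e.
  exfalso; have o12 : open (W1 `&` W3) by apply: openI.
  have [q [[[q1 q3] qt] Cq]] := irreducible_open irrC o12 oWt
    (irreducible_open irrC oW1 oW3 mW1 mW3) mWt.
  have /eqP := nu _ q3; apply; have := E _ q1.
  by rewrite e0 expr0 mulr1 /= => <-; apply: tZ => //; apply: Zs.
have [e1|e1] := eqVneq e 1%N; first by [].
(* An equation F of Z of least degree is a multiple of t, once divided by a
   form L of the same degree that does not vanish identically on Z. *)
have [d [F [hF F0 d0 FZ minF]]] := prime_minimal_form pZ.
have [z Zz] := irrZ.1; have z0 := coords_neq0 z.
have [|b Hb] := @avoid _ _ [:: coords z]; first by move=> x; rewrite inE => /eqP ->.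
have bz : ev (lform b) (coords z) != 0 by rewrite ev_lform; apply: Hb; rewrite inE.
pose L := lform b ^+ d.
have hb := lform_homog b; have hL : L \is d.-homog by rewrite -[d]mul1n; apply: dhomogMn.
pose V7 := [set q : P2 K | peval (lform b) q != 0].
have oV7 : open V7 := open_principal hb.
have L7 q : V7 q -> peval L q != 0 by move=> q7; rewrite /peval rmorphXn /= expf_neq0.
have mV7 : V7 `&` Z !=set0 by exists z.
pose g q := peval F q / peval L q.
have rg : regular V7 g by apply: (regular_ratio hF hL).
have vg : vanishing Z Z g.
  exists V7; split=> // q q7 Zq; rewrite /g {1}/peval -/(ev F (coords q)) FZ ?coordsK ?coords_neq0 //.
  by rewrite mul0r.
have gg : germ Z g by exists V7.
have [c [/(_ ord0) [V6 [oV6 mV6 rc]] [V5 [oV5 mV5 Ec]]]] := (lt.2 g gg).1 vg.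
have [W2 [oW2 mW2 rs]] := ls.1 ord0.
pose W := W1 `&` W2 `&` W3 `&` W4 `&` (sg @^-1` V5) `&` (sg @^-1` V6) `&` (sg @^-1` V7).
have oW : open W.
  by do ![apply: openI]; rewrite ?oW1 //; apply: sg_open.
have [q0 [Wq0 Cq0]] : W `&` C !=set0.
  do ![apply: (irreducible_open irrC)] => //; do ?[apply: openI] => //;
    do ?[exact: sg_open]; do ?[exact: (sg_meets img)].
have v0 := coords_neq0 q0; rewrite -[q0]coordsK in Wq0 Cq0.
have rsW : regular W s by apply: (regular_sub _ _ _ oW2 oW _ rs) => q [[[[[[_ ?] _] _] _] _] _].
have ruW : regular W u by apply: (regular_sub _ _ _ oW3 oW _ ru) => q [[[[[_ ?] _] _] _] _].
have rcW : regular W (c ord0 \o sg).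
  apply: (regular_sub _ _ _ (sg_open oV6) oW _ ((power_map_morphism m Bu oV6).2 _ rc)).
  by move=> q [[_ ?] _].
have rk := regular_mul _ _ _ oW rcW ruW.
have [d1 [S1 [S2 [hS1 hS2 S2q ES]]]] := regular_rep oW rsW v0 Wq0.
have [d2 [A1 [A2 [hA1 hA2 A2q EA]]]] := regular_rep oW rk v0 Wq0.
pose P := lsub (invmx B) (pwsub m F); pose M := lsub (invmx B) (pwsub m L).
have evP v : ev P v = ev F (pw (invmx B *m v)) := ev_pull m (invmx B) F v.
have evM' v : ev M v = ev L (pw (invmx B *m v)) := ev_pull m (invmx B) L v.
(* Near a general point of C, F / L is c times t, and t pulls back to u s^e;
   here S1 / S2 represents s, and A1 / A2 the product of u and the pullback
   of c. *)
have idE : P * A2 * S2 ^+ e = M * A1 * S1 ^+ e.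
  apply: (@ev_eq_off0 _ _ _ (S2 * A2)).
    by apply: mulf_neq0; [exact: (@ev_neq0 _ _ _ _ S2q)|exact: (@ev_neq0 _ _ _ _ A2q)].
  move=> v vn0; rewrite evM mulf_eq0 negb_or => /andP[S2v A2v].
  have [Wv Sv] := ES v vn0 S2v; have [_ Av] := EA v vn0 A2v.
  have pv0 := pw_neq0 m (invB_neq0 Bu vn0).
  have [[[[[[w1 w2] w3] w4] w5] w6] w7] := Wv.
  have gE : g (sg (proj_pt v)) = ev P v / ev M v.
    by rewrite (power_map_proj m Bu vn0) /g (peval_proj_ratio hF hL pv0) evP evM'.
  have Mv : ev M v != 0.
    have := L7 _ w7; rewrite (power_map_proj m Bu vn0) (peval_proj_neq0 hL pv0).
    by rewrite evM'.
  have := Ec _ w5; rewrite big_ord1 gE.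
  have := E _ w1; rewrite /= => ->; rewrite mulrA Sv.
  have {}Av : c ord0 (sg (proj_pt v)) * u (proj_pt v) = ev A1 v / ev A2 v := Av.
  rewrite Av !evM !evXn expr_div_n.
  move: (expf_neq0 e S2v) A2v Mv; clear; move: (ev S2 v ^+ e) (ev S1 v ^+ e).
  move: (ev P v) (ev M v) (ev A1 v) (ev A2 v) => x1 x2 x3 x4 x5 x6 n5 n4 n2 H.
  apply: (mulIf (mulf_neq0 (invr_neq0 n2) (mulf_neq0 (invr_neq0 n4) (invr_neq0 n5)))).
  have -> : x1 * x4 * x5 * (x2^-1 * (x4^-1 * x5^-1)) = x1 / x2 by field; rewrite n2 n4 n5.
  by rewrite H; field; rewrite n2 n4 n5.
pose W' := [set q : P2 K | peval (S2 * A2) q != 0].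
have hSA := dhomogM hS2 hA2; have oW' : open W' := open_principal hSA.
have mW' : W' `&` C !=set0.
  exists (proj_pt (coords q0)); split=> //.
  by rewrite /W' /= (peval_proj_neq0 hSA v0) evM mulf_neq0.
have idB := congr1 (lsub B) idE.
have lsubM F1 F2 : lsub B (F1 * F2) = lsub B F1 * lsub B F2.
  by apply: ev_inj => v; rewrite evM !ev_lsub evM.
have PB : lsub B P = pwsub m F.
  apply: ev_inj => v; rewrite [RHS]ev_pwsub; apply: etrans (ev_lsub B P v) _.
  by rewrite evP mulKmx.
have eE : e = e.-2.+2 by case: (e) e0 e1 => [|[|]].
(* As e >= 2, both sides of this identity have zero derivatives where s
   vanishes. *)
have deriv0 q j : C q -> W' q -> ev F^`M(j) (pw (invmx B *m coords q)) *
    (invmx B *m coords q) j 0 ^+ m.-1 = 0.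
  move=> Cq W'q; set v := coords q; have vn0 : v != 0 := coords_neq0 q.
  move: W'q; rewrite /W' /= /peval -/(ev (S2 * A2) v) evM mulf_eq0 negb_or => /andP[S2v A2v].
  have [Wv Sv] := ES v vn0 S2v; rewrite coordsK in Wv Sv.
  have [[[[[[w1 w2] w3] w4] w5] w6] w7] := Wv.
  have S1v : ev S1 v = 0.
    by have /eqP := sC _ w4 Cq; rewrite Sv mulf_eq0 invr_eq0 (negPf S2v) orbF => /eqP.
  pose y := invmx B *m v; have yE : B *m y = v by rewrite mulKVmx.
  have Fy : ev F (pw y) = 0.
    apply: FZ; first exact/pw_neq0/invB_neq0.
    by rewrite -(power_map_proj m Bu vn0) coordsK; apply: Zs.
  have idB' : pwsub m F * (lsub B A2 * lsub B (S2 ^+ e)) =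
      lsub B M * lsub B A1 * (lsub B S1 * (lsub B S1 * lsub B (S1 ^+ e.-2))).
    have lsubE X1 X2 X3 Y1 Y2 : X1 * X2 * X3 = Y1 * Y2 * (S1 * (S1 * S1 ^+ e.-2)) ->
        lsub B X1 * (lsub B X2 * lsub B X3) =
        lsub B Y1 * lsub B Y2 * (lsub B S1 * (lsub B S1 * lsub B (S1 ^+ e.-2))).
      by move=> H; rewrite -!lsubM -H -mulrA.
    by rewrite -PB; apply: lsubE; rewrite idE; congr (_ * _); rewrite -!exprS -eE.
  have A2y : ev (lsub B A2 * lsub B (S2 ^+ e)) y != 0.
    rewrite evM; apply: mulf_neq0; first by rewrite (ev_lsub B A2) yE.
    by rewrite (ev_lsub B (S2 ^+ e)) yE evXn expf_neq0.
  have /eqP := double_zero_deriv j idB' (etrans (ev_pwsub m F y) Fy)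
    (etrans (ev_lsub B S1 y) (etrans (congr1 (ev S1) yE) S1v)) A2y.
  rewrite mderiv_pwsub evM (ev_pwsub m F^`M(j)) evZ evXn evX.
  rewrite !mulf_eq0 pnatr_eq0 eqn0Ngt m0 /= => /orP[/eqP ->|/eqP ->].
    by rewrite mul0r.
  by rewrite mulr0.
have dF j : F^`M(j) = 0.
  have hdF := mderiv_homog j hF; apply: minF => // v vn0 Zv.
  apply/eqP/negPn/negP => dFv.
  pose O := [set q : P2 K | peval F^`M(j) q != 0]; have oO : open O := open_principal hdF.
  have mO : O `&` Z !=set0.
    by exists (proj_pt v); split=> //; rewrite /O /= (peval_proj_neq0 hdF vn0).
  have o12 : open (W' `&` ~` lineset (axis j)) by apply: openI.
  have [q [[[W'q offq] Oq] Cq]] := irreducible_open irrC o12 (sg_open oO)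
    (irreducible_open irrC oW' (ooff j) mW' (off j)) (sg_meets img mO).
  have q0' := coords_neq0 q; have := deriv0 q j Cq W'q; apply/eqP.
  move: Oq; rewrite /O /preimage /= -{1}[q]coordsK (power_map_proj m Bu q0').
  rewrite (peval_proj_neq0 hdF (pw_neq0 m (invB_neq0 Bu q0'))) => dFq.
  rewrite mulf_neq0 // expf_neq0 //; apply/eqP => yj; apply: offq.
  by apply/row_eq0; rewrite axis_mul.
case/eqP: F0; apply: ev_inj => v; rewrite ev0; apply/eqP.
have dn0 : d%:R != 0 :> K by rewrite pnatr_eq0 -lt0n.
rewrite -(inj_eq (mulfI dn0)) mulr0 -(euler v hF); apply/eqP/big1 => i _.
by rewrite dF ev0 mulr0.
Qed.

End BranchPower.

(** * The branch divisor and the group action on the plane *)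

Section Conclusion.
Variables (K : numClosedFieldType) (G : finSubgroup (PGL3 K)).
Local Notation pi := (@piG K G).
Implicit Types (Z C : set (P2 K)) (z : K * K).

Local Opaque PGL3_act proj_pt.

Lemma snc_transport (X : funSpaceType K) (Delta : Qdivisor X) : snc Delta ->
  quotient_pair G Delta -> forall p, exists u, local_parameters (pi p) u /\
    forall D, prime_divisor D -> branch_coef pi D != 0 -> D (pi p) ->
      exists i, local_equation [set pi p] D (u i).
Proof.
move=> sD [f [[g [fK gK mf mg]] DE]] p.
have fg : inverse_morphisms f g by [].
have gf := inverse_morphisms_sym fg.
have [u [lu su]] := sD (g (pi p)).
have pE : g @^-1` [set g (pi p)] = [set pi p].
  apply/seteqP; split=> x; rewrite /preimage /=; last by move=> ->.
  exact: (can_inj gK).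
exists (fun i => u i \o g); split.
  by have := transport_generates fg lu; rewrite pE.
move=> D pD bD Dp.
have pZ : prime_divisor (f @^-1` D) := transport_prime gf pD.
have [||i li] := su (f @^-1` D).
- by rewrite DE // (image_preimage fg) (preimage_cancel gf).
- by rewrite /preimage /= gK.
exists i; have := transport_generates fg li.
by rewrite pE (preimage_cancel gf).
Qed.

Variables (B : 'M[K]_3) (m : nat).
Hypotheses (Bu : B \in unitmx) (m0 : (0 < m)%N).
Hypothesis hG : forall g, fsubg G g <->
  exists a b, [/\ a ^+ m = 1, b ^+ m = 1 & lifts (tor B 1 a b) g].

Lemma side_point i j : lineset (side K i) (proj_pt (delta_mx j 0)) <-> i != j.
Proof.
have d0 : delta_mx j 0 != 0 :> 'cV[K]_3 by apply/cV0Pn; exists j; rewrite mxE !eqxx oner_neq0.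
rewrite (linesetE _ d0) row_eq0 side_mul mxE eqxx andbT.
by case: eqVneq => _ /=; split=> // /eqP; rewrite oner_eq0.
Qed.

Lemma side_inj : injective (fun i => lineset (side K i)).
Proof.
move=> i j E; apply/eqP/negPn/negP => /side_point; rewrite E => /side_point.
by rewrite eqxx.
Qed.

Lemma sides_general_position : general_position (fun i => lineset (side K i)).
Proof.
split; first exact: side_inj.
apply/seteqP; split=> // p H; have /eqP := coords_neq0 p; apply.
apply/colP => i; rewrite mxE -side_mul; apply/(row_eq0 (side K i) (coords p)).
exact: H i I.
Qed.

(** Through phi the quotient map becomes the power map, whose ramification
    index is m along the axes and one along all other curves. *)
Lemma branch_coef_plane (phi : P2quot G -> P2 K) Z :
  (forall p, phi (pi p) = power_map B m p) -> isomorphism phi -> prime_divisor Z ->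
  branch_coef pi (phi @^-1` Z) =
  (1 - m%:R^-1) * (\sum_(i < 3) `[< lineset (side K i) = Z >]%:R).
Proof.
move=> phiE [psi [phiK psiK mphi mpsi]] pZ.
have fg : inverse_morphisms phi psi by [].
have plane C e : pi @` C = phi @^-1` Z -> ramification_index pi C e ->
    power_map B m @` C = Z /\ ramified_along B m C Z e.
  move=> img [t [s [w [lt ls uw E]]]]; split.
    apply/seteqP; split=> [_ [q Cq <-]|y Zy].
      have : (pi @` C) (pi q) by exists q.
      by rewrite img /preimage /= phiE.
    have : (pi @` C) (psi y) by rewrite img /preimage /= psiK.
    by move=> [q Cq Eq]; exists q; rewrite // -phiE Eq psiK.
  exists (t \o psi), s, w; split=> //.
    have := transport_generates fg lt.
    by rewrite img (preimage_cancel (inverse_morphisms_sym fg)).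
  suff -> : (t \o psi) \o power_map B m = t \o pi by [].
  by apply: funext => q; rewrite /= -phiE phiK.
rewrite /branch_coef.
have [[i Ei]|none] := pselect (exists i, lineset (side K i) = Z).
  rewrite (bigD1 i) //= Ei asboolT // big1 => [|j ji]; last first.
    by rewrite asboolF // -Ei => /side_inj /eqP; rewrite (negPf ji).
  rewrite addr0 mulr1; congr (1 - _^-1); congr (_%:R).
  have a0 := axis_neq0 Bu i.
  case: xgetP => [e _ [C [pC img re]]|noE].
    have [imgC rC] := plane C e img re; subst Z.
    exact: (side_index Bu m0 pC imgC rC).
  exfalso; have [e re] := ramification_exists G a0; apply: (noE e).
  exists (lineset (axis B i)); split=> //; first exact: lineset_prime.
  apply/seteqP; split=> [_ [q Lq <-]|x].
    by rewrite /preimage /= phiE -Ei; apply/axis_side.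
  have [q <-] := pi_surj x; rewrite /preimage /= phiE -Ei => Lq.
  by exists q => //; apply/(axis_side Bu m0).
rewrite big1 => [|i _]; last by rewrite asboolF // => Ei; apply: none; exists i.
rewrite mulr0; case: xgetP => [e _ [C [pC img re]]|_]; last by rewrite invr1 subrr.
have [imgC rC] := plane C e img re; have [_ irrC _ _] := pC.
rewrite (other_index Bu m0 irrC imgC pZ _ rC) ?invr1 ?subrr // => i Ei.
by apply: none; exists i.
Qed.

Lemma tor_inj a b a' b' c : tor B 1 a b = c *: tor B 1 a' b' -> a = a' /\ b = b'.
Proof.
move=> E; have eig (i : 'I_3) : [:: 1; a; b]`_i = c * [:: 1; a'; b']`_i :> K.
  have v0 := basis_neq0 i Bu; have := tor_eigen 1 a b i Bu.
  rewrite E -scalemxAl tor_eigen // scalerA => /eqP; rewrite eq_sym -subr_eq0 -scalerBl.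
  by rewrite scaler_eq0 (negPf v0) orbF subr_eq0 => /eqP.
have := eig 0; rewrite /= mulr1 => c1; have := eig 1; have := eig 2%:R.
by rewrite /= -c1 !mul1r.
Qed.

Lemma diagonal_action_tor : diagonal_action m G.
Proof.
have unit_tor z : (mu m `*` mu m) z -> tor B 1 z.1 z.2 \in unitmx.
  move=> [z1 z2]; have nz (x : K) : m.-unity_root x -> x != 0.
    rewrite unity_rootE => /eqP xm; apply: contra_eq_neq xm => ->.
    by rewrite expr0n eqn0Ngt m0 eq_sym oner_neq0.
  by rewrite unitmxE unitfE tor_det // mul1r mulf_neq0 ?nz.
have /choice[rho rhoE] : forall z, exists g, (mu m `*` mu m) z -> lifts (tor B 1 z.1 z.2) g.
  move=> z; have [mz|nz] := pselect ((mu m `*` mu m) z); last by exists 1%g.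
  by have [g lg] := lifts_exists (unit_tor z mz); exists g.
have muE (x : K) : mu m x <-> x ^+ m = 1 by rewrite /mu /= unity_rootE; split=> /eqP.
exists rho; split.
- split.
  + by move=> z mz; apply/hG; exists z.1, z.2; split; [apply/muE; case: mz|apply/muE; case: mz|exact: rhoE].
  + move=> z w; rewrite !inE => mz mw E; have lz := rhoE z mz; rewrite E in lz.
    have [c [c0 Ec]] := lifts_eq lz (rhoE w mw).
    by have [] := tor_inj Ec; case: (z) (w) => [? ?] [? ?] /= -> ->.
  + move=> g /hG[a [b [a1 b1 l]]]; have mab : (mu m `*` mu m) (a, b) by split; apply/muE.
    by exists (a, b) => //; apply: lifts_inj (rhoE _ mab) l.
- move=> z w mz mw; have mzw : (mu m `*` mu m) (z.1 * w.1, z.2 * w.2).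
    case: mz mw => /muE z1 /muE z2 [/muE w1 /muE w2].
    by split; apply/muE; rewrite /= exprMn ?z1 ?w1 ?z2 ?w2 mulr1.
  apply: (lifts_inj (rhoE _ mzw)); have := lifts_mul (rhoE z mz) (rhoE w mw).
  by rewrite torM // mulr1.
have [gB lB] := lifts_exists Bu.
exists (PGL3_act gB); split; first exact: act_isomorphism.
move=> z mz x0 x1 x2 x012.
have col0 y0 y1 y2 : [|| y0 != 0, y1 != 0 | y2 != 0] ->
    \col_(i < 3) [:: y0; y1; y2]`_i != 0 :> 'cV[K]_3.
  by case/or3P => yi; apply/cV0Pn; [exists 0|exists 1|exists 2%:R]; rewrite mxE.
have v0 := col0 _ _ _ x012.
have zx012 : [|| x0 != 0, z.1 * x1 != 0 | z.2 * x2 != 0].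
  have := unit_tor z mz; rewrite unitmxE unitfE tor_det // mul1r mulf_eq0 negb_or.
  move=> /andP[z1 z2]; case/or3P: x012 => xi; apply/or3P;
    [apply: Or31|apply: Or32|apply: Or33] => //; exact: mulf_neq0.
rewrite /hpt (lifts_act lB v0) (lifts_act lB (col0 _ _ _ zx012)).
rewrite (lifts_act (rhoE z mz) (unit_mulv_neq0 Bu v0)); congr proj_pt.
rewrite /tor !mulmxA mulmxKV // -mulmxA; congr (_ *m _).
apply/colP => i; rewrite dg_mul !mxE.
by have [->|->|->] := ord3P i; rewrite /= ?mul1r.
Qed.

End Conclusion.

Theorem lemma5p3 (R : realType) (X : funSpaceType R[i]) (Delta : Qdivisor X)
    (G : finSubgroup (PGL3 R[i])) :
  log_smooth_surface Delta -> quotient_pair G Delta ->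
  exists m : nat, [/\ (1 <= m)%N,
    exists phi : X -> P2 R[i], isomorphism phi /\
      exists H : 'I_3 -> set (P2 R[i]),
        [/\ forall i, line (H i), general_position H &
            forall Z, prime_divisor Z ->
              Delta (phi @^-1` Z) =
              (1 - m%:R^-1) * (\sum_(i < 3) `[< H i = Z >]%:R)] &
    diagonal_action m G].
Proof.
move=> [_ sncD] quotD.
have st p := snc_standard_stabilizer (snc_transport sncD quotD p).
have [B [m [Bu m0 hG]]] := diagonal_subgroup st.
exists m; split=> //; last exact: (diagonal_action_tor Bu m0 hG).
have [phi [phiE isophi]] := quotient_is_plane Bu m0 hG.
have [f [[g [fK gK mf mg]] DE]] := quotD.
have fg : inverse_morphisms f g by [].
have [psi [phiK psiK mphi mpsi]] := isophi.
exists (phi \o f); split.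
  exists (g \o psi); split.
  - by move=> x; rewrite /= phiK fK.
  - by move=> x; rewrite /= gK psiK.
  - move=> U /[dup] oU /mphi[oV rV]; have [oW rW] := mf _ oV; split=> // h rh.
    exact: rW (rV _ rh).
  - move=> U /[dup] oU /mg[oV rV]; have [oW rW] := mpsi _ oV; split=> // h rh.
    exact: rW (rV _ rh).
exists (fun i => lineset (side _ i)); split.
- by move=> i; exists (side _ i); split; first exact: side_neq0.
- exact: sides_general_position.
move=> Z pZ; have pZ' : prime_divisor (phi @^-1` Z).
  by apply: (transport_prime (f := psi)) pZ; split.
have pZ'' : prime_divisor (f @^-1` (phi @^-1` Z)).
  exact: transport_prime (inverse_morphisms_sym fg) _ pZ'.
rewrite -[(phi \o f) @^-1` Z]/(f @^-1` (phi @^-1` Z)) DE //.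
rewrite (image_preimage fg) (preimage_cancel (inverse_morphisms_sym fg)).
exact: (branch_coef_plane Bu m0 phiE isophi pZ).
Qed.
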